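(* Consider a linear Hopf manifold of any dimension $n\ge2$ equipped with a Bismut-Griffiths-non-negative metric $g(\alpha_0,\beta_0)$ ($\alpha_0>0$, $\beta_0>-\alpha_0$). Then: (i) the gradient flow of Streets and Tian starting at $g(\alpha_0,\beta_0)$ evolves preserving the Bismut-Griffiths-non-negativity; (ii) the Ustinovskiy flow starting at $g(\alpha_0,\beta_0)$ does not preserve the Bismut-Griffiths-non-negativity; (iii) unless $n=2$, the pluriclosed flow starting at $g(\alpha_0,\beta_0)$ does not preserve the Bismut-Griffiths-non-negativity.
   Context: A linear Hopf manifold of complex dimension $n$ is $M^n=(\mathbb C^n\setminus\{0\})/\!\sim$, where $(z_1,\dots,z_n)\sim(a_1z_1,\dots,a_nz_n)$ for fixed $(a_1,\dots,a_n)\in\mathbb C^n\setminus\{0\}$ with $|a_1|=\dots=|a_n|\ne1$, with its natural complex structure. For real $\alpha>0$, $\beta>-\alpha$, $g(\alpha,\beta)$ is the Hermitian metric $g(\alpha,\beta)_{i\bar j}=\alpha\frac{\delta_{ij}}{|z|^2}+\beta\frac{\bar z_iz_j}{|z|^4}$. The Bismut connection $\nabla^+$ of a Hermitian manifold is the unique Hermitian connection ($\nabla^+g=0$, $\nabla^+J=0$) with totally skew-symmetric torsion; its curvature tensor is $\Omega^B(X,Y,Z,W)=g(R^+(X,Y)Z,W)$, $R^+(X,Y)=[\nabla^+_X,\nabla^+_Y]-\nabla^+_{[X,Y]}$, extended complex-multilinearly. A Hermitian metric is Bismut-Griffiths-non-negative if $\Omega^B\in\wedge^{1,1}M\otimes\wedge^{1,1}M$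 and $\Omega^B(\xi,\bar\xi,\nu,\bar\nu)\ge0$ for all nonzero $\xi,\nu\in T^{1,0}M$. The Hermitian curvature flow (HCF) with coefficients $(a,b,c,d)$ is $\frac{\partial}{\partial t}g=-S+aQ^1+bQ^2+cQ^3+dQ^4$, where, with $\Omega^{Ch}$ and $T=T^{Ch}$ the curvature and torsion of the Chern connection (torsion indices lowered by $g$, $T_{ik\bar n}=T_{ik}^pg_{p\bar n}$, $T_{\bar j\bar l m}=\overline{T_{jl\bar m}}$), $S_{i\bar j}=g^{k\bar l}\Omega^{Ch}_{k\bar li\bar j}$, and $Q^1_{i\bar j}=g^{k\bar l}g^{m\bar n}T_{ik\bar n}T_{\bar j\bar lm}$, $Q^2_{i\bar j}=g^{k\bar l}g^{m\bar n}T_{km\bar j}T_{\bar l\bar ni}$, $Q^3_{i\bar j}=g^{k\bar l}g^{m\bar n}T_{ik\bar l}T_{\bar j\bar nm}$, $Q^4_{i\bar j}=\frac12g^{k\bar l}g^{m\bar n}(T_{mk\bar l}T_{\bar n\bar ji}+T_{mi\bar j}T_{\bar n\bar lk})$. The gradient flow of Streets and Tian is the HCF with $a=\frac12$, $b=-\frac14$, $c=-\frac12$, $d=1$; the Ustinovskiy flow is the HCF with $b=-\frac12$, $a=c=d=0$; the pluriclosed flow is the HCF with $a=1$, $b=c=d=0$. The flow starting at a given non-negative metric preserves the Bismut-Griffiths-non-negativity if the evolved metrics are Bismut-Griffiths-non-negative for as long as the flow exists. *)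

(* Defs.v *)
From HB Require Import structures.
From mathcomp Require Import all_boot all_order all_algebra.
From mathcomp Require Import complex.
From mathcomp Require Import all_classical all_reals all_analysis.

Set Implicit Arguments.
Unset Strict Implicit.
Unset Printing Implicit Defensive.

Import Order.TTheory GRing.Theory Num.Theory.
Import numFieldNormedType.Exports.

Local Open Scope classical_set_scope.
Local Open Scope ring_scope.
Local Open Scope complex_scope.

(* A linear Hopf manifold is the quotient of C^n \ {0} by the cyclic group
   generated by the biholomorphism z |-> (a_1 z_1, ..., a_n z_n).  Its tensor
   fields are the tensor fields on C^n \ {0} that are invariant under this map;
   all geometry below is written on C^n \ {0}, in the global coordinates z. *)

(* C^n as a real normed space: (x, y) stands for the point x + i y. *)
Definition Cn (R : realType) (n : nat) : normedModType R :=
  ('rV[R]_n * 'rV[R]_n)%type.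

Section Calculus.
Context {R : realType}.

Fixpoint Ck {V : normedModType R} (k : nat) (D : set V) (f : V -> R) : Prop :=
  {within D, continuous f} /\
  match k with
  | 0%N => True
  | k'.+1 => forall v : V, exists2 f' : V -> R,
      (forall p : V, D° p -> is_derive p v f (f' p)) & Ck k' D f'
  end.

(* Smoothness on a set D contained in the closure of its interior: all iterated
   derivatives exist in the interior and extend continuously to D.  For open D
   this is the usual notion; for D = [0, T[ x U it is smoothness up to the
   initial time. *)
Definition smooth {V : normedModType R} (D : set V) (f : V -> R[i]) : Prop :=
  forall k, Ck k D (fun p => complex.Re (f p)) /\
            Ck k D (fun p => complex.Im (f p)).

Definition cderive {V : normedModType R} (f : V -> R[i]) (p v : V) : R[i] :=
  ('D_v (fun q => complex.Re (f q)) p) +i* ('D_v (fun q => complex.Im (f q)) p).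

Context {n : nat}.

Definition zc (p : Cn R n) (i : 'I_n) : R[i] := (p.1 0 i) +i* (p.2 0 i).

Definition znorm2 (p : Cn R n) : R[i] := \sum_(i < n) `|zc p i| ^+ 2.

Definition punctured : set (Cn R n) := [set p | p != 0].

(* The complexified tangent bundle has the frame (d/dz_1, ..., d/dz_n,
   d/dzbar_1, ..., d/dzbar_n), indexed by 'I_n + 'I_n: inl i is d/dz_i and
   inr i is d/dzbar_i. *)
Definition pd (A : 'I_n + 'I_n) (f : Cn R n -> R[i]) (p : Cn R n) : R[i] :=
  match A with
  | inl i => (cderive f p (delta_mx 0 i, 0)
              - 'i%C * cderive f p (0, delta_mx 0 i)) / 2
  | inr i => (cderive f p (delta_mx 0 i, 0)
              + 'i%C * cderive f p (0, delta_mx 0 i)) / 2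
  end.

Definition barI (A : 'I_n + 'I_n) : 'I_n + 'I_n :=
  match A with inl i => inr i | inr i => inl i end.

Definition is10 (A : 'I_n + 'I_n) : bool :=
  match A with inl _ => true | inr _ => false end.

(* Eigenvalue of the complex structure J on the frame vector A. *)
Definition Jev (A : 'I_n + 'I_n) : R[i] := if is10 A then 'i%C else - 'i%C.

End Calculus.

Section HermitianGeometry.
Context {R : realType} {n : nat}.

(* A field of matrices g is read as g p i j = g_{i jbar}(p). *)
Implicit Type g : Cn R n -> 'M[R[i]]_n.

(* G p A B C is the C-component of nabla_A B, for frame vectors A, B, C. *)
Implicit Type G : Cn R n -> 'I_n + 'I_n -> 'I_n + 'I_n -> 'I_n + 'I_n -> R[i].

Definition hopf_parameter (a : 'I_n -> R[i]) : Prop :=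
  (exists i, a i != 0) /\
  (forall i j, `|a i| = `|a j|) /\ (forall i, `|a i| != 1).

Definition deck (a : 'I_n -> R[i]) (p : Cn R n) : Cn R n :=
  (\row_i complex.Re (a i * zc p i), \row_i complex.Im (a i * zc p i)).

Definition hermitian_posdef (h : 'M[R[i]]_n) : Prop :=
  (forall i j, h i j = (h j i)^*%C) /\
  (forall v : 'I_n -> R[i], (exists i, v i != 0) ->
     0 < \sum_(i < n) \sum_(j < n) h i j * v i * (v j)^*%C).

(* Hermitian metrics on the Hopf manifold of parameter a. *)
Definition hopf_metric (a : 'I_n -> R[i]) g : Prop :=
  [/\ forall i j, smooth punctured (fun p => g p i j),
      forall p, punctured p -> hermitian_posdef (g p)
    & forall p i j, punctured p ->
        g (deck a p) i j * a i * (a j)^*%C = g p i j].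

(* Complex-bilinear extension of the metric. *)
Definition gC g (p : Cn R n) (A B : 'I_n + 'I_n) : R[i] :=
  match A, B with
  | inl i, inr j => g p i j
  | inr j, inl i => g p i j
  | _, _ => 0
  end.

(* g^{k lbar}, characterized by sum_l g_{j lbar} g^{k lbar} = delta_jk; whence
   the transposition. *)
Definition ginv g (p : Cn R n) (k l : 'I_n) : R[i] := (invmx (g p)) l k.

(* The frame is holonomic, so brackets of frame vectors vanish. *)
Definition torsion G (p : Cn R n) (A B C : 'I_n + 'I_n) : R[i] :=
  G p A B C - G p B A C.

(* g(T(A, B), C) *)
Definition torsion_low g G (p : Cn R n) (A B C : 'I_n + 'I_n) : R[i] :=
  \sum_(D : 'I_n + 'I_n) torsion G p A B D * gC g p D C.

(* D-component of R(A, B) C. *)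
Definition curvature G (p : Cn R n) (A B C D : 'I_n + 'I_n) : R[i] :=
  pd A (fun q => G q B C D) p - pd B (fun q => G q A C D) p
  + \sum_(E : 'I_n + 'I_n) (G p B C E * G p A E D - G p A C E * G p B E D).

(* Omega(A, B, C, E) = g(R(A, B) C, E) *)
Definition curvature_low g G (p : Cn R n) (A B C E : 'I_n + 'I_n) : R[i] :=
  \sum_(D : 'I_n + 'I_n) curvature G p A B C D * gC g p D E.

(* The clauses say that G is real, i.e. comes from a connection on the real
   tangent bundle, that nabla g = 0, and that nabla J = 0. *)
Definition hermitian_connection g G : Prop :=
  forall p : Cn R n, punctured p ->
  [/\ forall A B C, (G p A B C)^*%C = G p (barI A) (barI B) (barI C),
      forall A B C, pd A (fun q => gC g q B C) p =
        \sum_(D : 'I_n + 'I_n) (G p A B D * gC g p D C + G p A C D * gC g p B D)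
    & forall A B C, Jev B * G p A B C = Jev C * G p A B C].

(* Each of the next two definitions determines G algebraically from g and its
   first derivatives, so smoothness and invariance of G need not be required. *)
Definition bismut_connection g G : Prop :=
  hermitian_connection g G /\
  forall p A B C, punctured p ->
    torsion_low g G p A B C = - torsion_low g G p B A C /\
    torsion_low g G p A B C = - torsion_low g G p A C B.

(* The Chern connection is the Hermitian connection whose torsion has vanishing
   (1,1)-part. *)
Definition chern_connection g G : Prop :=
  hermitian_connection g G /\
  forall p (i j : 'I_n) C, punctured p -> torsion G p (inl i) (inr j) C = 0.

Definition BG_nonneg g : Prop :=
  exists2 G, bismut_connection g G &
  let Om := curvature_low g G in
  forall p, punctured p ->
    (forall A B C D, is10 A = is10 B \/ is10 C = is10 D -> Om p A B C D = 0) /\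
    (forall xi nu : 'I_n -> R[i],
       (exists i, xi i != 0) -> (exists i, nu i != 0) ->
       0 <= \sum_(i < n) \sum_(j < n) \sum_(k < n) \sum_(l < n)
              Om p (inl i) (inr j) (inl k) (inr l)
              * xi i * (xi j)^*%C * nu k * (nu l)^*%C).

Section Terms.
Variables (g : Cn R n -> 'M[R[i]]_n)
  (G : Cn R n -> 'I_n + 'I_n -> 'I_n + 'I_n -> 'I_n + 'I_n -> R[i])
  (p : Cn R n).

(* T_{i k nbar} and T_{jbar lbar m} *)
Let T (i k m : 'I_n) : R[i] := torsion_low g G p (inl i) (inl k) (inr m).
Let Tb (j l m : 'I_n) : R[i] := (T j l m)^*%C.

Definition S_term (i j : 'I_n) : R[i] :=
  \sum_(k < n) \sum_(l < n)
    ginv g p k l * curvature_low g G p (inl k) (inr l) (inl i) (inr j).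

Definition Q1 (i j : 'I_n) : R[i] :=
  \sum_(k < n) \sum_(l < n) \sum_(m < n) \sum_(q < n)
    ginv g p k l * ginv g p m q * (T i k q * Tb j l m).

Definition Q2 (i j : 'I_n) : R[i] :=
  \sum_(k < n) \sum_(l < n) \sum_(m < n) \sum_(q < n)
    ginv g p k l * ginv g p m q * (T k m j * Tb l q i).

Definition Q3 (i j : 'I_n) : R[i] :=
  \sum_(k < n) \sum_(l < n) \sum_(m < n) \sum_(q < n)
    ginv g p k l * ginv g p m q * (T i k l * Tb j q m).

Definition Q4 (i j : 'I_n) : R[i] :=
  2^-1 * \sum_(k < n) \sum_(l < n) \sum_(m < n) \sum_(q < n)
    ginv g p k l * ginv g p m q * (T m k l * Tb q j i + T m i j * Tb q l k).

End Terms.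

(* b is the quadruple of the coefficients of Q1, Q2, Q3, Q4. *)
Definition hcf_velocity (b : R * R * R * R) g G (p : Cn R n) (i j : 'I_n) :
    R[i] :=
  let: (b1, b2, b3, b4) := b in
  - S_term g G p i j + b1%:C * Q1 g G p i j + b2%:C * Q2 g G p i j
  + b3%:C * Q3 g G p i j + b4%:C * Q4 g G p i j.

(* g is a smooth solution on [0, T[, 0 < T <= +oo, of the Hermitian curvature
   flow with coefficients b on the Hopf manifold of parameter a, with initial
   metric g0.  By smoothness up to t = 0 the equation then also holds at t = 0
   with the one-sided derivative. *)
Definition hcf_solution (a : 'I_n -> R[i]) (b : R * R * R * R) g0
    (T : \bar R) (g : R -> Cn R n -> 'M[R[i]]_n) : Prop :=
  (0 < T)%E /\
  [/\ forall p, punctured p -> g 0 p = g0 p,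
      forall t : R, 0 <= t -> (t%:E < T)%E -> hopf_metric a (g t),
      forall i j, smooth
        [set q : R * Cn R n | [/\ 0 <= q.1, (q.1%:E < T)%E & punctured q.2]]
        (fun q => g q.1 q.2 i j)
    & forall t : R, 0 < t -> (t%:E < T)%E ->
      exists2 G, chern_connection (g t) G &
      forall p i j, punctured p ->
        cderive (fun s : R => g s p i j) t 1 = hcf_velocity b (g t) G p i j].

(* Every solution starting at g0, on whatever interval [0, T[, consists of
   Bismut-Griffiths-non-negative metrics. *)
Definition preserves_BG_nonneg (a : 'I_n -> R[i]) (b : R * R * R * R) g0 :
    Prop :=
  forall (T : \bar R) (g : R -> Cn R n -> 'M[R[i]]_n),
    hcf_solution a b g0 T g ->
    forall t : R, 0 <= t -> (t%:E < T)%E -> BG_nonneg (g t).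

End HermitianGeometry.

Definition gradient_flow (R : realType) : R * R * R * R :=
  (2^-1, - 4^-1, - 2^-1, 1).
Definition ustinovskiy_flow (R : realType) : R * R * R * R :=
  (0, - 2^-1, 0, 0).
Definition pluriclosed_flow (R : realType) : R * R * R * R :=
  (1, 0, 0, 0).

Definition gab (R : realType) (n : nat) (alpha beta : R) (p : Cn R n) :
    'M[R[i]]_n :=
  \matrix_(i, j) (alpha%:C * (i == j)%:R / znorm2 p
                  + beta%:C * ((zc p i)^*%C * zc p j) / znorm2 p ^+ 2).

(* Main.v *)
Require Import Defs.
From HB Require Import structures.
From mathcomp Require Import all_boot all_order all_algebra.
From mathcomp Require Import complex.
From mathcomp Require Import all_classical all_reals all_analysis.
From mathcomp Require Import spectral sesquilinear.
From mathcomp Require Import ring lra.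
Import Order.TTheory GRing.Theory Num.Theory.
Import numFieldNormedType.Exports.
Set Implicit Arguments.
Unset Strict Implicit.
Unset Printing Implicit Defensive.
Local Open Scope classical_set_scope.
Local Open Scope ring_scope.
Local Open Scope complex_scope.

(** Unitary symmetry reduces each of the three flows to an ordinary
    differential equation, and the maximum principle shows that the solution so
    obtained is the only one.

    Let y = (alpha + beta) / alpha; with respect to g(1, 0), the metric
    g(alpha, beta) has the eigenvalues alpha + beta along the radial complex line
    and alpha across it.  Up to a positive factor the Bismut curvature of g(alpha, beta) at (xi, xibar, nu, nubar) is
    (1 - 2 y) |xi'|^2 |nu'|^2 + |(xi', nu')|^2, where the prime is the projection
    along the radial line.  For n >= 3 the vectors xi' and nu' may be orthogonal,
    and non-negativity means y <= 1/2; for n = 2 they lie on one complex line,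
    and it means y <= 1.  This is [BG_condition_sufficient] and
    [BG_condition_necessary].

    The velocity of a Hermitian curvature flow at g(alpha, beta) lies in the span
    of the two tensors that define this family ([gab_hcf_velocity]).  Hence the
    flow reads alpha' = - n + B y and (alpha + beta)' = - A y^2, where (A, B) is
    (n (n - 1) / 2, n) for the gradient flow, (n - 1, 0) for the Ustinovskiy flow
    and (0, 2) for the pluriclosed flow.  In the time tau with dt = alpha dtau
    this becomes the logistic equation y' = y (n - (A + B) y), so y moves
    monotonically to n / (A + B), which is 2 / (n + 1), n / (n - 1) and n / 2
    respectively.  The first limit does not exceed the critical value of y, the
    second always does, the third does for n >= 3 ([flow_y_bounded],
    [flow_y_exceeds]).  This settles the two negative assertions, for which one
    solution suffices ([gab_flow_not_preserves]).

    The positive assertion is about every solution ([gab_flow_preserves]), so it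
    needs uniqueness ([hcf_unique]).  The second order part of the velocity is
    the strictly elliptic operator g^{k lbar} d_k d_lbar acting on each
    component, so no gauge fixing is needed.  For two solutions g1 and g2 the
    function u = sum_ij | |z|^2 (g1 - g2)_ij |^2 is invariant under the deck
    transformation, hence attains its maximum on a compact annulus; there the
    second derivative test absorbs the first derivatives of the difference and
    leaves u' <= 2 kappa u ([gap_growth]).  Finally a solution cannot survive the
    explicit one: at the end of the life of the latter alpha tends to 0
    ([flow_al_vanishes]), whereas a metric that is smooth on a compact time
    interval stays bounded below there. *)

(** * Complex-valued functions and directional derivatives *)

Notation Rep := complex.Re.
Notation Imp := complex.Im.

Section ComplexConjugate.
Context {R : realType}.
Implicit Types x y : R[i].

Lemma conjcMx x y : (x * y)^*%C = x^*%C * y^*%C.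
Proof. by case: x; case: y => a b c d; simpc; congr (_ +i* _); ring. Qed.

Lemma conjcDx x y : (x + y)^*%C = x^*%C + y^*%C.
Proof. by case: x; case: y => a b c d; simpc; congr (_ +i* _); ring. Qed.

Lemma conjcNx x : (- x)^*%C = - x^*%C.
Proof. by case: x. Qed.

Lemma conjcBx x y : (x - y)^*%C = x^*%C - y^*%C.
Proof. by rewrite conjcDx conjcNx. Qed.

Lemma conjcXx x k : (x ^+ k)^*%C = x^*%C ^+ k.
Proof. by elim: k => [|k ih]; rewrite ?expr0 ?conjc1 // !exprS conjcMx ih. Qed.

Lemma conjc_sum (I : finType) (F : I -> R[i]) :
  (\sum_i F i)^*%C = \sum_i (F i)^*%C.
Proof. exact: (big_morph _ conjcDx (@conjc0 R)). Qed.

Definition conjcE := (conjcMx, conjcDx, conjcNx, @conjc_inv, conjcXx, @conjcK,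
  @conjc_nat, @conjc0, @conjc1, @conjc_real).

Lemma realcD (x y : R) : (x + y)%:C = x%:C + y%:C.
Proof. exact: rmorphD. Qed.

Lemma realcN (x : R) : (- x)%:C = - x%:C.
Proof. exact: rmorphN. Qed.

Lemma realcM (x y : R) : (x * y)%:C = x%:C * y%:C.
Proof. exact: rmorphM. Qed.

Lemma realcX (x : R) k : (x ^+ k)%:C = x%:C ^+ k.
Proof. exact: rmorphXn. Qed.

Lemma realcV (x : R) : (x^-1)%:C = x%:C^-1.
Proof. exact: fmorphV. Qed.

Lemma realc_nat k : (k%:R : R)%:C = k%:R.
Proof. exact: rmorph_nat. Qed.

Lemma realc1 : (1 : R)%:C = 1.
Proof. by []. Qed.

Definition realcE := (realcX, realcD, realcN, realcM, realcV, realc_nat, realc1).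

End ComplexConjugate.

Section ComplexDerivative.
Context {R : realType} {V : normedModType R}.
Implicit Types (f g : V -> R[i]) (p v : V).

Definition is_cderive f p v (d : R[i]) :=
  is_derive p v (fun q => Rep (f q)) (Rep d) /\
  is_derive p v (fun q => Imp (f q)) (Imp d).

Lemma is_cderive_near f g p v d :
  (\forall q \near p, f q = g q) -> is_cderive f p v d -> is_cderive g p v d.
Proof.
by move=> fg [a b]; split; [apply: near_eq_is_derive a|apply: near_eq_is_derive b];
  apply: filterS fg => q ->.
Qed.

Lemma cderiveE f p v d : is_cderive f p v d -> cderive f p v = d.
Proof.
move=> [a b]; rewrite /cderive (@derive_val _ _ _ _ _ _ _ a).
by rewrite (@derive_val _ _ _ _ _ _ _ b); case: d {a b}.
Qed.

Lemma is_cderive_cst (c : R[i]) p v : is_cderive (fun=> c) p v 0.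
Proof. by split; exact: is_derive_cst. Qed.

Lemma is_cderiveD f g p v df dg : is_cderive f p v df -> is_cderive g p v dg ->
  is_cderive (fun q => f q + g q) p v (df + dg).
Proof.
move=> [a b] [c d]; split.
  rewrite raddfD /=; under eq_fun do rewrite raddfD /=; exact: is_deriveD.
rewrite raddfD /=; under eq_fun do rewrite raddfD /=; exact: is_deriveD.
Qed.

Lemma is_cderiveN f p v df : is_cderive f p v df ->
  is_cderive (fun q => - f q) p v (- df).
Proof.
move=> [a b]; split.
  rewrite raddfN /=; under eq_fun do rewrite raddfN /=; exact: is_deriveN.
rewrite raddfN /=; under eq_fun do rewrite raddfN /=; exact: is_deriveN.
Qed.

Lemma Re_mul (x y : R[i]) : Rep (x * y) = Rep x * Rep y - Imp x * Imp y.
Proof. by case: x; case: y. Qed.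

Lemma Im_mul (x y : R[i]) : Imp (x * y) = Rep x * Imp y + Imp x * Rep y.
Proof. by case: x; case: y. Qed.

Lemma is_cderiveM f g p v df dg : is_cderive f p v df -> is_cderive g p v dg ->
  is_cderive (fun q => f q * g q) p v (df * g p + f p * dg).
Proof.
move=> [a b] [c d]; split.
  under eq_fun do rewrite Re_mul.
  apply: is_derive_eq.
  rewrite !raddfD /= !Re_mul /GRing.scale /=; ring.
under eq_fun do rewrite Im_mul.
apply: is_derive_eq.
rewrite !raddfD /= !Im_mul /GRing.scale /=; ring.
Qed.

Lemma is_cderive_conj f p v df : is_cderive f p v df ->
  is_cderive (fun q => (f q)^*%C) p v (df^*%C).
Proof.
move=> [a b]; have ReJ (x : R[i]) : Rep x^*%C = Rep x by case: x.
have ImJ (x : R[i]) : Imp x^*%C = - Imp x by case: x.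
split; first by rewrite ReJ; under eq_fun do rewrite ReJ.
by rewrite ImJ; under eq_fun do rewrite ImJ; exact: is_deriveN.
Qed.

Lemma is_cderive_sum (I : finType) (F : I -> V -> R[i]) (dF : I -> R[i]) p v :
  (forall i, is_cderive (F i) p v (dF i)) ->
  is_cderive (fun q => \sum_i F i q) p v (\sum_i dF i).
Proof.
move=> h; have: forall s : seq I,
  is_cderive (fun q => \sum_(i <- s) F i q) p v (\sum_(i <- s) dF i); last exact.
elim=> [|i s ih].
  by rewrite big_nil; under eq_fun do rewrite big_nil; exact: is_cderive_cst.
by rewrite big_cons; under eq_fun do rewrite big_cons; exact: is_cderiveD.
Qed.

Lemma is_cderiveV f p v df : f p != 0 -> is_cderive f p v df ->
  is_cderive (fun q => (f q)^-1) p v (- df / f p ^+ 2).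
Proof.
move=> fp0 [a b].
pose N q := Rep (f q) * Rep (f q) + Imp (f q) * Imp (f q).
have Np0 : N p != 0.
  move: fp0; rewrite /N; case: (f p) => x y; rewrite eq_complex /= negb_and => h.
  rewrite -!expr2 paddr_eq0 ?sqr_ge0 // !expf_eq0 /= negb_and; exact: h.
have dN : is_derive p v N (2 * (Rep (f p) * Rep df + Imp (f p) * Imp df)).
  by rewrite /N; apply: is_derive_eq; rewrite /GRing.scale /=; ring.
have dV : is_derive p v (fun q => (N q)^-1)
    (- N p ^- 2 *: (2 * (Rep (f p) * Rep df + Imp (f p) * Imp df))).
  apply: DeriveDef; first by apply: derivableV => //; case: dN.
  by rewrite deriveV //; case: dN => // _ ->.
have ReV (x : R[i]) : Rep x^-1 = Rep x * (Rep x * Rep x + Imp x * Imp x)^-1.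
  by case: x => x y; rewrite /= !expr2.
have ImV (x : R[i]) : Imp x^-1 = - (Imp x * (Rep x * Rep x + Imp x * Imp x)^-1).
  by case: x => x y; rewrite /= !expr2.
have N2 : Rep (f p ^+ 2) * Rep (f p ^+ 2) + Imp (f p ^+ 2) * Imp (f p ^+ 2) = N p ^+ 2.
  by rewrite expr2 !Re_mul !Im_mul /N; ring.
split.
  under eq_fun do rewrite ReV.
  apply: (@is_derive_eq _ _ _ _ _ _ _ _ (is_deriveM a dV)).
  rewrite Re_mul ReV ImV N2 expr2 Re_mul Im_mul !raddfN /= /GRing.scale /=.
  move: Np0; rewrite /N; set x := Rep (f p); set y := Imp (f p) => Np0.
  by field; rewrite Np0.
under eq_fun do rewrite ImV.
apply: (@is_derive_eq _ _ _ _ _ _ _ _ (is_deriveN (is_deriveM b dV))).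
rewrite Im_mul ReV ImV N2 expr2 Re_mul Im_mul !raddfN /= /GRing.scale /=.
move: Np0; rewrite /N; set x := Rep (f p); set y := Imp (f p) => Np0.
by field; rewrite Np0.
Qed.

(** Differentiability along each direction separately, which is all that the
    frame derivatives see. *)
Definition cdiff f p := forall v, exists d, is_cderive f p v d.

Lemma cdiffP f p v : cdiff f p -> is_cderive f p v (cderive f p v).
Proof. by move=> /(_ v)[d h]; rewrite (cderiveE h). Qed.

Lemma cdiff_near f g p : (\forall q \near p, f q = g q) -> cdiff f p -> cdiff g p.
Proof. by move=> fg h v; have [d ?] := h v; exists d; apply: is_cderive_near fg _. Qed.

Lemma cdiff_cst (c : R[i]) p : cdiff (fun=> c) p.
Proof. by move=> v; exists 0; exact: is_cderive_cst. Qed.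

Lemma cdiffD f g p : cdiff f p -> cdiff g p -> cdiff (fun q => f q + g q) p.
Proof. by move=> a b v; eexists; apply: is_cderiveD; exact: cdiffP. Qed.

Lemma cdiffN f p : cdiff f p -> cdiff (fun q => - f q) p.
Proof. by move=> a v; eexists; apply: is_cderiveN; exact: cdiffP. Qed.

Lemma cdiffM f g p : cdiff f p -> cdiff g p -> cdiff (fun q => f q * g q) p.
Proof. by move=> a b v; eexists; apply: is_cderiveM; exact: cdiffP. Qed.

Lemma cdiffV f p : f p != 0 -> cdiff f p -> cdiff (fun q => (f q)^-1) p.
Proof. by move=> a b v; eexists; apply: is_cderiveV => //; exact: cdiffP. Qed.

Lemma cdiff_conj f p : cdiff f p -> cdiff (fun q => (f q)^*%C) p.
Proof. by move=> a v; eexists; apply: is_cderive_conj; exact: cdiffP. Qed.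

Lemma cdiff_sum (I : finType) (F : I -> V -> R[i]) p :
  (forall i, cdiff (F i) p) -> cdiff (fun q => \sum_i F i q) p.
Proof.
by move=> h v; eexists; apply: is_cderive_sum => i; apply: cdiffP; exact: h.
Qed.

Lemma cdiff_prod (I : finType) (F : I -> V -> R[i]) p :
  (forall i, cdiff (F i) p) -> cdiff (fun q => \prod_i F i q) p.
Proof.
move=> h; have: forall s : seq I, cdiff (fun q => \prod_(i <- s) F i q) p; last exact.
elim=> [|i s ih].
  by under eq_fun do rewrite big_nil; exact: cdiff_cst.
by under eq_fun do rewrite big_cons; exact: cdiffM.
Qed.

End ComplexDerivative.

(** * Wirtinger derivatives *)

(** The difference quotient of a linear function is constant. *)
Lemma is_derive_linear {R : realType} {V : normedModType R} (f : V -> R) p v :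
  (forall a u w, f (a *: u + w) = a * f u + f w) -> is_derive p v f (f v).
Proof.
move=> fl.
have c : (fun h : R => h^-1 *: ((f \o shift p) (h *: v) - f p)) @ 0^' --> f v.
  apply: (@cvg_trans _ ((fun=> f v) @ (0 : R)^')); last exact: cvg_cst.
  apply: near_eq_cvg; near=> h.
  have h0 : h != 0 by near: h; exact: nbhs_dnbhs_neq.
  by rewrite /= fl addrK /GRing.scale /= mulKf.
by apply: DeriveDef; [apply/cvg_ex; exists (f v)|exact: cvg_lim].
Unshelve. all: by end_near. Qed.

Section Wirtinger.
Context {R : realType} {n : nat}.
Implicit Types (f g : Cn R n -> R[i]) (p v : Cn R n) (A B : 'I_n + 'I_n).

(** The real directions d/dx_i and d/dy_i that make up both d/dz_i and
    d/dzbar_i. *)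
Definition xdir A : Cn R n :=
  match A with inl i => (delta_mx 0 i, 0) | inr i => (delta_mx 0 i, 0) end.
Definition ydir A : Cn R n :=
  match A with inl i => (0, delta_mx 0 i) | inr i => (0, delta_mx 0 i) end.

Lemma pdE A f p :
  pd A f p = (cderive f p (xdir A) - Jev A * cderive f p (ydir A)) / 2.
Proof. by case: A => i; rewrite /pd /Jev //= mulNr opprK. Qed.

Lemma is_pd A f p a b : is_cderive f p (xdir A) a -> is_cderive f p (ydir A) b ->
  pd A f p = (a - Jev A * b) / 2.
Proof. by move=> h k; rewrite pdE (cderiveE h) (cderiveE k). Qed.

Lemma pd_near A f g p : (\forall q \near p, f q = g q) -> pd A f p = pd A g p.
Proof.
move=> fg; have h v : cderive f p v = cderive g p v.
  rewrite /cderive (@near_eq_derive _ _ _ _ (fun q => Rep (g q))); last first.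
    by apply: filterS fg => q ->.
  rewrite (@near_eq_derive _ _ _ (fun q => Imp (f q)) (fun q => Imp (g q))) //.
  by apply: filterS fg => q ->.
by rewrite !pdE !h.
Qed.

Lemma pd_cst A (c : R[i]) p : pd A (fun=> c) p = 0.
Proof.
by rewrite (is_pd (is_cderive_cst _ _ _) (is_cderive_cst _ _ _)) mulr0 subr0 mul0r.
Qed.

Lemma pdD A f g p : cdiff f p -> cdiff g p ->
  pd A (fun q => f q + g q) p = pd A f p + pd A g p.
Proof.
move=> a b; rewrite !pdE.
rewrite (cderiveE (is_cderiveD (cdiffP (xdir A) a) (cdiffP (xdir A) b))).
rewrite (cderiveE (is_cderiveD (cdiffP (ydir A) a) (cdiffP (ydir A) b))).
move: (cderive f p (xdir A)) (cderive f p (ydir A)) (Jev A) => x y J.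
by move: (cderive g p (xdir A)) (cderive g p (ydir A)) => z t; ring.
Qed.

Lemma pdN A f p : cdiff f p -> pd A (fun q => - f q) p = - pd A f p.
Proof.
move=> a; rewrite !pdE (cderiveE (is_cderiveN (cdiffP (xdir A) a))).
rewrite (cderiveE (is_cderiveN (cdiffP (ydir A) a))).
by move: (cderive f p (xdir A)) (cderive f p (ydir A)) (Jev A) => x y J; ring.
Qed.

Lemma pdM A f g p : cdiff f p -> cdiff g p ->
  pd A (fun q => f q * g q) p = pd A f p * g p + f p * pd A g p.
Proof.
move=> a b; rewrite !pdE.
rewrite (cderiveE (is_cderiveM (cdiffP (xdir A) a) (cdiffP (xdir A) b))).
rewrite (cderiveE (is_cderiveM (cdiffP (ydir A) a) (cdiffP (ydir A) b))).
move: (cderive f p (xdir A)) (cderive f p (ydir A)) (Jev A) => x y J.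
move: (cderive g p (xdir A)) (cderive g p (ydir A)) => z t.
by move: (f p) (g p) => u w; ring.
Qed.

Lemma pdV A f p : f p != 0 -> cdiff f p ->
  pd A (fun q => (f q)^-1) p = - pd A f p / f p ^+ 2.
Proof.
move=> fp a; rewrite !pdE (cderiveE (is_cderiveV fp (cdiffP (xdir A) a))).
rewrite (cderiveE (is_cderiveV fp (cdiffP (ydir A) a))).
move: fp (cderive f p (xdir A)) (cderive f p (ydir A)) (Jev A) => + x y J.
by move: (f p) => u u0; field; rewrite u0.
Qed.

Lemma pd_sum A (I : finType) (F : I -> Cn R n -> R[i]) p :
  (forall i, cdiff (F i) p) ->
  pd A (fun q => \sum_i F i q) p = \sum_i pd A (F i) p.
Proof.
move=> h; rewrite pdE.
rewrite (cderiveE (is_cderive_sum (fun i => cdiffP (xdir A) (h i)))).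
rewrite (cderiveE (is_cderive_sum (fun i => cdiffP (ydir A) (h i)))).
rewrite mulr_sumr -sumrB mulr_suml; apply: eq_bigr => i _; by rewrite pdE.
Qed.

Lemma barIK : involutive (@barI n). Proof. by case. Qed.

Lemma Jev_bar A : Jev (barI A) = (Jev A : R[i])^*%C.
Proof. by case: A => i; rewrite /Jev /= ?rmorphN /=; simpc. Qed.

(** Conjugation exchanges d/dz_i and d/dzbar_i, because Jev is conjugated by
    barI. *)
Lemma pd_conj A f p : cdiff f p ->
  pd A (fun q => (f q)^*%C) p = (pd (barI A) f p)^*%C.
Proof.
move=> a; rewrite !pdE (cderiveE (is_cderive_conj (cdiffP (xdir A) a))).
rewrite (cderiveE (is_cderive_conj (cdiffP (ydir A) a))).
have -> : xdir (barI A) = xdir A by case: (A).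
have -> : ydir (barI A) = ydir A by case: (A).
rewrite Jev_bar.
have h (x y J : R[i]) : (x^*%C - J * y^*%C) / 2 = ((x - J^*%C * y) / 2)^*%C.
  by rewrite !conjcE.
exact: h.
Qed.

Lemma is_cderive_zc i p v : is_cderive (fun q => zc q i) p v (zc v i).
Proof.
split; rewrite /zc /=.
  by apply: (is_derive_linear (f := fun q : Cn R n => q.1 0 i)) => a u w; rewrite !mxE.
by apply: (is_derive_linear (f := fun q : Cn R n => q.2 0 i)) => a u w; rewrite !mxE.
Qed.

Lemma cdiff_zc i p : cdiff (fun q => zc q i) p.
Proof. by move=> v; eexists; exact: is_cderive_zc. Qed.

Lemma mulii : 'i%C * 'i%C = -1 :> R[i].
Proof. by rewrite -expr2 sqr_i. Qed.

Lemma pd_zc A i p :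
  pd A (fun q => zc q i) p = if A is inl k then (k == i)%:R else 0.
Proof.
rewrite (is_pd (is_cderive_zc _ _ _) (is_cderive_zc _ _ _)).
have zx k : zc (delta_mx 0 k, 0) i = (k == i)%:R :> R[i].
  by rewrite /zc !mxE /= eq_sym; case: eqP => _.
have zy k : zc (0, delta_mx 0 k) i = 'i%C * (k == i)%:R :> R[i].
  by rewrite /zc !mxE /= eq_sym; case: eqP => _; rewrite ?mulr1 ?mulr0.
case: A => k; rewrite /Jev /= zx zy mulrA.
  by move: ((k == i)%:R : R[i]) => e; rewrite mulii; field.
by move: ((k == i)%:R : R[i]) => e; rewrite mulNr mulii; field.
Qed.

Lemma pd_zbar A i p :
  pd A (fun q => (zc q i)^*%C) p = if A is inr k then (k == i)%:R else 0.
Proof.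
rewrite pd_conj; last exact: cdiff_zc.
by rewrite pd_zc; case: A => k; rewrite /barI ?conjc0 ?conjc_nat.
Qed.

Lemma znorm2E p : znorm2 p = \sum_i zc p i * (zc p i)^*%C.
Proof. by apply: eq_bigr => i _; rewrite sqr_normc. Qed.

Lemma znorm2_ge0 p : 0 <= znorm2 p.
Proof. by apply: sumr_ge0 => i _; rewrite exprn_ge0. Qed.

Lemma znorm2_eq0 p : (znorm2 p == 0) = (p == 0).
Proof.
apply/eqP/eqP => [|->]; last first.
  by apply: big1 => i _; rewrite /zc !mxE normr0 expr0n.
move=> /eqP; rewrite psumr_eq0; last by move=> i _; rewrite exprn_ge0.
move=> /allP h; have z i : zc p i = 0.
  by apply/eqP; have := h i (mem_index_enum _); rewrite /= expf_eq0 /= normr_eq0.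
case: p h z => x y _ z; congr (_, _); apply/rowP => i; rewrite mxE.
  by case: (z i).
by case: (z i).
Qed.

Lemma punctured_r p : punctured p -> znorm2 p != 0.
Proof. by rewrite znorm2_eq0. Qed.

Lemma cdiff_r p : cdiff (@znorm2 R n) p.
Proof.
have -> : @znorm2 R n = fun q => \sum_i zc q i * (zc q i)^*%C.
  by apply/funext => q; exact: znorm2E.
apply: cdiff_sum => i; apply: cdiffM; first exact: cdiff_zc.
by apply: cdiff_conj; exact: cdiff_zc.
Qed.

Lemma pd_r A p : pd A (@znorm2 R n) p =
  match A with inl k => (zc p k)^*%C | inr k => zc p k end.
Proof.
have -> : @znorm2 R n = fun q => \sum_i zc q i * (zc q i)^*%C.
  by apply/funext => q; exact: znorm2E.
have d i : cdiff (fun q : Cn R n => zc q i) p by exact: cdiff_zc.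
rewrite pd_sum; last by move=> i; apply: cdiffM => //; exact: cdiff_conj.
rewrite (eq_bigr (fun i => (if A is inl k then (k == i)%:R else 0) * (zc p i)^*%C
  + zc p i * (if A is inr k then (k == i)%:R else 0))); last first.
  by move=> i _; rewrite pdM // ?pd_zc ?pd_zbar //; exact: cdiff_conj.
case: A => k.
  rewrite (bigD1 k) //= eqxx mul1r mulr0 addr0 big1 ?addr0 // => i ik.
  by rewrite eq_sym (negbTE ik) mul0r mulr0 addr0.
rewrite (bigD1 k) //= eqxx mul0r mulr1 add0r big1 ?addr0 // => i ik.
by rewrite eq_sym (negbTE ik) mul0r mulr0 addr0.
Qed.

(** Identities between fields that hold off the origin can be differentiated
    there. *)
Lemma near_punctured p : punctured p -> \forall q \near p, punctured q.
Proof.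
move=> p0; apply: open_nbhs_nbhs; split => //.
suff -> : @punctured R n = ~` [set 0] by apply: closed_openC; apply: accessible_closed_set1; apply: hausdorff_accessible; exact: norm_hausdorff.
by apply/seteqP; split => q /=; move/eqP.
Qed.

End Wirtinger.

(** * Inverse metrics and Hermitian connections *)

Section CkComplex.
Context {R : realType} {V : normedModType R}.
Implicit Types (D : set V) (f : V -> R[i]).

(** One order of the smoothness hypothesis, for complex-valued functions. *)
Definition cCk k D f := Ck k D (fun q => Rep (f q)) /\ Ck k D (fun q => Imp (f q)).

Lemma smooth_cCk k D f : smooth D f -> cCk k D f.
Proof. by move=> /(_ k). Qed.

Lemma cCkS k D f v : cCk k.+1 D f ->
  exists2 f', (forall p, D° p -> is_cderive f p v (f' p)) & cCk k D f'.
Proof.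
move=> [[_ /(_ v)[f1 h1 c1]] [_ /(_ v)[f2 h2 c2]]].
by exists (fun q => f1 q +i* f2 q) => // p Dp; split; [exact: h1|exact: h2].
Qed.

Lemma cCk_cdiff k D f p : cCk k.+1 D f -> D° p -> cdiff f p.
Proof. by move=> h Dp v; have [f' hf' _] := cCkS v h; exists (f' p); exact: hf'. Qed.

End CkComplex.

Lemma sum_delta (A : pzSemiRingType) n (F : 'I_n -> A) k :
  \sum_l F l * (l == k)%:R = F k.
Proof.
rewrite (bigD1 k) //= eqxx mulr1 big1 ?addr0 // => i /negbTE ->.
by rewrite mulr0.
Qed.

Lemma sum_delta' (A : pzSemiRingType) n (F : 'I_n -> A) k :
  \sum_l F l * (k == l)%:R = F k.
Proof. by under eq_bigr do rewrite eq_sym; exact: sum_delta. Qed.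

Section HermitianBasics.
Context {R : realType} {n : nat}.
Implicit Types (g : Cn R n -> 'M[R[i]]_n) (p : Cn R n) (f : Cn R n -> R[i]).

Lemma cCk2_cdiff_pd (D : set (Cn R n)) f A p : cCk 2 D f -> open D -> D p ->
  cdiff (pd A f) p.
Proof.
move=> h oD Dp; have [f1 h1 c1] := cCkS (xdir A) h.
have [f2 h2 c2] := cCkS (ydir A) h.
have ip q : D q -> D° q by rewrite (interior_id _).1.
apply: (@cdiff_near _ _ (fun q => (f1 q - Jev A * f2 q) / 2)).
  near=> q; symmetry; have Dq : D° q.
    by apply: ip; near: q; apply: open_nbhs_nbhs.
  by apply: is_pd; [exact: h1|exact: h2].
apply: cdiffM; last exact: cdiff_cst.
apply: cdiffD; first by apply: cCk_cdiff c1 _; exact: ip.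
by apply: cdiffN; apply: cdiffM; [exact: cdiff_cst|apply: cCk_cdiff c2 _; exact: ip].
Unshelve. all: by end_near. Qed.

Lemma posdef_unit (h : 'M[R[i]]_n) : hermitian_posdef h -> h \in unitmx.
Proof.
move=> [_ hp]; rewrite unitmxE unitfE; apply/negP => /det0P[v v0 vh].
have /(hp (fun i => v 0 i)) : exists i, v 0 i != 0.
  apply: contrapT => hv; case/negP: v0; apply/eqP/rowP => i; rewrite mxE.
  by apply/eqP/negPn/negP => vi; apply: hv; exists i.
rewrite exchange_big /= big1 ?ltxx // => j _.
rewrite -mulr_suml; have /rowP/(_ j) := vh; rewrite !mxE => e.
by rewrite (eq_bigr (fun i => v 0 i * h i j)) ?e ?mul0r // => i _; rewrite mulrC.
Qed.

Lemma ginv_low g p j k : g p \in unitmx ->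
  \sum_l g p j l * ginv g p k l = (j == k)%:R.
Proof. by move=> /mulmxV/matrixP/(_ j k); rewrite !mxE. Qed.

Lemma ginv_low' g p l m : g p \in unitmx ->
  \sum_k ginv g p k m * g p k l = (m == l)%:R.
Proof. by move=> /mulVmx/matrixP/(_ m l); rewrite !mxE. Qed.

(** Exhibiting g^{k lbar} with g_{j lbar} g^{k lbar} = delta_jk proves at
    once that g is invertible and that this is its inverse. *)
Lemma ginv_unique g p (M : 'I_n -> 'I_n -> R[i]) :
  (forall j k, \sum_l g p j l * M k l = (j == k)%:R) ->
  g p \in unitmx /\ forall k l, ginv g p k l = M k l.
Proof.
move=> h; pose N : 'M[R[i]]_n := \matrix_(l, k) M k l.
have gN : g p *m N = 1%:M.
  apply/matrixP => j k; rewrite !mxE -h; apply: eq_bigr => l _; by rewrite mxE.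
have [u _] := mulmx1_unit gN; split => // k l.
by rewrite /ginv -[invmx _]mulmx1 -gN mulmxA mulVmx // mul1mx mxE.
Qed.

(** Connection coefficients are only known after lowering an index with g;
    invertibility of g recovers them. *)
Lemma raise_unique g p (X : 'I_n -> R[i]) (Y : 'I_n -> R[i]) : g p \in unitmx ->
  (forall j, \sum_d X d * g p d j = Y j) ->
  forall d, X d = \sum_l ginv g p d l * Y l.
Proof.
move=> u h d; under eq_bigr do rewrite -h mulr_sumr.
rewrite exchange_big /= -(sum_delta X d); apply: eq_bigr => e _.
rewrite -(ginv_low e d u) mulr_sumr; apply: eq_bigr => l _.
by move: (X e) (ginv g p d l) (g p e l) => x y z; ring.
Qed.

Lemma raise_low g p (Y : 'I_n -> R[i]) j : g p \in unitmx ->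
  \sum_d (\sum_l ginv g p d l * Y l) * g p d j = Y j.
Proof.
move=> u; rewrite -[RHS](sum_delta Y j).
rewrite (eq_bigr (fun d => \sum_l Y l * (ginv g p d l * g p d j))).
  by rewrite exchange_big; apply: eq_bigr => l _; rewrite -mulr_sumr ginv_low'.
by move=> d _; rewrite mulr_suml; apply: eq_bigr => l _; rewrite mulrAC mulrC.
Qed.

Lemma cdiff_det m (M : Cn R n -> 'M[R[i]]_m) p :
  (forall i j, cdiff (fun q => M q i j) p) -> cdiff (fun q => \det (M q)) p.
Proof.
move=> h; rewrite /determinant; apply: cdiff_sum => s.
by apply: cdiffM; [exact: cdiff_cst|exact: cdiff_prod].
Qed.

(** Cramer: near an invertible matrix the inverse is the adjugate divided by
    the determinant. *)
Lemma cdiff_ginv g p k l : (\forall q \near p, g q \in unitmx) ->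
  (forall i j, cdiff (fun q => g q i j) p) -> cdiff (fun q => ginv g q k l) p.
Proof.
move=> u h.
apply: (@cdiff_near _ _ (fun q => (\det (g q))^-1 * \adj (g q) l k)).
  by apply: filterS u => q uq; rewrite /ginv /invmx uq !mxE.
apply: cdiffM; last first.
  under eq_fun do rewrite mxE /cofactor.
  apply: cdiffM; first exact: cdiff_cst.
  by apply: cdiff_det => i j; under eq_fun do rewrite !mxE; exact: h.
apply: cdiffV; last exact: cdiff_det.
by have := nbhs_singleton u; rewrite unitmxE unitfE.
Qed.

Lemma sum_frame (F : 'I_n + 'I_n -> R[i]) :
  \sum_D F D = \sum_d F (inl d) + \sum_d F (inr d).
Proof. exact: big_sumType. Qed.

(** The properties of a metric that determine its connections and allow their
    curvatures to be computed. *)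
Definition regular_metric g := forall p, punctured p ->
  [/\ g p \in unitmx, forall i j, g p i j = (g p j i)^*%C,
      forall i j, cdiff (fun q => g q i j) p
    & forall A i j, cdiff (pd A (fun q => g q i j)) p].

Lemma open_punctured : open (@punctured R n).
Proof. by rewrite openE => p /= /near_punctured. Qed.

Lemma interior_punctured p : punctured p -> (@punctured R n)° p.
Proof. by rewrite (interior_id _).1 //; exact: open_punctured. Qed.

Lemma hopf_metric_regular a g : hopf_metric a g -> regular_metric g.
Proof.
move=> [sm pos _] p pp; split.
- exact: posdef_unit (pos _ pp).
- by case: (pos _ pp).
- move=> i j; apply: (cCk_cdiff (k := 0) (smooth_cCk 1 (sm i j))).
  exact: interior_punctured.
- move=> A i j; apply: (cCk2_cdiff_pd A (smooth_cCk 2 (sm i j)) open_punctured pp).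
Qed.

(** Hermitian symmetry turns dbar derivatives of g into conjugates of d
    derivatives. *)
Lemma pd_bar_metric g A p i j : regular_metric g -> punctured p ->
  pd (barI A) (fun q => g q i j) p = (pd A (fun q => g q j i) p)^*%C.
Proof.
move=> rg pp; rewrite -[A in RHS]barIK -pd_conj; last by case: (rg p pp).
apply: pd_near; near=> q; have pq : punctured q by near: q; exact: near_punctured.
by case: (rg q pq).
Unshelve. all: by end_near. Qed.

(** The clause nabla J = 0 kills the components of G that mix types, since i
    and - i differ. *)
Lemma J_mixed (x : R[i]) : 'i%C * x = - 'i%C * x -> x = 0.
Proof.
move=> h; have : 2 * 'i%C * x = 0 :> R[i].
  by rewrite -mulrA mulr_natl mulr2n {1}h mulNr addNr.
move=> /eqP; rewrite !mulf_eq0 pnatr_eq0 /= eq_complex /= oner_eq0 andbF /=.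
by move/eqP.
Qed.

Section HermitianConnection.
Variables (g : Cn R n -> 'M[R[i]]_n)
  (G : Cn R n -> 'I_n + 'I_n -> 'I_n + 'I_n -> 'I_n + 'I_n -> R[i]).
Hypothesis hG : hermitian_connection g G.

Lemma hc_lr p A i j : punctured p -> G p A (inl i) (inr j) = 0.
Proof. by move=> pp; have [_ _ h] := hG pp; apply: J_mixed; exact: (h A (inl i) (inr j)). Qed.

Lemma hc_rl p A i j : punctured p -> G p A (inr i) (inl j) = 0.
Proof. by move=> pp; have [_ _ h] := hG pp; apply: J_mixed; symmetry; exact: (h A (inr i) (inl j)). Qed.

Lemma hc_bar p A B C : punctured p ->
  G p (barI A) (barI B) (barI C) = (G p A B C)^*%C.
Proof. by move=> pp; have [-> _ _] := hG pp. Qed.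

Lemma hc_metric p A i j : punctured p -> pd A (fun q => g q i j) p =
  \sum_d G p A (inl i) (inl d) * g p d j + \sum_d G p A (inr j) (inr d) * g p i d.
Proof.
move=> pp; have [_ h _] := hG pp; have := h A (inl i) (inr j).
rewrite sum_frame => ->; congr (_ + _); apply: eq_bigr => d _ /=.
  by rewrite mulr0 addr0.
by rewrite mulr0 add0r.
Qed.

End HermitianConnection.

End HermitianBasics.

(** * The Chern and Bismut connections *)

Section Tensors.
Context {R : realType} {n : nat}.
Implicit Types (H : 'I_n -> 'I_n -> R[i]) (T : 'I_n -> 'I_n -> 'I_n -> R[i]).

(** The quadratic terms Q^1, ..., Q^4 as contractions of an arbitrary inverse
    metric and torsion, so that they can be evaluated or compared without
    reference to a connection. *)
Definition q1 H T i j : R[i] :=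
  \sum_(k < n) \sum_(l < n) \sum_(m < n) \sum_(q < n)
    H k l * H m q * (T i k q * (T j l m)^*%C).
Definition q2 H T i j : R[i] :=
  \sum_(k < n) \sum_(l < n) \sum_(m < n) \sum_(q < n)
    H k l * H m q * (T k m j * (T l q i)^*%C).
Definition q3 H T i j : R[i] :=
  \sum_(k < n) \sum_(l < n) \sum_(m < n) \sum_(q < n)
    H k l * H m q * (T i k l * (T j q m)^*%C).
Definition q4 H T i j : R[i] :=
  2^-1 * \sum_(k < n) \sum_(l < n) \sum_(m < n) \sum_(q < n)
    H k l * H m q * (T m k l * (T q j i)^*%C + T m i j * (T q l k)^*%C).

Definition hcf_algebraic (b : R * R * R * R) (S : 'I_n -> 'I_n -> R[i]) H T i j
    : R[i] :=
  let: (b1, b2, b3, b4) := b in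
  - S i j + b1%:C * q1 H T i j + b2%:C * q2 H T i j
  + b3%:C * q3 H T i j + b4%:C * q4 H T i j.

End Tensors.

Section Connections.
Context {R : realType} {n : nat}.
Implicit Types (g : Cn R n -> 'M[R[i]]_n) (p : Cn R n).

Definition chern_torsion g p (i k m : 'I_n) : R[i] :=
  pd (inl i) (fun q => g q k m) p - pd (inl k) (fun q => g q i m) p.

Definition chern_gamma g p (k i d : 'I_n) : R[i] :=
  \sum_l ginv g p d l * pd (inl k) (fun q => g q i l) p.

(** The term S of the flow written in g and its first two derivatives: the
    curvature of the Chern connection is - dbar Gamma, and Gamma_lowered = d
    g. *)
Definition chern_S g p (i j : 'I_n) : R[i] :=
  \sum_k \sum_l ginv g p k l *
    (- pd (inr l) (pd (inl k) (fun q => g q i j)) p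
     + \sum_d chern_gamma g p k i d * pd (inr l) (fun q => g q d j) p).

Section Chern.
Variables (g : Cn R n -> 'M[R[i]]_n)
  (G : Cn R n -> 'I_n + 'I_n -> 'I_n + 'I_n -> 'I_n + 'I_n -> R[i]).
Hypothesis (rg : regular_metric g) (cG : chern_connection g G).
Let hG : hermitian_connection g G := proj1 cG.

(** The vanishing (1,1) torsion equates a mixed component with one excluded
    by nabla J = 0. *)
Lemma chern_lrr p i j C : punctured p -> G p (inl i) (inr j) C = 0.
Proof.
move=> pp; case: C => c; first exact: (hc_lr hG) || exact: (hc_rl hG).
have := proj2 cG p i j (inr c) pp; rewrite /torsion => /subr0_eq ->.
exact: (hc_lr hG).
Qed.

Lemma chern_rll p i j C : punctured p -> G p (inr j) (inl i) C = 0.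
Proof.
move=> pp; have := proj2 cG p i j C pp; rewrite /torsion => /subr0_eq <-.
exact: chern_lrr.
Qed.

(** The derivative of dbar_j along d_k vanishes, so metricity along d_k keeps
    one term only. *)
Lemma chern_lower p k i j : punctured p ->
  \sum_d G p (inl k) (inl i) (inl d) * g p d j = pd (inl k) (fun q => g q i j) p.
Proof.
move=> pp; rewrite (hc_metric hG) // [X in _ = _ + X]big1 ?addr0 // => d _.
by rewrite chern_lrr // mul0r.
Qed.

Lemma chern_gammaE p k i d : punctured p ->
  G p (inl k) (inl i) (inl d) = chern_gamma g p k i d.
Proof.
move=> pp; have [u _ _ _] := rg pp.
by apply: (raise_unique (X := fun d => G p (inl k) (inl i) (inl d)) u) => j;
  exact: chern_lower.
Qed.

Lemma chern_torsionE p i k m : punctured p ->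
  torsion_low g G p (inl i) (inl k) (inr m) = chern_torsion g p i k m.
Proof.
move=> pp; rewrite /torsion_low /torsion sum_frame.
rewrite [X in _ + X]big1 ?addr0; last by move=> d _; rewrite mulr0.
under eq_bigr do rewrite mulrBl.
by rewrite sumrB /= !chern_lower.
Qed.

Lemma cdiff_chern_gamma p k i d : punctured p ->
  cdiff (fun q => chern_gamma g q k i d) p.
Proof.
move=> pp; have [_ _ d1 d2] := rg pp.
apply: cdiff_sum => l; apply: cdiffM; last exact: d2.
apply: cdiff_ginv => //; near=> q.
have pq : punctured q by near: q; exact: near_punctured.
by case: (rg pq).
Unshelve. all: by end_near. Qed.

Lemma chern_curvatureE p k l i d : punctured p ->
  curvature G p (inl k) (inr l) (inl i) (inl d) =
  - pd (inr l) (fun q => chern_gamma g q k i d) p.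
Proof.
move=> pp; rewrite /curvature sum_frame !big1 ?addr0; last 2 first.
- by move=> e _; rewrite !(hc_lr hG) // !mul0r subrr.
- by move=> e _; rewrite !chern_rll // mul0r mulr0 subrr.
rewrite (@pd_near _ _ _ _ (fun=> 0)); last first.
  near=> q; apply: chern_rll; near: q; exact: near_punctured.
rewrite pd_cst sub0r; congr (- _); apply: pd_near.
near=> q; apply: chern_gammaE; near: q; exact: near_punctured.
Unshelve. all: by end_near. Qed.

(** Differentiating the identity Gamma_ki^d g_dj = d_k g_ij along dbar_l
    trades the derivative of Gamma for second derivatives of g. *)
Lemma chern_SE p i j : punctured p -> S_term g G p i j = chern_S g p i j.
Proof.
move=> pp; have [u _ d1 d2] := rg pp.
rewrite /S_term; apply: eq_bigr => k _; apply: eq_bigr => l _; congr (_ * _).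
rewrite /curvature_low sum_frame [X in _ + X]big1 ?addr0; last first.
  by move=> d _; rewrite mulr0.
under eq_bigr do rewrite chern_curvatureE // mulNr.
rewrite sumrN.
have -> : pd (inr l) (pd (inl k) (fun q => g q i j)) p =
  pd (inr l) (fun q => \sum_d chern_gamma g q k i d * g q d j) p.
  apply: pd_near; near=> q.
  have pq : punctured q by near: q; exact: near_punctured.
  by rewrite -chern_lower //; apply: eq_bigr => d _; rewrite chern_gammaE.
rewrite pd_sum; last by move=> d; apply: cdiffM => //; exact: cdiff_chern_gamma.
have -> : \sum_d pd (inr l) (fun q => chern_gamma g q k i d * g q d j) p =
  \sum_d (pd (inr l) (fun q => chern_gamma g q k i d) p * g p d j
   + chern_gamma g p k i d * pd (inr l) (fun q => g q d j) p).
  by apply: eq_bigr => d _; rewrite pdM //; exact: cdiff_chern_gamma.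
by rewrite big_split /= opprD subrK.
Unshelve. all: by end_near. Qed.

(** The velocity depends on the metric alone, through its derivatives of
    order at most two; this is what both the explicit solutions and
    uniqueness rest on. *)
Lemma hcf_velocityE b p i j : punctured p ->
  hcf_velocity b g G p i j =
  hcf_algebraic b (chern_S g p) (ginv g p) (chern_torsion g p) i j.
Proof.
move=> pp; case: b => [[[b1 b2] b3] b4].
have <- : (fun i k m => torsion_low g G p (inl i) (inl k) (inr m)) =
          chern_torsion g p.
  by do 3!apply/funext => ?; exact: chern_torsionE.
by rewrite /hcf_velocity chern_SE.
Qed.

End Chern.

(** The connection with prescribed components nabla_{d_i} d_j and
    nabla_{dbar_i} d_j; reality determines the remaining ones. *)
Definition real_connection (U L : Cn R n -> 'I_n -> 'I_n -> 'I_n -> R[i]) p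
    (A B C : 'I_n + 'I_n) : R[i] :=
  match A, B, C with
  | inl a, inl b, inl c => U p a b c
  | inr a, inl b, inl c => L p a b c
  | inr a, inr b, inr c => (U p a b c)^*%C
  | inl a, inr b, inr c => (L p a b c)^*%C
  | _, _, _ => 0
  end.

Lemma real_connection_hermitian g U L : regular_metric g ->
  (forall p, punctured p -> forall k i j,
     pd (inl k) (fun q => g q i j) p =
     \sum_d U p k i d * g p d j + \sum_d (L p k j d)^*%C * g p i d) ->
  hermitian_connection g (real_connection U L).
Proof.
move=> rg h p pp; have [_ her _ _] := rg p pp.
have hr k i j : pd (inr k) (fun q => g q i j) p =
     \sum_d L p k i d * g p d j + \sum_d (U p k j d)^*%C * g p i d.
  have := pd_bar_metric (inl k) i j rg pp; rewrite [barI _]/= => ->.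
  rewrite h // conjcDx !conjc_sum addrC; congr (_ + _); apply: eq_bigr => d _;
    by rewrite conjcMx -her ?conjcK.
split.
- by case=> a [] b [] c; rewrite /barI /real_connection ?conjcK ?conjc0.
- move=> A B C; rewrite sum_frame.
  case: B => b; case: C => c /=; rewrite ?pd_cst.
  + by rewrite !big1 ?addr0 // => d _; rewrite ?mulr0 ?addr0 //;
      case: A => a; rewrite /= !mul0r addr0.
  + case: A => a; rewrite ?h ?hr //; congr (_ + _);
      by apply: eq_bigr => d _; rewrite /= ?mul0r ?mulr0 ?addr0 ?add0r.
  + case: A => a; rewrite ?h ?hr //; congr (_ + _);
      by apply: eq_bigr => d _; rewrite /= ?mul0r ?mulr0 ?addr0 ?add0r.
  + by rewrite !big1 ?addr0 // => d _; rewrite ?mulr0 ?addr0 //;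
      case: A => a; rewrite /= !mul0r addr0.
- by case=> a [] b [] c; rewrite /= ?mulr0.
Qed.

(** Gamma = g^{-1} d g is metric by construction, and has no mixed
    components. *)
Lemma chern_exists g : regular_metric g ->
  chern_connection g (real_connection (chern_gamma g) (fun _ _ _ _ => 0)).
Proof.
move=> rg; split; last by move=> p i j [] c pp; rewrite /torsion /real_connection ?conjc0 subrr.
apply: real_connection_hermitian => // p pp k i j; have [u _ _ _] := rg p pp.
by rewrite raise_low // [X in _ = _ + X]big1 ?addr0 // => d _; rewrite conjc0 mul0r.
Qed.

Section Bismut.
Variables (g : Cn R n -> 'M[R[i]]_n).
Hypothesis rg : regular_metric g.

(** The Bismut connection after lowering: g(nabla_k d_i, dbar_q) = d_i g_kq
    and g(nabla_kbar d_i, dbar_q) = dbar_k g_iq - dbar_q g_ik. These are the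
    equations that total skew-symmetry of the torsion forces. *)
Definition bismut_lower (U L : Cn R n -> 'I_n -> 'I_n -> 'I_n -> R[i]) :=
  forall p, punctured p -> forall k i q,
  \sum_d U p k i d * g p d q = pd (inl i) (fun z => g z k q) p /\
  \sum_d L p k i d * g p d q =
    pd (inr k) (fun z => g z i q) p - pd (inr q) (fun z => g z i k) p.

Lemma low_llr (G : Cn R n -> 'I_n + 'I_n -> 'I_n + 'I_n -> 'I_n + 'I_n -> R[i])
    p A B c :
  \sum_D G p A B D * gC g p D (inr c) = \sum_d G p A B (inl d) * g p d c.
Proof.
rewrite sum_frame [X in _ + X]big1 ?addr0 // => d _; exact: mulr0.
Qed.

Lemma low_lrl (G : Cn R n -> 'I_n + 'I_n -> 'I_n + 'I_n -> 'I_n + 'I_n -> R[i])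
    p A B c :
  \sum_D G p A B D * gC g p D (inl c) = \sum_d G p A B (inr d) * g p c d.
Proof.
rewrite sum_frame [X in X + _]big1 ?add0r // => d _; exact: mulr0.
Qed.

Lemma torsion_lowE G p A B C : torsion_low g G p A B C =
  \sum_D G p A B D * gC g p D C - \sum_D G p B A D * gC g p D C.
Proof. by rewrite -sumrB; apply: eq_bigr => D _; rewrite -mulrBl. Qed.

Lemma conj_low (X : 'I_n -> R[i]) p c : punctured p ->
  \sum_d (X d)^*%C * g p c d = (\sum_d X d * g p d c)^*%C.
Proof.
move=> pp; have [_ her _ _] := rg pp.
by rewrite conjc_sum; apply: eq_bigr => d _; rewrite conjcMx -her.
Qed.

(** Existence of the Bismut connection: a solution of the lowered equations
    has totally skew torsion, as one checks on the eight types of triples of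
    frame vectors. *)
Lemma bismut_real_connection U L : bismut_lower U L ->
  bismut_connection g (real_connection U L).
Proof.
move=> bl.
have bU p k i q (pp : punctured p) := (bl p pp k i q).1.
have bL p k i q (pp : punctured p) := (bl p pp k i q).2.
have cpd p (pp : punctured p) A i j :=
  pd_bar_metric A j i rg pp.
have Ub p k i q : punctured p -> \sum_d (U p k i d)^*%C * g p q d =
    pd (inr i) (fun z => g z q k) p.
  by move=> pp; rewrite conj_low // bU // -cpd.
have Lb p k i q : punctured p -> \sum_d (L p k i d)^*%C * g p q d =
    pd (inl k) (fun z => g z q i) p - pd (inl q) (fun z => g z k i) p.
  by move=> pp; rewrite conj_low // bL // conjcBx -!cpd.
split.
  by apply: real_connection_hermitian => // p pp k i j; rewrite bU // Lb // addrC subrK.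
move=> p A B C pp; split.
  by rewrite !torsion_lowE opprB.
have s0 q : \sum_d 0 * g p d q = 0 by apply: big1 => d _; rewrite mul0r.
have s1 q : \sum_d 0 * g p q d = 0 by apply: big1 => d _; rewrite mul0r.
have [D1 hD1] : exists D1, forall k i q, pd (inl k) (fun z => g z i q) p = D1 k i q.
  by eexists.
have [D2 hD2] : exists D2, forall k i q, pd (inr k) (fun z => g z i q) p = D2 k i q.
  by eexists.
have {}bU k i q : \sum_d U p k i d * g p d q = D1 i k q by rewrite bU.
have {}bL k i q : \sum_d L p k i d * g p d q = D2 k i q - D2 q i k by rewrite bL // !hD2.
have {}Ub k i q : \sum_d (U p k i d)^*%C * g p q d = D2 i q k by rewrite Ub.
have {}Lb k i q : \sum_d (L p k i d)^*%C * g p q d = D1 k q i - D1 q k i.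
  by rewrite Lb // !hD1.
clear hD1 hD2; rewrite !torsion_lowE; case: A => a; case: B => b; case: C => c;
  rewrite ?low_llr ?low_lrl /real_connection ?s0 ?s1 ?bU ?bL ?Ub ?Lb;
  by rewrite ?subr0 ?sub0r ?subrr ?oppr0 ?opprB ?opprK.
Qed.

(** Uniqueness of the Bismut connection: skew-symmetry in the last two slots
    of the torsion, together with metricity, determines the lowered
    components. *)
Lemma bismut_lowerE G : bismut_connection g G ->
  bismut_lower (fun p a b c => G p (inl a) (inl b) (inl c))
               (fun p a b c => G p (inr a) (inl b) (inl c)).
Proof.
move=> [hG tG].
have gU p k i q : punctured p -> \sum_d G p (inl k) (inl i) (inl d) * g p d q =
    pd (inl i) (fun z => g z k q) p.
  move=> pp; have [_] := tG p (inl i) (inr q) (inl k) pp.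
  rewrite !torsion_lowE ?low_llr ?low_lrl (hc_metric hG) //.
  rewrite [X in _ - X]big1 ?subr0; last first.
    by move=> d _; rewrite (hc_lr hG) ?mul0r.
  by move=> ->; rewrite opprB addrC subrK.
move=> p pp k i q; split; first exact: gU.
have [_ her _ _] := rg pp.
have -> : pd (inr q) (fun z => g z i k) p = \sum_d (G p (inl k) (inl q) (inl d))^*%C * g p i d.
  by rewrite conj_low // gU // -pd_bar_metric.
rewrite (hc_metric hG) //.
rewrite -[LHS]addr0 -addrA; congr (_ + _); apply/eqP; rewrite eq_sym subr_eq0.
by apply/eqP/eq_bigr => d _; rewrite -(hc_bar hG).
Qed.

End Bismut.

End Connections.

(** * Contractions of the torsion of unitarily invariant metrics *)

(** Z, W and r stand for the coordinates of a point, their conjugates and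
    |z|^2, and a, b for alpha, beta. With Z and W independent, all identities
    are rational and hold over any field of numbers. *)
Section UnitaryTensors.
Variables (F : numFieldType) (n : nat) (Z W : 'I_n -> F) (r a b : F).
Hypothesis (hr : \sum_i W i * Z i = r) (r0 : r != 0) (a0 : a != 0)
  (s0 : a + b != 0).
Let dl (i j : 'I_n) : F := (i == j)%:R.
Let y := (a + b) / a.
Let c := - (a + b) / r ^+ 2.

(** The inverse of g(alpha, beta) and its Chern torsion and conjugate
    torsion, as expressions in the coordinates. *)
Definition Ginv k l := r / a * dl k l - b / (a * (a + b)) * (Z k * W l).
Definition Tchern i k m := c * (W i * dl k m - W k * dl i m).
Definition TchernBar i k m := c * (Z i * dl k m - Z k * dl i m).

Let dlC i j : dl i j = dl j i. Proof. by rewrite /dl eq_sym. Qed.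
Let sdl (X : 'I_n -> F) k : \sum_l X l * dl l k = X k.
Proof. exact: sum_delta. Qed.
Let sdl' (X : 'I_n -> F) k : \sum_l X l * dl k l = X k.
Proof. exact: sum_delta'. Qed.
(** Splits a sum into contractions that are already known. *)
Lemma sum_lin2 (e1 e2 : F) (X X1 X2 : 'I_n -> F) :
  (forall q, X q = e1 * X1 q + e2 * X2 q) ->
  \sum_q X q = e1 * \sum_q X1 q + e2 * \sum_q X2 q.
Proof. by move=> h; rewrite !mulr_sumr -big_split; apply: eq_bigr. Qed.

Lemma sum_lin3 (e1 e2 e3 : F) (X X1 X2 X3 : 'I_n -> F) :
  (forall q, X q = e1 * X1 q + e2 * X2 q + e3 * X3 q) ->
  \sum_q X q = e1 * \sum_q X1 q + e2 * \sum_q X2 q + e3 * \sum_q X3 q.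
Proof. by move=> h; rewrite !mulr_sumr -!big_split; apply: eq_bigr. Qed.

Lemma Ginv_Z k : \sum_l Ginv k l * Z l = r / (a + b) * Z k.
Proof.
rewrite (sum_lin2 (e1 := r / a) (e2 := - (b / (a * (a + b)) * Z k))
  (X1 := fun l => Z l * dl k l) (X2 := fun l => W l * Z l)); last first.
  by move=> q; rewrite /Ginv; ring.
by rewrite sdl' hr; field; rewrite a0 s0.
Qed.

Lemma Ginv_W l : \sum_k Ginv k l * W k = r / (a + b) * W l.
Proof.
rewrite (sum_lin2 (e1 := r / a) (e2 := - (b / (a * (a + b)) * W l))
  (X1 := fun k => W k * dl k l) (X2 := fun k => W k * Z k)); last first.
  by move=> q; rewrite /Ginv; ring.
by rewrite sdl hr; field; rewrite a0 s0.
Qed.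

Lemma Ginv_trace : \sum_k Ginv k k = r * (n%:R / a - b / (a * (a + b))).
Proof.
rewrite (sum_lin2 (e1 := r / a) (e2 := - (b / (a * (a + b))))
  (X1 := fun k => 1) (X2 := fun k => W k * Z k)); last first.
  by move=> q; rewrite /Ginv /dl eqxx /=; ring.
by rewrite hr sumr_const card_ord; field; rewrite a0 s0.
Qed.

(** Sherman-Morrison for a multiple of the identity plus a matrix of rank
    one. *)
Lemma Gmet_Ginv j k :
  \sum_l (a / r * dl j l + b / r ^+ 2 * (W j * Z l)) * Ginv k l = dl j k.
Proof.
rewrite (sum_lin2 (e1 := a / r) (e2 := b / r ^+ 2 * W j)
  (X1 := fun l => Ginv k l * dl j l) (X2 := fun l => Ginv k l * Z l)); last first.
  by move=> q; ring.
rewrite sdl' Ginv_Z /Ginv (dlC k j); field; by rewrite r0 a0 s0.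
Qed.

Lemma Tchern_raise i k m :
  \sum_q Ginv m q * Tchern i k q = - (y / r) * (W i * dl m k - W k * dl m i).
Proof.
rewrite (sum_lin2 (e1 := c * W i) (e2 := - (c * W k))
  (X1 := fun q => Ginv m q * dl k q) (X2 := fun q => Ginv m q * dl i q)); last first.
  by move=> q; rewrite /Tchern; ring.
by rewrite !sdl' /Ginv /c /y; field; rewrite r0 a0 s0.
Qed.

Lemma Tchern_trace i :
  \sum_k \sum_l Ginv k l * Tchern i k l = - (y / r) * (n%:R - 1) * W i.
Proof.
rewrite (eq_bigr _ (fun k _ => Tchern_raise i k k)).
rewrite (sum_lin2 (e1 := - (y / r) * W i) (e2 := y / r) (X1 := fun k => 1)
  (X2 := fun k => W k * dl k i)); last first.
  by move=> q; rewrite /dl eqxx /=; ring.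
by rewrite sdl sumr_const card_ord; ring.
Qed.

Lemma TchernBar_raise i k m :
  \sum_q Ginv q m * TchernBar i k q = - (y / r) * (Z i * dl m k - Z k * dl m i).
Proof.
rewrite (sum_lin2 (e1 := c * Z i) (e2 := - (c * Z k))
  (X1 := fun q => Ginv q m * dl k q) (X2 := fun q => Ginv q m * dl i q)); last first.
  by move=> q; rewrite /TchernBar; ring.
by rewrite !sdl' /Ginv /c /y !(dlC m); field; rewrite r0 a0 s0.
Qed.

Lemma TchernBar_trace j :
  \sum_m \sum_q Ginv m q * TchernBar j q m = - (y / r) * (n%:R - 1) * Z j.
Proof.
rewrite exchange_big /= (eq_bigr _ (fun k _ => TchernBar_raise j k k)).
rewrite (sum_lin2 (e1 := - (y / r) * Z j) (e2 := y / r) (X1 := fun k => 1)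
  (X2 := fun k => Z k * dl k j)); last first.
  by move=> q; rewrite /dl eqxx /=; ring.
by rewrite sdl sumr_const card_ord; ring.
Qed.

(** Each index is summed as soon as possible, against delta, Z or W, so that
    only the trace of the inverse metric and sums of |z_i|^2 remain; the
    other three terms are treated alike. *)
Lemma q1_contraction i j :
  \sum_k \sum_l \sum_m \sum_q Ginv k l * Ginv m q * (Tchern i k q * TchernBar j l m) =
  y / r * dl i j + y * ((n%:R - 1) * y - 1) / r ^+ 2 * (W i * Z j).
Proof.
have in1 k l : \sum_m \sum_q Ginv k l * Ginv m q * (Tchern i k q * TchernBar j l m) =
  Ginv k l * (c * - (y / r) * (W i * (Z j * dl l k - Z l * dl j k)
                             - W k * (Z j * dl l i - Z l * dl j i))).
  rewrite (eq_bigr (fun m => Ginv k l * (- (y / r) * (W i * dl m k - W k * dl m i))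
     * TchernBar j l m)); last first.
    by move=> m _; rewrite -Tchern_raise mulr_sumr mulr_suml; apply: eq_bigr => q _; ring.
  rewrite (sum_lin2 (e1 := - (y / r) * Ginv k l * W i) (e2 := y / r * Ginv k l * W k)
    (X1 := fun m => TchernBar j l m * dl m k) (X2 := fun m => TchernBar j l m * dl m i));
    last by move=> m; ring.
  by rewrite !sdl /TchernBar; ring.
rewrite (eq_bigr (fun k => \sum_l _) (fun k _ => eq_bigr _ (fun l _ => in1 k l))).
have in2 k : \sum_l Ginv k l * (c * - (y / r) * (W i * (Z j * dl l k - Z l * dl j k)
                             - W k * (Z j * dl l i - Z l * dl j i))) =
  c * - (y / r) * (W i * Z j * Ginv k k
   - W i * (r / (a + b)) * (Z k * dl j k)
   - Z j * (Ginv k i * W k) + (r / (a + b)) * dl j i * (W k * Z k)).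
  rewrite (sum_lin3 (e1 := c * - (y / r) * W i * Z j)
    (e2 := - (c * - (y / r) * (W i * dl j k - W k * dl j i)))
    (e3 := - (c * - (y / r) * W k * Z j))
    (X1 := fun l => Ginv k l * dl l k) (X2 := fun l => Ginv k l * Z l)
    (X3 := fun l => Ginv k l * dl l i)); last by move=> l; ring.
  by rewrite !sdl Ginv_Z; ring.
rewrite (eq_bigr _ (fun k _ => in2 k)).
rewrite -mulr_sumr (sum_lin3 (e1 := W i * Z j) (e2 := - (W i * (r / (a + b))))
  (e3 := 1) (X1 := fun k => Ginv k k) (X2 := fun k => Z k * dl j k)
  (X3 := fun k => - Z j * (Ginv k i * W k) + (r / (a + b)) * dl j i * (W k * Z k)));
  last by move=> k; ring.
rewrite Ginv_trace sdl' big_split /= -!mulr_sumr Ginv_W hr (dlC j i) /c /y; field.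
by rewrite r0 a0 s0.
Qed.

Lemma q2_contraction i j :
  \sum_k \sum_l \sum_m \sum_q Ginv k l * Ginv m q * (Tchern k m j * TchernBar l q i) =
  2 * y / r * dl i j - 2 * y / r ^+ 2 * (W i * Z j).
Proof.
have in1 k m : \sum_l \sum_q Ginv k l * Ginv m q * (Tchern k m j * TchernBar l q i) =
  Tchern k m j * (c * (r / (a + b)) * (r / a) * (Z k * dl m i - Z m * dl k i)).
  have in0 l : \sum_q Ginv k l * Ginv m q * (Tchern k m j * TchernBar l q i) =
    Tchern k m j * c * (Ginv k l * (Z l * Ginv m i - r / (a + b) * Z m * dl l i)).
    rewrite (sum_lin2 (e1 := Tchern k m j * c * Ginv k l * Z l)
      (e2 := - (Tchern k m j * c * Ginv k l * dl l i)) (X1 := fun q => Ginv m q * dl q i)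
      (X2 := fun q => Ginv m q * Z q)); last by move=> q; rewrite /TchernBar; ring.
    by rewrite sdl Ginv_Z; ring.
  rewrite (eq_bigr _ (fun l _ => in0 l)) -mulr_sumr.
  rewrite (sum_lin2 (e1 := Ginv m i) (e2 := - (r / (a + b) * Z m))
    (X1 := fun l => Ginv k l * Z l) (X2 := fun l => Ginv k l * dl l i));
    last by move=> l; ring.
  by rewrite sdl Ginv_Z /Ginv; ring.
rewrite (eq_bigr (fun k => \sum_m _) (fun k _ => etrans (exchange_big _ _ _ _ _ _)
  (eq_bigr _ (fun m _ => in1 k m)))).
have in2 k : \sum_m Tchern k m j * (c * (r / (a + b)) * (r / a) * (Z k * dl m i - Z m * dl k i))
  = c ^+ 2 * (r / (a + b)) * (r / a) *
    (dl i j * (W k * Z k) - Z j * (W k * dl k i) - W i * (Z k * dl k j)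
      + r * (dl k j * dl k i)).
  rewrite (sum_lin2 (e1 := c * (r / (a + b)) * (r / a) * Z k)
    (e2 := - (c * (r / (a + b)) * (r / a) * dl k i))
    (X1 := fun m => Tchern k m j * dl m i) (X2 := fun m => Tchern k m j * Z m));
    last by move=> m; ring.
  rewrite sdl (sum_lin2 (e1 := c * W k) (e2 := - (c * dl k j))
    (X1 := fun m => Z m * dl m j) (X2 := fun m => W m * Z m));
    last by move=> m; rewrite /Tchern; ring.
  by rewrite sdl hr /Tchern; ring.
rewrite (eq_bigr _ (fun k _ => in2 k)) -mulr_sumr.
rewrite (sum_lin3 (e1 := dl i j) (e2 := - Z j) (e3 := 1)
  (X1 := fun k => W k * Z k) (X2 := fun k => W k * dl k i)
  (X3 := fun k => - W i * (Z k * dl k j) + r * (dl k j * dl k i)));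
  last by move=> k; ring.
rewrite big_split /= -!mulr_sumr !sdl hr /c /y; field.
by rewrite r0 a0 s0.
Qed.

(** This term is the product of a trace of the torsion with its conjugate. *)
Lemma q3_contraction i j :
  \sum_k \sum_l \sum_m \sum_q Ginv k l * Ginv m q * (Tchern i k l * TchernBar j q m) =
  (n%:R - 1) ^+ 2 * y ^+ 2 / r ^+ 2 * (W i * Z j).
Proof.
transitivity ((\sum_k \sum_l Ginv k l * Tchern i k l) * (\sum_m \sum_q Ginv m q * TchernBar j q m)).
  rewrite mulr_suml; apply: eq_bigr => k _; rewrite mulr_suml; apply: eq_bigr => l _.
  rewrite mulr_sumr; apply: eq_bigr => m _; rewrite mulr_sumr; apply: eq_bigr => q _.
  ring.
by rewrite Tchern_trace TchernBar_trace; field.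
Qed.

Lemma q4_contraction i j :
  2^-1 * \sum_k \sum_l \sum_m \sum_q
    Ginv k l * Ginv m q * (Tchern m k l * TchernBar q j i + Tchern m i j * TchernBar q l k) =
  (n%:R - 1) * y / r * dl i j - (n%:R - 1) * y / r ^+ 2 * (W i * Z j).
Proof.
have -> : \sum_k \sum_l \sum_m \sum_q
    Ginv k l * Ginv m q * (Tchern m k l * TchernBar q j i + Tchern m i j * TchernBar q l k) =
  \sum_m \sum_q Ginv m q * ((\sum_k \sum_l Ginv k l * Tchern m k l) * TchernBar q j i
     + Tchern m i j * \sum_k \sum_l Ginv k l * TchernBar q l k).
  under eq_bigr do rewrite exchange_big; rewrite exchange_big /=.
  apply: eq_bigr => m _.
  under eq_bigr do rewrite exchange_big; rewrite exchange_big /=.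
  apply: eq_bigr => q _.
  rewrite mulr_suml mulr_sumr -big_split mulr_sumr; apply: eq_bigr => k _ /=.
  rewrite mulr_suml mulr_sumr -big_split mulr_sumr; apply: eq_bigr => l _ /=.
  ring.
have e : \sum_m \sum_q Ginv m q * ((\sum_k \sum_l Ginv k l * Tchern m k l) * TchernBar q j i
     + Tchern m i j * \sum_k \sum_l Ginv k l * TchernBar q l k) =
  \sum_m (- (y / r) * (n%:R - 1)) * (\sum_q Ginv m q * W m * TchernBar q j i)
  + \sum_m (- (y / r) * (n%:R - 1)) * (Tchern m i j * (r / (a + b)) * Z m).
  rewrite -big_split; apply: eq_bigr => m _ /=.
  rewrite (sum_lin2 (e1 := - (y / r) * (n%:R - 1))
    (e2 := - (y / r) * (n%:R - 1) * Tchern m i j)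
    (X1 := fun q => Ginv m q * W m * TchernBar q j i) (X2 := fun q => Ginv m q * Z q)).
    by rewrite Ginv_Z; ring.
  by move=> q; rewrite Tchern_trace TchernBar_trace; ring.
rewrite e -!mulr_sumr exchange_big /=.
have e1 : \sum_q \sum_m Ginv m q * W m * TchernBar q j i =
  c * (r / (a + b)) * (r * dl i j - W i * Z j).
  rewrite (sum_lin2 (e1 := c * (r / (a + b)) * dl j i) (e2 := - (c * (r / (a + b)) * Z j))
    (X1 := fun q => W q * Z q) (X2 := fun q => W q * dl q i)).
    by rewrite hr sdl (dlC j i); ring.
  by move=> q; rewrite -mulr_suml Ginv_W /TchernBar; ring.
have e2 : \sum_m Tchern m i j * (r / (a + b)) * Z m =
  c * (r / (a + b)) * (r * dl i j - W i * Z j).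
  rewrite (sum_lin2 (e1 := c * (r / (a + b)) * dl i j) (e2 := - (c * (r / (a + b)) * W i))
    (X1 := fun q => W q * Z q) (X2 := fun q => Z q * dl q j)).
    by rewrite hr sdl; ring.
  by move=> q; rewrite /Tchern; ring.
rewrite e1 e2 /c /y; field.
by rewrite r0 a0 s0.
Qed.

End UnitaryTensors.

(** * Curvature contractions of unitarily invariant metrics *)

Section UnitaryTensorsCurvature.
Variables (F : numFieldType) (n : nat) (Z W : 'I_n -> F) (r a b : F).
Hypothesis (hr : \sum_i W i * Z i = r) (r0 : r != 0) (a0 : a != 0)
  (s0 : a + b != 0).
Let dl (i j : 'I_n) : F := (i == j)%:R.
Let y := (a + b) / a.
Let x := b / a.
Let H := Ginv Z W r a b.

Let dlC i j : dl i j = dl j i. Proof. by rewrite /dl eq_sym. Qed.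
Let sdl (X : 'I_n -> F) k : \sum_l X l * dl l k = X k.
Proof. exact: sum_delta. Qed.
Let sdl' (X : 'I_n -> F) k : \sum_l X l * dl k l = X k.
Proof. exact: sum_delta'. Qed.

(** The metric and its derivatives d_k g_ij, dbar_l g_ij and dbar_l d_k g_ij. *)
Definition Gmet i j := a / r * dl i j + b / r ^+ 2 * (W i * Z j).
Definition dGmet k i j := - (a / r ^+ 2) * W k * dl i j + b / r ^+ 2 * W i * dl k j
  - 2 * b / r ^+ 3 * W k * W i * Z j.
Definition dbarGmet l i j := - (a / r ^+ 2) * Z l * dl i j + b / r ^+ 2 * dl l i * Z j
  - 2 * b / r ^+ 3 * Z l * W i * Z j.
Definition ddbarGmet l k i j :=
  - a * dl i j * (- (2 / r ^+ 3) * Z l * W k + dl l k / r ^+ 2)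
  + b * dl k j * (- (2 / r ^+ 3) * Z l * W i + dl l i / r ^+ 2)
  - 2 * b * (- (3 / r ^+ 4) * Z l * W k * W i * Z j + dl l k * W i * Z j / r ^+ 3
             + W k * dl l i * Z j / r ^+ 3).

(** The coefficients of nabla_{d_k} d_i and nabla_{dbar_l} d_i for the Bismut
    connection; those of the Chern connection are bismut10 with the two lower
    indices exchanged. *)
Definition bismut10 k i p := - (W i / r) * dl p k + x / r * W k * dl p i
  - x / r ^+ 2 * W i * W k * Z p.
Definition bismut01 l i p := - (y / r) * Z l * dl p i + x / r ^+ 2 * Z l * Z p * W i
  + dl l i * Z p / r.

Lemma bismut10_lower k i q : \sum_d bismut10 k i d * Gmet d q = dGmet i k q.
Proof.
rewrite (sum_lin2 (e1 := a / r) (e2 := b / r ^+ 2 * Z q)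
  (X1 := fun d => bismut10 k i d * dl d q) (X2 := fun d => bismut10 k i d * W d));
  last by move=> d; rewrite /Gmet; ring.
rewrite sdl (sum_lin3 (e1 := - (W i / r)) (e2 := x / r * W k)
  (e3 := - (x / r ^+ 2 * W i * W k)) (X1 := fun d => W d * dl d k)
  (X2 := fun d => W d * dl d i) (X3 := fun d => W d * Z d));
  last by move=> d; rewrite /bismut10; ring.
rewrite !sdl hr /bismut10 /dGmet /x (dlC q k) (dlC q i); field.
by rewrite r0 a0.
Qed.

Lemma bismut10_W k i : \sum_d bismut10 k i d * W d = - (W i * W k / r).
Proof.
rewrite (sum_lin3 (e1 := - (W i / r)) (e2 := x / r * W k)
  (e3 := - (x / r ^+ 2 * W i * W k)) (X1 := fun d => W d * dl d k)
  (X2 := fun d => W d * dl d i) (X3 := fun d => W d * Z d));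
  last by move=> d; rewrite /bismut10; ring.
by rewrite !sdl hr; field.
Qed.

Lemma bismut01_W l i : \sum_d bismut01 l i d * W d = dl l i - Z l * W i / r.
Proof.
rewrite (sum_lin3 (e1 := - (y / r) * Z l) (e2 := x / r ^+ 2 * Z l * W i)
  (e3 := dl l i / r) (X1 := fun d => W d * dl d i)
  (X2 := fun d => W d * Z d) (X3 := fun d => W d * Z d));
  last by move=> d; rewrite /bismut01; ring.
by rewrite !sdl hr /y /x; field; rewrite r0 a0.
Qed.

Lemma bismut01_lower k i q : \sum_d bismut01 k i d * Gmet d q = dbarGmet k i q - dbarGmet q i k.
Proof.
rewrite (sum_lin2 (e1 := a / r) (e2 := b / r ^+ 2 * Z q)
  (X1 := fun d => bismut01 k i d * dl d q) (X2 := fun d => bismut01 k i d * W d));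
  last by move=> d; rewrite /Gmet; ring.
rewrite sdl bismut01_W /bismut01 /dbarGmet /x /y (dlC i q) (dlC i k); field.
by rewrite r0 a0.
Qed.

(** For every Hermitian metric the (1,0) parts of the Chern and Bismut
    connections are transposes of each other; here this spares a second set
    of Christoffel symbols. *)
Lemma chern_gamma_bismut10 k i d : \sum_l H d l * dGmet k i l = bismut10 i k d.
Proof.
rewrite (sum_lin3 (e1 := - (a / r ^+ 2) * W k) (e2 := b / r ^+ 2 * W i)
  (e3 := - (2 * b / r ^+ 3 * W k * W i)) (X1 := fun l => H d l * dl i l)
  (X2 := fun l => H d l * dl k l) (X3 := fun l => H d l * Z l));
  last by move=> l; rewrite /dGmet; ring.
rewrite !sdl' /H Ginv_Z // /Ginv -!/(dl _ _) /bismut10 /x; field.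
by rewrite r0 a0 s0.
Qed.

(** The sum over l is reduced to contractions of the inverse metric with
    delta_lk, delta_li and Z_l, whose coefficients are A1, A2 and A3. *)
Lemma chern_S_contraction i j :
  \sum_k \sum_l H k l * (- ddbarGmet l k i j + \sum_d bismut10 i k d * dbarGmet l d j) =
  (n%:R - y) / r * dl i j + ((n%:R - 1) * y ^+ 2 - n%:R + y) / r ^+ 2 * (W i * Z j).
Proof.
have g k l : \sum_d bismut10 i k d * dbarGmet l d j =
    - (a / r ^+ 2) * Z l * bismut10 i k j + b / r ^+ 2 * Z j * bismut10 i k l
    + 2 * b / r ^+ 4 * Z l * Z j * W k * W i.
  rewrite (sum_lin3 (e1 := - (a / r ^+ 2) * Z l) (e2 := b / r ^+ 2 * Z j)
    (e3 := - (2 * b / r ^+ 3 * Z l * Z j)) (X1 := fun d => bismut10 i k d * dl d j)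
    (X2 := fun d => bismut10 i k d * dl l d) (X3 := fun d => bismut10 i k d * W d));
    last by move=> d; rewrite /dbarGmet; ring.
  by rewrite sdl sdl' bismut10_W; field.
pose A1 := a * dl i j / r ^+ 2 + 2 * b * W i * Z j / r ^+ 3
  + b / r ^+ 3 * x * W i * Z j.
pose A2 k := - (b / r ^+ 2) * dl k j + b / r ^+ 3 * W k * Z j.
pose A3 k := - (2 / r ^+ 3) * a * dl i j * W k + 2 / r ^+ 3 * b * dl k j * W i
  - (6 + x - 2) * b / r ^+ 4 * W k * W i * Z j - a / r ^+ 2 * bismut10 i k j.
have in1 k : \sum_l H k l * (- ddbarGmet l k i j + \sum_d bismut10 i k d * dbarGmet l d j) =
    A1 * H k k + A2 k * H k i + A3 k * (r / (a + b) * Z k).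
  rewrite (sum_lin3 (e1 := A1) (e2 := A2 k) (e3 := A3 k)
    (X1 := fun l => H k l * dl l k) (X2 := fun l => H k l * dl l i)
    (X3 := fun l => H k l * Z l)); first by rewrite !sdl /H Ginv_Z.
  move=> l; rewrite g /ddbarGmet /A1 /A2 /A3 {2}/bismut10; field.
  by rewrite r0.
rewrite (eq_bigr _ (fun k _ => in1 k)).
rewrite (sum_lin3 (e1 := A1) (e2 := 1) (e3 := r / (a + b)) (X1 := fun k => H k k)
  (X2 := fun k => A2 k * H k i) (X3 := fun k => A3 k * Z k));
  last by move=> k; ring.
rewrite {1}/H Ginv_trace //.
rewrite (sum_lin2 (e1 := - (b / r ^+ 2)) (e2 := b / r ^+ 3 * Z j)
  (X := fun k => A2 k * H k i)
  (X1 := fun k => H k i * dl k j) (X2 := fun k => H k i * W k));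
  last by move=> k; rewrite /A2; ring.
rewrite (sum_lin2 (e1 := - (2 / r ^+ 3) * a * dl i j
    - (6 + x - 2) * b / r ^+ 4 * W i * Z j - a / r ^+ 2 * (- dl j i / r)
    + a / r ^+ 2 * x / r ^+ 2 * W i * Z j)
  (e2 := 2 / r ^+ 3 * b * W i - a / r ^+ 2 * x / r * W i) (X := fun k => A3 k * Z k)
  (X1 := fun k => W k * Z k) (X2 := fun k => Z k * dl k j)); last first.
  by move=> k; rewrite /A3 /bismut10 (dlC j k); ring.
rewrite !sdl hr /H Ginv_W // /A1 /Ginv -!/(dl _ _) (dlC j i) /y /x; field.
by rewrite r0 a0 s0.
Qed.

(** The orthogonal projection along the radial direction. *)
Definition perp_proj i j := dl i j - W i * Z j / r.

(** The derivatives of the Bismut coefficients along d_k and dbar_l. *)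
Definition d_bismut01 k l i p :=
  - y * dl p i * (- (W k * Z l) / r ^+ 2 + dl k l / r)
  + x * (- (2 / r ^+ 3) * W k * Z l * Z p * W i + dl k l * Z p * W i / r ^+ 2
         + Z l * dl k p * W i / r ^+ 2)
  + dl l i * (- (W k * Z p) / r ^+ 2 + dl k p / r).
Definition dbar_bismut10 l k i p :=
  - dl p k * (- (Z l * W i) / r ^+ 2 + dl l i / r)
  + x * dl p i * (- (Z l * W k) / r ^+ 2 + dl l k / r)
  - x * (- (2 / r ^+ 3) * Z l * W i * W k * Z p + dl l i * W k * Z p / r ^+ 2
         + W i * dl l k * Z p / r ^+ 2).
Definition d_bismut10 k m i p := dl p m * W i * W k / r ^+ 2
  - x * dl p i * W m * W k / r ^+ 2
  - x * (- (2 / r ^+ 3) * W k * W i * W m * Z p + W i * W m * dl k p / r ^+ 2).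
Definition dbar_bismut01 l m i p := y / r ^+ 2 * Z l * Z m * dl p i
  + x * (- (2 / r ^+ 3) * Z l * Z m * Z p * W i + Z m * Z p * dl l i / r ^+ 2)
  - dl m i * Z l * Z p / r ^+ 2.

Lemma contract_bismut10 (X : 'I_n -> F) k p :
  \sum_q X q * bismut10 k q p = - (dl p k / r + x / r ^+ 2 * W k * Z p) * (\sum_q X q * W q)
    + x / r * W k * X p.
Proof.
rewrite (sum_lin2 (e1 := - (dl p k / r + x / r ^+ 2 * W k * Z p)) (e2 := x / r * W k)
  (X1 := fun q => X q * W q) (X2 := fun q => X q * dl p q)); first by rewrite sdl'.
by move=> q; rewrite /bismut10; ring.
Qed.

Lemma contract_bismut01 (X : 'I_n -> F) l p :
  \sum_q X q * bismut01 l q p = - (y / r) * Z l * X p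
    + x / r ^+ 2 * Z l * Z p * (\sum_q X q * W q) + Z p / r * X l.
Proof.
rewrite (sum_lin3 (e1 := - (y / r) * Z l) (e2 := x / r ^+ 2 * Z l * Z p) (e3 := Z p / r)
  (X1 := fun q => X q * dl p q) (X2 := fun q => X q * W q)
  (X3 := fun q => X q * dl l q)); first by rewrite !sdl'.
by move=> q; rewrite /bismut01; ring.
Qed.

(** All terms along the radial direction cancel, which leaves projections
    only. *)
Lemma bismut_R11_contraction k l i p :
  d_bismut01 k l i p - dbar_bismut10 l k i p + \sum_q (bismut01 l i q * bismut10 k q p - bismut10 k i q * bismut01 l q p) =
  (- (1 + 2 * x) * perp_proj k l * perp_proj i p + perp_proj i l * perp_proj k p) / r.
Proof.
rewrite sumrB contract_bismut10 contract_bismut01 bismut10_W bismut01_W.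
rewrite /d_bismut01 /dbar_bismut10 /bismut01 /bismut10 /perp_proj (dlC p i) (dlC p k) (dlC l k) (dlC l i) /x /y; field.
by rewrite r0 a0.
Qed.

(** The Bismut curvature of type (2,0), and likewise (0,2), vanishes for this
    family. *)
Lemma bismut_R20_contraction k m i p :
  d_bismut10 k m i p - d_bismut10 m k i p + \sum_q (bismut10 m i q * bismut10 k q p - bismut10 k i q * bismut10 m q p) = 0.
Proof.
rewrite sumrB !contract_bismut10 !bismut10_W.
rewrite /d_bismut10 /bismut10 (dlC p i) (dlC p k) (dlC p m) /x; field.
by rewrite r0 a0.
Qed.

Lemma bismut_R02_contraction l m i p :
  dbar_bismut01 l m i p - dbar_bismut01 m l i p + \sum_q (bismut01 m i q * bismut01 l q p - bismut01 l i q * bismut01 m q p) = 0.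
Proof.
rewrite sumrB !contract_bismut01 !bismut01_W.
rewrite /dbar_bismut01 /bismut01 /x /y; field.
by rewrite r0 a0.
Qed.

Lemma perp_proj_lower i j : \sum_p perp_proj i p * Gmet p j = a / r * perp_proj i j.
Proof.
rewrite (sum_lin2 (e1 := a / r) (e2 := b / r ^+ 2 * Z j)
  (X1 := fun p => perp_proj i p * dl p j) (X2 := fun p => perp_proj i p * W p));
  last by move=> p; rewrite /Gmet; ring.
rewrite sdl (sum_lin2 (e1 := 1) (e2 := - (W i / r)) (X1 := fun p => W p * dl i p)
  (X2 := fun p => W p * Z p)); last by move=> p; rewrite /perp_proj; ring.
by rewrite sdl' hr /perp_proj; field; rewrite r0.
Qed.

Lemma bismut_R11_lower k l i j :
  \sum_p (- (1 + 2 * x) * perp_proj k l * perp_proj i p + perp_proj i l * perp_proj k p) / r * Gmet p j =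
  a / r ^+ 2 * (- (1 + 2 * x) * perp_proj k l * perp_proj i j + perp_proj i l * perp_proj k j).
Proof.
rewrite (sum_lin2 (e1 := - (1 + 2 * x) * perp_proj k l / r) (e2 := perp_proj i l / r)
  (X1 := fun p => perp_proj i p * Gmet p j) (X2 := fun p => perp_proj k p * Gmet p j));
  last by move=> p; ring.
by rewrite !perp_proj_lower; field.
Qed.

End UnitaryTensorsCurvature.

(** * First derivatives of g(alpha, beta) *)

Section PdValue.
Context {R : realType} {n : nat}.
Implicit Types (f g : Cn R n -> R[i]) (p : Cn R n) (D E : 'I_n + 'I_n -> R[i]).

(** A derivative rule carries differentiability and the values of all frame
    derivatives together, so that the derivative of an explicit expression is
    computed by syntax alone. *)
Definition has_pd f p D := cdiff f p /\ forall A, pd A f p = D A.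

Lemma has_pd_cst c p : has_pd (fun=> c) p (fun=> 0).
Proof. by split=> [|A]; [exact: cdiff_cst|exact: pd_cst]. Qed.

Lemma has_pd_zc i p :
  has_pd (fun q => zc q i) p (fun A => if A is inl k then (k == i)%:R else 0).
Proof. by split=> [|A]; [exact: cdiff_zc|exact: pd_zc]. Qed.

Lemma has_pd_zbar i p :
  has_pd (fun q => (zc q i)^*%C) p (fun A => if A is inr k then (k == i)%:R else 0).
Proof. by split=> [|A]; [apply: cdiff_conj; exact: cdiff_zc|exact: pd_zbar]. Qed.

Lemma has_pd_r p : has_pd (@znorm2 R n) p
  (fun A => match A with inl k => (zc p k)^*%C | inr k => zc p k end).
Proof. by split=> [|A]; [exact: cdiff_r|exact: pd_r]. Qed.

Lemma has_pdD f g p D E : has_pd f p D -> has_pd g p E ->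
  has_pd (fun q => f q + g q) p (fun A => D A + E A).
Proof. by move=> [a b] [c d]; split=> [|A]; [exact: cdiffD|rewrite pdD ?b ?d]. Qed.

Lemma has_pdN f p D : has_pd f p D -> has_pd (fun q => - f q) p (fun A => - D A).
Proof. by move=> [a b]; split=> [|A]; [exact: cdiffN|rewrite pdN ?b]. Qed.

Lemma has_pdM f g p D E : has_pd f p D -> has_pd g p E ->
  has_pd (fun q => f q * g q) p (fun A => D A * g p + f p * E A).
Proof. by move=> [a b] [c d]; split=> [|A]; [exact: cdiffM|rewrite pdM ?b ?d]. Qed.

Lemma has_pdV f p D : f p != 0 -> has_pd f p D ->
  has_pd (fun q => (f q)^-1) p (fun A => - D A / f p ^+ 2).
Proof. by move=> f0 [a b]; split=> [|A]; [exact: cdiffV|rewrite pdV ?b]. Qed.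

Lemma has_pdX f p D k : has_pd f p D ->
  has_pd (fun q => f q ^+ k.+1) p (fun A => k.+1%:R * f p ^+ k * D A).
Proof.
move=> h; elim: k => [|k ih].
  have -> : (fun q => f q ^+ 1) = f by apply/funext => q; rewrite expr1.
  case: h => a b; split=> // A; by rewrite b mul1r expr0 mul1r.
have -> : (fun q => f q ^+ k.+2) = (fun q => f q * f q ^+ k.+1).
  by apply/funext => q; rewrite exprS.
have [a b] := has_pdM h ih; split=> // A; rewrite b exprS.
by rewrite -(addn1 k.+1) natrD; move: (k.+1%:R : R[i]) => m; move: (f p) (D A) => u v;
  move: (u ^+ k) => w; ring.
Qed.

Lemma has_pd_near f g p D : (\forall q \near p, f q = g q) -> has_pd f p D -> has_pd g p D.
Proof.
move=> fg [a b]; split; first exact: cdiff_near fg a.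
by move=> A; rewrite -b; symmetry; exact: pd_near.
Qed.

End PdValue.

Ltac pv := repeat first
  [ apply: has_pdX | apply: has_pdD | apply: has_pdN | apply: has_pdM | apply: has_pdV
  | exact: has_pd_zc | exact: has_pd_zbar | exact: has_pd_r | exact: has_pd_cst ].

Section HopfMetric.
Context {R : realType} {n : nat}.
Variables (al be : R) (g : Cn R n -> 'M[R[i]]_n).
Hypothesis (al0 : 0 < al) (sl0 : 0 < al + be).
Hypothesis hg : forall p, punctured p -> g p = gab al be p.
Let a : R[i] := al%:C.
Let b : R[i] := be%:C.
Let Z (p : Cn R n) (i : 'I_n) := zc p i.
Let W (p : Cn R n) (i : 'I_n) := (zc p i)^*%C.
Let r (p : Cn R n) : R[i] := znorm2 p.
Implicit Type p : Cn R n.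

Lemma sum_WZ p : \sum_i W p i * Z p i = r p.
Proof. by rewrite /r znorm2E; apply: eq_bigr => i _; rewrite mulrC. Qed.

Lemma a_neq0 : a != 0.
Proof. by rewrite /a eq_complex /= eqxx andbT gt_eqF. Qed.

Lemma s_neq0 : a + b != 0.
Proof. by rewrite /a /b -rmorphD /= eq_complex /= eqxx andbT gt_eqF. Qed.

Lemma conj_r p : (znorm2 p)^*%C = znorm2 p.
Proof. by rewrite znorm2E conjc_sum; apply: eq_bigr => i _; rewrite !conjcE mulrC. Qed.

Lemma gabE p i j : punctured p -> g p i j = Gmet (Z p) (W p) (r p) a b i j.
Proof.
by move=> pp; rewrite hg // mxE /Gmet mulrAC [b * _ / _]mulrAC.
Qed.

Lemma near_gabE p i j : punctured p ->
  \forall q \near p, Gmet (Z q) (W q) (r q) a b i j = g q i j.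
Proof. by move=> /near_punctured; apply: filterS => q pq; rewrite gabE. Qed.

Lemma gab_has_pd p i j : punctured p -> has_pd (fun q => g q i j) p
  (fun A => match A with
    inl k => dGmet (Z p) (W p) (r p) a b k i j
  | inr l => dbarGmet (Z p) (W p) (r p) a b l i j end).
Proof.
move=> pp; have r0 : znorm2 p != 0 := punctured_r pp.
apply: (has_pd_near (near_gabE i j pp)).
have [D DE] : exists D, has_pd (fun q => Gmet (Z q) (W q) (r q) a b i j) p D /\
   forall A, D A = (match A with
    inl k => dGmet (Z p) (W p) (r p) a b k i j
  | inr l => dbarGmet (Z p) (W p) (r p) a b l i j end).
  eexists; split.
    by rewrite /Gmet /Z /W /r; pv => //; rewrite expf_neq0.
  rewrite /dGmet /dbarGmet /Z /W /r.
  move: r0 a b; move: (znorm2 p) (zc p) => u z u0 a' b'.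
  by case=> k; move: ((i == j)%:R : R[i]) => d; [move: ((k == j)%:R : R[i])|
    move: ((k == i)%:R : R[i])] => e; move: (z k) (z i) (z j)
    (z k)^*%C (z i)^*%C (z j)^*%C => *; field.
by case: DE => [[x1 x2] h]; split=> // A; rewrite x2 h.
Qed.

End HopfMetric.

(** * Chern geometry of g(alpha, beta) *)

Section UnitaryForms.
Variables (F : numFieldType) (n : nat) (Z W : 'I_n -> F) (r a b : F).
Hypothesis (hr : \sum_i W i * Z i = r) (r0 : r != 0).
Implicit Types u v : 'I_n -> F.

(** The Hermitian form of the orthogonal complement of the radial direction. *)
Definition perp_form u v := \sum_i \sum_j perp_proj Z W r i j * u i * v j.

(** A projection is its own square: the form is an inner product of projected
    vectors, hence non-negative on the diagonal. *)
Lemma perp_formE u v : perp_form u v =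
  \sum_i (u i - (\sum_j W j * u j) / r * Z i) * (v i - (\sum_j Z j * v j) / r * W i).
Proof.
set U := \sum_j W j * u j; set V := \sum_j Z j * v j.
transitivity (\sum_i (u i * v i) - U * V / r).
  rewrite /perp_form (eq_bigr (fun i => u i * v i - (W i * u i) * V / r)); last first.
    move=> i _; rewrite (sum_lin2 (e1 := u i) (e2 := - (W i * u i / r))
      (X1 := fun j => v j * (i == j)%:R) (X2 := fun j => Z j * v j)).
      by rewrite sum_delta' -/V; ring.
    by move=> j; rewrite /perp_proj; ring.
  by rewrite sumrB -!mulr_suml.
rewrite (sum_lin3 (e1 := 1) (e2 := - (V / r)) (e3 := - (U / r))
  (X := fun i => (u i - U / r * Z i) * (v i - V / r * W i))
  (X1 := fun i => u i * v i) (X2 := fun i => W i * u i)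
  (X3 := fun i => Z i * v i - V / r * (W i * Z i))); last by move=> i; ring.
by rewrite sumrB -mulr_sumr hr -/U -/V; field.
Qed.

Lemma Gmet_form u v : \sum_i \sum_j Gmet Z W r a b i j * u i * v j =
  a / r * perp_form u v
  + (a + b) / r ^+ 2 * ((\sum_j W j * u j) * (\sum_j Z j * v j)).
Proof.
rewrite /perp_form mulr_suml !mulr_sumr -big_split; apply: eq_bigr => i _ /=.
rewrite !mulr_sumr -big_split; apply: eq_bigr => j _ /=.
by rewrite /Gmet /perp_proj; field.
Qed.

End UnitaryForms.

Section DeckTransformation.
Context {R : realType} {n : nat}.
Implicit Types (c : 'I_n -> R[i]) (p : Cn R n).

Lemma zc_deck c p i : zc (deck c p) i = c i * zc p i.
Proof. by rewrite {1}/zc /deck !mxE /=; case: (c i * _). Qed.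

(** All a_i have one modulus t; only t^2 enters the invariance of the metric. *)
Lemma hopf_parameter_norm c : hopf_parameter c -> exists2 t : R, 0 < t /\ t != 1 &
  forall i, c i * (c i)^*%C = (t ^+ 2)%:C.
Proof.
move=> [[i0 c0] [ce c1]]; exists (Rep `|c i0|); last first.
  move=> i; rewrite -sqr_normc (ce i i0) realcX RRe_real // normr_real //.
split.
  have : 0 < `|c i0| by rewrite normr_gt0.
  by rewrite ltcE => /andP[_].
apply: contra (c1 i0) => /eqP h; rewrite -[`|_|]RRe_real ?h // normr_real //.
Qed.

Lemma znorm2_deck c (t : R) p : (forall i, c i * (c i)^*%C = (t ^+ 2)%:C) ->
  znorm2 (deck c p) = (t ^+ 2)%:C * znorm2 p.
Proof.
move=> h; rewrite !znorm2E mulr_sumr; apply: eq_bigr => i _.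
by rewrite !zc_deck conjcMx -(h i); move: (c i) (zc p i) (c i)^*%C (zc p i)^*%C => *; ring.
Qed.

Lemma deck_punctured c (t : R) p : t != 0 ->
  (forall i, c i * (c i)^*%C = (t ^+ 2)%:C) -> punctured (deck c p) <-> punctured p.
Proof.
move=> t0 h; rewrite /punctured /= -!znorm2_eq0 (znorm2_deck p h) mulf_eq0.
suff -> : ((t ^+ 2)%:C == 0 :> R[i]) = false by [].
by rewrite eq_complex /= eqxx andbT expf_eq0 (negbTE t0).
Qed.

End DeckTransformation.

Section HopfMetricTensors.
Context {R : realType} {n : nat}.
Variables (al be : R) (g : Cn R n -> 'M[R[i]]_n).
Hypothesis (al0 : 0 < al) (sl0 : 0 < al + be).
Hypothesis hg : forall p, punctured p -> g p = gab al be p.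
Let a : R[i] := al%:C.
Let b : R[i] := be%:C.
Let Z (p : Cn R n) (i : 'I_n) := zc p i.
Let W (p : Cn R n) (i : 'I_n) := (zc p i)^*%C.
Let r (p : Cn R n) : R[i] := znorm2 p.
Implicit Type p : Cn R n.

Let a0 : a != 0 := a_neq0 al0.
Let s0 : a + b != 0 := s_neq0 sl0.
Let gE p i j (pp : punctured p) := gabE hg i j pp.

(** Only the derivatives along dbar_l are evaluated, since no others occur in
    the curvature. *)
Lemma gab_has_pd2 p k i j : punctured p ->
  exists D, has_pd (pd (inl k) (fun q => g q i j)) p D /\
  forall l, D (inr l) = ddbarGmet (Z p) (W p) (r p) a b l k i j.
Proof.
move=> pp; have r0 : znorm2 p != 0 := punctured_r pp.
have [D [D1 D2]] : exists D,
   has_pd (fun q => dGmet (Z q) (W q) (r q) a b k i j) p D /\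
   forall l, D (inr l) = ddbarGmet (Z p) (W p) (r p) a b l k i j.
  eexists; split.
    by rewrite /dGmet /Z /W /r; pv => //; rewrite expf_neq0.
  move=> l; rewrite /ddbarGmet /Z /W /r.
  move: r0 a b; move: (znorm2 p) (zc p) => u z u0 a' b'.
  move: ((i == j)%:R : R[i]) ((k == j)%:R : R[i]) ((l == i)%:R : R[i])
    ((l == k)%:R : R[i]) => d1 d2 d3 d4.
  by move: (z l) (z i) (z j) (z k) (z l)^*%C (z k)^*%C (z i)^*%C (z j)^*%C => *; field.
exists D; split=> //; apply: has_pd_near D1.
have := near_punctured pp; apply: filterS => q pq.
by have [_ ->] := gab_has_pd hg i j pq.
Qed.

Lemma gab_hermitian p i j : punctured p -> g p i j = (g p j i)^*%C.
Proof.
move=> pp; rewrite !gE // /Gmet /W /Z /r /a /b !conjcE conj_r // eq_sym.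
by congr (_ + _ * _); rewrite mulrC.
Qed.

(** The explicit inverse is recognized by its defining identity. *)
Lemma gab_unit p : punctured p -> g p \in unitmx /\
  forall k l, ginv g p k l = Ginv (Z p) (W p) (r p) a b k l.
Proof.
move=> pp; have r0 : r p != 0 := punctured_r pp.
apply: ginv_unique => j k; under eq_bigr do rewrite gE //.
exact: (Gmet_Ginv (sum_WZ p)).
Qed.

Lemma gab_regular : regular_metric g.
Proof.
move=> p pp; split.
- by case: (gab_unit pp).
- by move=> i j; exact: gab_hermitian.
- by move=> i j; case: (gab_has_pd hg i j pp).
- move=> [k|k] i j; first by have [D [[]]] := gab_has_pd2 k i j pp.
  have c : cdiff (fun q => (pd (inl k) (fun z => g z j i) q)^*%C) p.
    by apply: cdiff_conj; have [D [[]]] := gab_has_pd2 k j i pp.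
  apply: cdiff_near c; have := near_punctured pp; apply: filterS => q pq.
  rewrite (_ : inl k = barI (inr k)) // -pd_conj; last by case: (gab_has_pd hg j i pq).
  apply: pd_near; have := near_punctured pq; apply: filterS => z pz.
  by rewrite -gab_hermitian.
Qed.

Lemma gab_chern_torsion p i k m : punctured p ->
  chern_torsion g p i k m = Tchern (W p) (r p) a b i k m.
Proof.
move=> pp; have r0 : r p != 0 := punctured_r pp.
rewrite /chern_torsion.
rewrite (proj2 (gab_has_pd hg k m pp)) (proj2 (gab_has_pd hg i m pp)) /dGmet /Tchern.
move: r0; rewrite /W /r /a /b; move: (znorm2 p) (zc p) al%:C be%:C => u z a' b' u0.
move: ((k == m)%:R : R[i]) ((i == m)%:R : R[i]) => *; move: (z i)^*%C (z k)^*%C (z m) => *.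
by field.
Qed.

Lemma gab_chern_torsion_conj p i k m : punctured p ->
  (chern_torsion g p i k m)^*%C = TchernBar (Z p) (r p) a b i k m.
Proof.
move=> pp; by rewrite gab_chern_torsion // /Tchern /TchernBar /W /r /a /b !conjcE conj_r.
Qed.

Lemma gab_chern_gamma p k i d : punctured p ->
  chern_gamma g p k i d = bismut10 (Z p) (W p) (r p) a b i k d.
Proof.
move=> pp; have r0 : r p != 0 := punctured_r pp; have [_ Hp] := gab_unit pp.
rewrite -(chern_gamma_bismut10 (sum_WZ p)) //; apply: eq_bigr => l _.
by rewrite Hp (proj2 (gab_has_pd hg i l pp)).
Qed.

Let y : R := (al + be) / al.

Lemma gab_chern_S p i j : punctured p -> chern_S g p i j =
  (n%:R - y)%:C / r p * (i == j)%:R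
  + ((n%:R - 1) * y ^+ 2 - n%:R + y)%:C / r p ^+ 2 * (W p i * Z p j).
Proof.
move=> pp; have r0 : r p != 0 := punctured_r pp; have [_ Hp] := gab_unit pp.
have := chern_S_contraction (sum_WZ p) r0 a0 s0 i j.
rewrite /y !realcE -/a -/b -/(W p i) -/(Z p j) => <-; apply: eq_bigr => k _; apply: eq_bigr => l _; rewrite Hp; congr (_ * (_ + _)).
  by have [D [[_ D1] D2]] := gab_has_pd2 k i j pp; rewrite D1 D2.
apply: eq_bigr => d _; rewrite gab_chern_gamma //.
by rewrite (proj2 (gab_has_pd hg d j pp)).
Qed.

(** The velocity has coefficient u on the identity part and v - u on the
    radial part, so it is g(u, v - u): u is the derivative of alpha and v
    that of alpha + beta. *)
Lemma gab_hcf_velocity B p i j : punctured p ->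
  hcf_algebraic B (chern_S g p) (ginv g p) (chern_torsion g p) i j =
  let: (b1, b2, b3, b4) := B in
  let u := - (n%:R - y) + b1 * y + 2 * b2 * y + b4 * (n%:R - 1) * y in
  let v := - (n%:R - 1) * y ^+ 2 + b1 * (n%:R - 1) * y ^+ 2
           + b3 * (n%:R - 1) ^+ 2 * y ^+ 2 in
  u%:C / r p * (i == j)%:R + (v - u)%:C / r p ^+ 2 * (W p i * Z p j).
Proof.
move=> pp; have r0 : r p != 0 := punctured_r pp; have [_ Hp] := gab_unit pp.
case: B => [[[b1 b2] b3] b4] /=; rewrite gab_chern_S //.
have -> : ginv g p = Ginv (Z p) (W p) (r p) a b.
  by apply/funext => k; apply/funext => l.
have Te : chern_torsion g p = Tchern (W p) (r p) a b.
  by apply/funext => ?; apply/funext => ?; apply/funext => ?; exact: gab_chern_torsion.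
have Tc i' k m : (Tchern (W p) (r p) a b i' k m)^*%C = TchernBar (Z p) (r p) a b i' k m.
  by rewrite -Te gab_chern_torsion_conj.
have sum4 (X Y : 'I_n -> 'I_n -> 'I_n -> 'I_n -> R[i]) :
    (forall k l m q, X k l m q = Y k l m q) ->
    \sum_k \sum_l \sum_m \sum_q X k l m q = \sum_k \sum_l \sum_m \sum_q Y k l m q.
  by move=> h; do 4 (apply: eq_bigr => ? _).
have h1 := q1_contraction (sum_WZ p) r0 a0 s0 i j; have h2 := q2_contraction (sum_WZ p) r0 a0 s0 i j.
have h3 := q3_contraction (Z p) (W p) r0 a0 s0 i j; have h4 := q4_contraction (sum_WZ p) r0 a0 s0 i j.
rewrite Te /q1 (sum4 _ _ (fun k l m q => congr1 (fun X => _ * (_ * X)) (Tc j l m))) h1.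
rewrite /q2 (sum4 _ _ (fun k l m q => congr1 (fun X => _ * (_ * X)) (Tc l q i))) h2.
rewrite /q3 (sum4 _ _ (fun k l m q => congr1 (fun X => _ * (_ * X)) (Tc j q m))) h3.
rewrite /q4 (sum4 _ _ (fun k l m q => congr2 (fun X Y => _ * (_ * X + _ * Y))
  (Tc q j i) (Tc q l k))) h4.
rewrite /y !realcE /a /b.
move: r0 a0; rewrite /r /W /Z /a; move: (znorm2 p) => u.
move: ((zc p i)^*%C * zc p j) ((i == j)%:R : R[i]) (n%:R : R[i]) => w d m.
move: (al%:C) (be%:C) (b1%:C) (b2%:C) (b3%:C) (b4%:C) => ? ? ? ? ? ? u0 a0'.
by field; rewrite u0 a0'.
Qed.

(** The form splits orthogonally as a multiple of alpha across the radial
    line and of alpha + beta along it. *)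
Lemma gab_posdef p : punctured p -> hermitian_posdef (g p).
Proof.
move=> pp; have r0 : r p != 0 := punctured_r pp.
split; first by move=> i j; exact: gab_hermitian.
move=> v [i0 vi0].
have -> : \sum_i \sum_j g p i j * v i * (v j)^*%C =
    \sum_i \sum_j Gmet (Z p) (W p) (r p) a b i j * v i * (v j)^*%C.
  by apply: eq_bigr => i _; apply: eq_bigr => j _; rewrite gE.
rewrite (Gmet_form (Z p) (W p) a b r0 v (fun j => (v j)^*%C)).
rewrite (perp_formE (sum_WZ p) r0).
set U := \sum_j W p j * v j.
have -> : \sum_j Z p j * (v j)^*%C = U^*%C.
  by rewrite conjc_sum; apply: eq_bigr => j _; rewrite conjcMx conjcK.
set c := U / r p.
have -> : U^*%C / r p = c^*%C by rewrite /c !conjcE /r conj_r.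
have r_gt0 : 0 < r p by rewrite lt_def r0 znorm2_ge0.
have agt0 : 0 < a by rewrite /a ltcR.
have sgt0 : 0 < a + b by rewrite /a /b -realcD ltcR.
have e i : (v i - c * Z p i) * ((v i)^*%C - c^*%C * W p i) = `|v i - c * Z p i| ^+ 2.
  by rewrite sqr_normc !conjcE.
rewrite (eq_bigr _ (fun i _ => e i)) -sqr_normc.
have [U0|U0] := eqVneq U 0; last first.
  rewrite ltr_wpDl //; last first.
    by rewrite mulr_gt0 ?divr_gt0 ?exprn_gt0 ?normr_gt0.
  apply: mulr_ge0; first by rewrite divr_ge0 // ltW.
  by apply: sumr_ge0 => i _; rewrite exprn_ge0.
rewrite U0 normr0 expr0n /= mulr0 addr0 mulr_gt0 ?divr_gt0 //.
rewrite lt_def; apply/andP; split; last first.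
  by apply: sumr_ge0 => i _; rewrite exprn_ge0.
rewrite psumr_neq0; last by move=> i _; rewrite exprn_ge0.
apply/hasP; exists i0; first exact: mem_index_enum.
by rewrite /= /c U0 mul0r mul0r subr0 exprn_gt0 // normr_gt0.
Qed.

(** Both terms of g(alpha, beta) scale by t^-2, which the factors a_i and
    conj a_j compensate. *)
Lemma gab_deck c p i j : hopf_parameter c -> punctured p ->
  g (deck c p) i j * c i * (c j)^*%C = g p i j.
Proof.
move=> hc pp; have [t [t0 _] ht] := hopf_parameter_norm hc.
have tc0 : (t ^+ 2)%:C != 0 :> R[i].
  by rewrite eq_complex /= eqxx andbT expf_neq0 // gt_eqF.
have r0 : znorm2 p != 0 := punctured_r pp.
have dp : punctured (deck c p).
  by apply/(deck_punctured p _ ht) => //; rewrite gt_eqF.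
rewrite !gE // /Gmet /Z /W /r /a /b !zc_deck (znorm2_deck p ht).
rewrite conjcMx.
have d : (i == j)%:R * (c i * (c j)^*%C) = (i == j)%:R * (t ^+ 2)%:C.
  by have [->|_] := eqVneq i j; rewrite ?ht ?mul0r.
transitivity (al%:C / ((t ^+ 2)%:C * znorm2 p) * ((i == j)%:R * (c i * (c j)^*%C))
  + be%:C / ((t ^+ 2)%:C * znorm2 p) ^+ 2 * ((c i * (c i)^*%C) * (c j * (c j)^*%C))
    * ((zc p i)^*%C * zc p j)).
  move: (al%:C / _) (be%:C / _) (zc p j) (zc p i)^*%C (c i) (c j) (c i)^*%C (c j)^*%C.
  by move: ((i == j)%:R : R[i]) => *; ring.
rewrite d !ht; move: tc0 r0; move: (t ^+ 2)%:C (znorm2 p) (al%:C) (be%:C).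
move: (zc p j) (zc p i)^*%C ((i == j)%:R : R[i]) => z w e T u a' b' T0 u0.
by field; rewrite T0 u0.
Qed.

End HopfMetricTensors.

(** * Bismut-Griffiths non-negativity of g(alpha, beta) *)

Section QuadraticForm.
Variables (F : numFieldType) (n : nat) (A : 'I_n -> 'I_n -> F) (c m : F).
Implicit Types u v : 'I_n -> F.
Let pf u v := \sum_i \sum_j A i j * u i * v j.

Lemma mul_sum2 (X Y : 'I_n -> 'I_n -> F) :
  (\sum_i \sum_j X i j) * (\sum_k \sum_l Y k l) =
  \sum_i \sum_j \sum_k \sum_l X i j * Y k l.
Proof.
rewrite mulr_suml; apply: eq_bigr => i _; rewrite mulr_suml; apply: eq_bigr => j _.
by rewrite mulr_sumr; apply: eq_bigr => k _; rewrite mulr_sumr.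
Qed.

(** Evaluation of the two products of projections on a pair of vectors. *)
Lemma curvature_form xi xb nu nb :
  \sum_i \sum_j \sum_k \sum_l
    c * (m * A i j * A k l + A k j * A i l) * xi i * xb j * nu k * nb l =
  c * (m * (pf xi xb * pf nu nb) + pf nu xb * pf xi nb).
Proof.
rewrite /pf mul_sum2 [X in _ + X]mulrC mul_sum2.
have -> : \sum_i \sum_j \sum_k \sum_l (A i j * xi i * nb j) * (A k l * nu k * xb l) =
  \sum_i \sum_j \sum_k \sum_l (A i l * xi i * nb l) * (A k j * nu k * xb j).
  apply: eq_bigr => i _; rewrite exchange_big [RHS]exchange_big /=.
  by apply: eq_bigr => k _; rewrite exchange_big.
rewrite mulrDr !mulr_sumr -big_split; apply: eq_bigr => i _ /=.
rewrite !mulr_sumr -big_split; apply: eq_bigr => j _ /=.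
rewrite !mulr_sumr -big_split; apply: eq_bigr => k _ /=.
rewrite !mulr_sumr -big_split; apply: eq_bigr => l _ /=.
ring.
Qed.

End QuadraticForm.

(** The curvature of a real connection is real, so its barred components need
    no computation. *)
Lemma curvature_bar {R : realType} {n : nat} (G : Cn R n ->
    'I_n + 'I_n -> 'I_n + 'I_n -> 'I_n + 'I_n -> R[i]) (p : Cn R n) A B C D :
  (forall q, punctured q -> forall A B C,
     G q (barI A) (barI B) (barI C) = (G q A B C)^*%C) ->
  (forall A B C, cdiff (fun q => G q A B C) p) -> punctured p ->
  curvature G p (barI A) (barI B) (barI C) (barI D) = (curvature G p A B C D)^*%C.
Proof.
move=> hb hd pp; rewrite /curvature !conjcDx conjcNx conjc_sum.
have h X Y U V : pd (barI X) (fun q => G q (barI Y) (barI U) (barI V)) p =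
    (pd X (fun q => G q Y U V) p)^*%C.
  rewrite -{2}(barIK X) -pd_conj; last exact: hd.
  by apply: pd_near; have := near_punctured pp; apply: filterS => q pq; rewrite hb.
rewrite !h; congr (_ + _).
rewrite (reindex_inj (inv_inj (@barIK n))) /=; apply: eq_bigr => E _.
by rewrite !hb // conjcBx !conjcMx.
Qed.

Section BismutGriffiths.
Context {R : realType} {n : nat}.
Variables (al be : R) (g : Cn R n -> 'M[R[i]]_n).
Hypothesis (al0 : 0 < al) (sl0 : 0 < al + be).
Hypothesis hg : forall p, punctured p -> g p = gab al be p.
Let a : R[i] := al%:C.
Let b : R[i] := be%:C.
Let Z (p : Cn R n) (i : 'I_n) := zc p i.
Let W (p : Cn R n) (i : 'I_n) := (zc p i)^*%C.
Let r (p : Cn R n) : R[i] := znorm2 p.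
Let U p := bismut10 (Z p) (W p) (r p) a b.
Let L p := bismut01 (Z p) (W p) (r p) a b.
Implicit Type p : Cn R n.

Let a0 : a != 0 := a_neq0 al0.
Let s0 : a + b != 0 := s_neq0 sl0.
Let rg : regular_metric g := gab_regular al0 sl0 hg.

Lemma gab_bismut_lower : bismut_lower g U L.
Proof.
move=> p pp k i q; have r0 : r p != 0 := punctured_r pp.
rewrite !(proj2 (gab_has_pd hg _ _ pp)).
rewrite -(bismut10_lower b (sum_WZ p) r0 a0 k i q) -(bismut01_lower b (sum_WZ p) r0 a0 k i q).
by split; apply: eq_bigr => d _; rewrite (gabE hg).
Qed.

Lemma bismut10_has_pd p k i d : punctured p -> has_pd (fun q => U q k i d) p
  (fun A => match A with inl m => d_bismut10 (Z p) (W p) (r p) a b m k i d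
                       | inr l => dbar_bismut10 (Z p) (W p) (r p) a b l k i d end).
Proof.
move=> pp; have r0 : znorm2 p != 0 := punctured_r pp.
have [D [[D1 D2] DE]] : exists D, has_pd (fun q => U q k i d) p D /\
   forall A, D A = (match A with inl m => d_bismut10 (Z p) (W p) (r p) a b m k i d
                       | inr l => dbar_bismut10 (Z p) (W p) (r p) a b l k i d end).
  eexists; split.
    by rewrite /U /bismut10 /Z /W /r; pv => //; rewrite ?expf_neq0.
  rewrite /d_bismut10 /dbar_bismut10 /Z /W /r.
  move: r0 a0; move: (znorm2 p) (zc p) a b => u z a' b' u0 a0'.
  case=> m; move: (z k) (z i) (z d) (z m) (z k)^*%C (z i)^*%C (z d)^*%C (z m)^*%C => *.
    move: ((d == k)%:R : R[i]) ((d == i)%:R : R[i]) ((m == d)%:R : R[i]) => *.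
    by field; rewrite u0 a0'.
  rewrite ![(m == k)]eq_sym.
  move: ((d == k)%:R : R[i]) ((d == i)%:R : R[i]) ((m == i)%:R : R[i])
   ((k == m)%:R : R[i]) => *.
  by field; rewrite u0 a0'.
by split=> // A; rewrite D2 DE.
Qed.

Lemma bismut01_has_pd p l i d : punctured p -> has_pd (fun q => L q l i d) p
  (fun A => match A with inl k => d_bismut01 (Z p) (W p) (r p) a b k l i d
                       | inr m => dbar_bismut01 (Z p) (W p) (r p) a b m l i d end).
Proof.
move=> pp; have r0 : znorm2 p != 0 := punctured_r pp.
have [D [[D1 D2] DE]] : exists D, has_pd (fun q => L q l i d) p D /\
   forall A, D A = (match A with inl k => d_bismut01 (Z p) (W p) (r p) a b k l i d
                       | inr m => dbar_bismut01 (Z p) (W p) (r p) a b m l i d end).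
  eexists; split.
    by rewrite /L /bismut01 /Z /W /r; pv => //; rewrite ?expf_neq0.
  rewrite /d_bismut01 /dbar_bismut01 /Z /W /r.
  move: r0 a0; move: (znorm2 p) (zc p) a b => u z a' b' u0 a0'.
  case=> m; move: (z l) (z i) (z d) (z m) (z l)^*%C (z i)^*%C (z d)^*%C (z m)^*%C => *.
    move: ((d == i)%:R : R[i]) ((m == l)%:R : R[i]) ((m == d)%:R : R[i])
      ((l == i)%:R : R[i]) => *.
    by field; rewrite u0 a0'.
  move: ((d == i)%:R : R[i]) ((m == i)%:R : R[i]) ((l == i)%:R : R[i]) => *.
  by field; rewrite u0 a0'.
by split=> // A; rewrite D2 DE.
Qed.

Section AnyBismut.
Variable G : Cn R n -> 'I_n + 'I_n -> 'I_n + 'I_n -> 'I_n + 'I_n -> R[i].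
Hypothesis bG : bismut_connection g G.
Let hG : hermitian_connection g G := proj1 bG.

Lemma bismut_U p k i d : punctured p -> G p (inl k) (inl i) (inl d) = U p k i d.
Proof.
move=> pp; have [u _] := gab_unit al0 sl0 hg pp.
rewrite (raise_unique u (fun q => (bismut_lowerE rg bG pp k i q).1) d).
by rewrite (raise_unique u (fun q => (gab_bismut_lower pp k i q).1) d).
Qed.

Lemma bismut_L p k i d : punctured p -> G p (inr k) (inl i) (inl d) = L p k i d.
Proof.
move=> pp; have [u _] := gab_unit al0 sl0 hg pp.
rewrite (raise_unique u (fun q => (bismut_lowerE rg bG pp k i q).2) d).
by rewrite (raise_unique u (fun q => (gab_bismut_lower pp k i q).2) d).
Qed.

Let UL p (A : 'I_n + 'I_n) := match A with inl k => U p k | inr k => L p k end.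

Lemma bismut_UL p A i d : punctured p -> G p A (inl i) (inl d) = UL p A i d.
Proof. by case: A => k pp; [exact: bismut_U|exact: bismut_L]. Qed.

Lemma pd_bismut_UL p A B i d : punctured p ->
  pd A (fun q => G q B (inl i) (inl d)) p = pd A (fun q => UL q B i d) p.
Proof.
move=> pp; apply: pd_near; have := near_punctured pp; apply: filterS => q pq.
exact: bismut_UL.
Qed.

Lemma bismut_curvature_l p A B i d : punctured p ->
  curvature G p A B (inl i) (inl d) =
  pd A (fun q => UL q B i d) p - pd B (fun q => UL q A i d) p
  + \sum_q (UL p B i q * UL p A q d - UL p A i q * UL p B q d).
Proof.
move=> pp; rewrite /curvature !pd_bismut_UL // sum_frame.
rewrite [X in _ + (_ + X)]big1 ?addr0; last first.
  by move=> e _; rewrite !(hc_lr hG) // !mul0r subrr.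
by congr (_ + _); apply: eq_bigr => e _; rewrite !bismut_UL.
Qed.

(** Up to conjugation and exchange of the first two slots, the only
    components of the curvature that do not vanish. *)
Lemma bismut_curvature11 p k l i d : punctured p ->
  curvature G p (inl k) (inr l) (inl i) (inl d) =
  (- (1 + 2 * (b / a)) * perp_proj (Z p) (W p) (r p) k l * perp_proj (Z p) (W p) (r p) i d
   + perp_proj (Z p) (W p) (r p) i l * perp_proj (Z p) (W p) (r p) k d) / r p.
Proof.
move=> pp; have r0 : r p != 0 := punctured_r pp.
rewrite bismut_curvature_l // -(bismut_R11_contraction b (sum_WZ p) r0 a0).
by rewrite (proj2 (bismut01_has_pd _ _ _ pp)) (proj2 (bismut10_has_pd _ _ _ pp)).
Qed.

Lemma bismut_curvature_same p A B i d : punctured p -> is10 A = is10 B ->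
  curvature G p A B (inl i) (inl d) = 0.
Proof.
move=> pp; have r0 : r p != 0 := punctured_r pp.
case: A => k; case: B => m // _; rewrite bismut_curvature_l //.
  apply: etrans (bismut_R20_contraction b (sum_WZ p) r0 a0 k m i d).
  by rewrite !(proj2 (bismut10_has_pd _ _ _ pp)).
apply: etrans (bismut_R02_contraction b (sum_WZ p) r0 a0 k m i d).
by rewrite !(proj2 (bismut01_has_pd _ _ _ pp)).
Qed.

Lemma cdiff_bismut p A B C : punctured p -> cdiff (fun q => G q A B C) p.
Proof.
move=> pp.
have ll A' i d : cdiff (fun q => G q A' (inl i) (inl d)) p.
  apply: (@cdiff_near _ _ (fun q => UL q A' i d)).
    have := near_punctured pp; apply: filterS => q pq; by rewrite bismut_UL.
  by case: A' => k; [case: (bismut10_has_pd k i d pp)|case: (bismut01_has_pd k i d pp)].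
case: B => i; case: C => d.
- exact: ll.
- apply: (@cdiff_near _ _ (fun=> 0)); last exact: cdiff_cst.
  have := near_punctured pp; apply: filterS => q pq; by rewrite (hc_lr hG).
- apply: (@cdiff_near _ _ (fun=> 0)); last exact: cdiff_cst.
  have := near_punctured pp; apply: filterS => q pq; by rewrite (hc_rl hG).
- apply: (@cdiff_near _ _ (fun q => (G q (barI A) (inl i) (inl d))^*%C)).
    have := near_punctured pp; apply: filterS => q pq.
    by rewrite -(hc_bar hG) // barIK.
  by apply: cdiff_conj; exact: ll.
Qed.

Lemma bismut_curvature_lr p A B i d : punctured p ->
  curvature G p A B (inl i) (inr d) = 0.
Proof.
move=> pp; rewrite /curvature.
have z X Y : pd X (fun q => G q Y (inl i) (inr d)) p = 0.
  rewrite -(pd_cst X 0 p); apply: pd_near.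
  have := near_punctured pp; apply: filterS => q pq; by rewrite (hc_lr hG).
rewrite !z subrr add0r big1 // => -[e|e] _.
  by rewrite !(hc_lr hG) // !mulr0 subrr.
by rewrite !(hc_lr hG) // !mul0r subrr.
Qed.

Lemma bismut_curvature_low11 p k l i j : punctured p ->
  curvature_low g G p (inl k) (inr l) (inl i) (inr j) =
  a / r p ^+ 2 * (- (1 + 2 * (b / a)) * perp_proj (Z p) (W p) (r p) k l * perp_proj (Z p) (W p) (r p) i j
   + perp_proj (Z p) (W p) (r p) i l * perp_proj (Z p) (W p) (r p) k j).
Proof.
move=> pp; have r0 : r p != 0 := punctured_r pp.
rewrite -(bismut_R11_lower a b (sum_WZ p) r0) /curvature_low sum_frame.
rewrite [X in _ + X]big1 ?addr0; last by move=> d _; exact: mulr0.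
by apply: eq_bigr => d _; rewrite bismut_curvature11 //= (gabE hg).
Qed.

Lemma bismut_curvature_r p A B i D : punctured p ->
  curvature G p A B (inr i) D = (curvature G p (barI A) (barI B) (inl i) (barI D))^*%C.
Proof.
move=> pp; rewrite -(@curvature_bar _ _ G p) ?barIK //.
  by move=> q pq *; exact: (hc_bar hG).
by move=> *; exact: cdiff_bismut.
Qed.

(** The clause of non-negativity that asks for the curvature to be of type
    (1,1) in each pair holds identically in this family. *)
Lemma bismut_curvature_low_type p A B C D : punctured p ->
  is10 A = is10 B \/ is10 C = is10 D -> curvature_low g G p A B C D = 0.
Proof.
move=> pp h; rewrite /curvature_low sum_frame.
have same : is10 A = is10 B -> is10 (barI A) = is10 (barI B).
  by case: (A); case: (B).
case: C h => i; case: D => j h; rewrite !big1 ?addr0 // => d _ /=;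
  rewrite ?mulr0 // ?bismut_curvature_r ?bismut_curvature_lr ?conjc0 ?mul0r //.
  by rewrite bismut_curvature_same ?mul0r //; case: h.
by rewrite bismut_curvature_same ?conjc0 ?mul0r //; apply: same; case: h.
Qed.

(** The quantity whose sign is in question, with c standing for conjugation
    of vectors. *)
Definition bismut_form p (xi nu : 'I_n -> R[i]) :=
  let pf := perp_form (Z p) (W p) (r p) in
  let c v (i : 'I_n) := (v i)^*%C in
  a / r p ^+ 2 * (- (1 + 2 * (b / a)) * (pf xi (c xi) * pf nu (c nu))
                  + pf nu (c xi) * pf xi (c nu)).

Lemma bismut_formE p xi nu : punctured p ->
  \sum_(i < n) \sum_(j < n) \sum_(k < n) \sum_(l < n)
    curvature_low g G p (inl i) (inr j) (inl k) (inr l)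
    * xi i * (xi j)^*%C * nu k * (nu l)^*%C = bismut_form p xi nu.
Proof.
move=> pp; rewrite /bismut_form /perp_form.
rewrite -(curvature_form (perp_proj (Z p) (W p) (r p)) (a / r p ^+ 2) (- (1 + 2 * (b / a)))).
by do 4 (apply: eq_bigr => ? _); rewrite bismut_curvature_low11.
Qed.

End AnyBismut.

Lemma gab_BG_nonneg_iff_form : BG_nonneg g <->
  forall p xi nu, punctured p -> (exists i, xi i != 0) -> (exists i, nu i != 0) ->
    0 <= bismut_form p xi nu.
Proof.
split=> [[G bG h] p xi nu pp xi0 nu0|h].
  by rewrite -(bismut_formE bG) //; have [_] := h p pp; exact.
have bG := bismut_real_connection rg gab_bismut_lower.
exists (real_connection U L) => // Om p pp; split.
  by move=> *; exact: (bismut_curvature_low_type bG).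
by move=> xi nu xi0 nu0; rewrite (bismut_formE bG) //; exact: h.
Qed.

(** Equivalent to y <= 1 for n = 2 and to y <= 1/2 for n >= 3, where y = (al
    + be) / al. *)
Definition BG_condition := if n == 2%N then be <= 0 else al + 2 * be <= 0.

(** In dimension two the orthogonal complement of the radial direction is a
    line, so the two products of projections coincide; this is why the
    criterion is weaker there. *)
Lemma perp_form_rank1 (F : numFieldType) m (z w : 'I_m -> F) (t : F) u v u' v' :
  m = 2%N -> \sum_i w i * z i = t -> t != 0 ->
  perp_form z w t u v * perp_form z w t u' v' =
  perp_form z w t u v' * perp_form z w t u' v.
Proof.
move=> m2; subst m => ht t0.
have e (x x' : 'I_2 -> F) : perp_form z w t x x' =
    (z 1 * x 0 - z 0 * x 1) * (w 1 * x' 0 - w 0 * x' 1) / t.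
  rewrite /perp_form !big_ord_recl !big_ord0 !addr0.
  have -> : lift ord0 ord0 = 1 :> 'I_2 by apply/val_inj.
  rewrite -[ord0]/(0 : 'I_2) /perp_proj !eqxx.
  have -> : (0 == 1 :> 'I_2) = false by [].
  have -> : (1 == 0 :> 'I_2) = false by [].
  move: ht t0; rewrite !big_ord_recl !big_ord0 !addr0.
  have -> : lift ord0 ord0 = 1 :> 'I_2 by apply/val_inj.
  rewrite -[ord0]/(0 : 'I_2) /=.
  move: (z 0) (z 1) (w 0) (w 1) (x 0) (x 1) (x' 0) (x' 1) => z0 z1 w0 w1 x0 x1 y0 y1.
  by move=> <- t0; field.
by rewrite !e; field.
Qed.

Lemma perp_form_ge0 p u : punctured p ->
  0 <= perp_form (Z p) (W p) (r p) u (fun i => (u i)^*%C).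
Proof.
move=> pp; have r0 : r p != 0 := punctured_r pp.
rewrite (perp_formE (sum_WZ p) r0); apply: sumr_ge0 => i _.
set t := _ / _; have -> : (\sum_j Z p j * (u j)^*%C) / r p = t^*%C.
  rewrite /t !conjcE conjc_sum /r conj_r; congr (_ / _); apply: eq_bigr => j _.
  by rewrite conjcMx conjcK.
have -> : (u i)^*%C - t^*%C * W p i = (u i - t * Z p i)^*%C by rewrite !conjcE.
exact: mulcJ_ge0.
Qed.

Lemma perp_form_conj p u v : punctured p ->
  perp_form (Z p) (W p) (r p) v (fun i => (u i)^*%C) =
  (perp_form (Z p) (W p) (r p) u (fun i => (v i)^*%C))^*%C.
Proof.
move=> pp; rewrite /perp_form conjc_sum exchange_big; apply: eq_bigr => i _ /=.
rewrite conjc_sum; apply: eq_bigr => j _.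
rewrite /perp_proj /W /Z /r !conjcE conj_r eq_sym.
by move: ((i == j)%:R : R[i]) (u i)^*%C (zc p i) (zc p j)^*%C => *; ring.
Qed.

(** For n >= 3 both terms of the form are non-negative; for n = 2 they are
    proportional and only their sum is. *)
Lemma BG_condition_sufficient : (2 <= n)%N -> BG_condition -> BG_nonneg g.
Proof.
move=> n2 cond; apply/gab_BG_nonneg_iff_form => p xi nu pp _ _.
have r0 : r p != 0 := punctured_r pp.
have ag0 : 0 <= a by rewrite /a ler0c ltW.
have rg0 : 0 <= r p by exact: znorm2_ge0.
rewrite /bismut_form /=; apply: mulr_ge0; first by rewrite divr_ge0 // exprn_ge0.
set X := perp_form _ _ _ xi (fun i => (xi i)^*%C); set Y := perp_form _ _ _ nu (fun i => (nu i)^*%C).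
have XY : 0 <= X * Y by apply: mulr_ge0; exact: perp_form_ge0.
have aE : 1 + 2 * (b / a) = ((al + 2 * be) / al)%:C.
  rewrite !realcE -/a -/b.
  by move: a0; move: a b => u v u0; field.
move: cond; rewrite /BG_condition; case: eqP => [n2'|_] cond.
  rewrite (perp_form_rank1 nu (fun i => (xi i)^*%C) xi (fun i => (nu i)^*%C) n2' (sum_WZ p) r0).
  rewrite -/X -/Y (mulrC Y X).
  rewrite (_ : _ + X * Y = (- (1 + 2 * (b / a)) + 1) * (X * Y)); last first.
    by rewrite [RHS]mulrDl mul1r.
  apply: mulr_ge0 => //.
  have -> : - (1 + 2 * (b / a)) + 1 = (- (2 * be / al))%:C.
    rewrite !realcE -/a -/b.
    by move: a0; move: a b => u v u0; field.
  by rewrite ler0c oppr_ge0 pmulr_lle0 ?invr_gt0 // pmulr_rle0.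
apply: addr_ge0; last by rewrite perp_form_conj // mulrC mulcJ_ge0.
rewrite mulNr -mulrN mulrC mulNr -mulrN; apply: mulr_ge0 => //.
by rewrite aE -realcN ler0c oppr_ge0 pmulr_lle0 ?invr_gt0.
Qed.

Lemma perp_form_delta (z w : 'I_n -> R[i]) (t : R[i]) i j :
  perp_form z w t (fun k => (k == i)%:R) (fun k => ((k == j)%:R : R[i])^*%C) = perp_proj z w t i j.
Proof.
rewrite /perp_form -[RHS](sum_delta (fun k => perp_proj z w t k j) i); apply: eq_bigr => k _.
rewrite -[in RHS](sum_delta (fun l => perp_proj z w t k l) j) mulr_suml.
by apply: eq_bigr => l _; rewrite conjc_nat mulrAC.
Qed.

(** Tested at the point e_0: with xi = nu = e_1 both terms contribute, with
    xi = e_1 and nu = e_2 only the first one does. *)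
Lemma BG_condition_necessary : (2 <= n)%N -> BG_nonneg g -> BG_condition.
Proof.
move=> n2 /gab_BG_nonneg_iff_form h.
have n0 : (0 < n)%N by exact: leq_trans n2.
pose i0 := Ordinal n0; pose i1 := Ordinal n2.
pose p0 : Cn R n := (delta_mx 0 i0, 0).
have zp i : Z p0 i = (i == i0)%:R.
  by rewrite /Z /zc !mxE eqxx /=; case: eqP.
have rp : r p0 = 1.
  rewrite /r znorm2E (eq_bigr (fun i => (i == i0)%:R * (i == i0)%:R)).
    by rewrite sum_delta eqxx.
  by move=> i _; rewrite -/(Z p0 i) zp conjc_nat.
have pp : punctured p0.
  by rewrite /punctured /= -znorm2_eq0 -/(r p0) rp oner_eq0.
have P i j : i != i0 -> perp_proj (Z p0) (W p0) (r p0) i j = (i == j)%:R.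
  by move=> ii; rewrite /perp_proj /W -/(Z p0 i) zp (negbTE ii) conjc0 mul0r mul0r subr0.
have form i j : i != i0 -> j != i0 ->
    0 <= a * (- (1 + 2 * (b / a)) + (i == j)%:R).
  move=> ii ji.
  have := h p0 (fun k => (k == i)%:R) (fun k => (k == j)%:R) pp.
  rewrite /bismut_form /= !perp_form_delta !P // !eqxx !mulr1 rp expr1n divr1.
  rewrite [j == i]eq_sym; have -> : (i == j)%:R * (i == j)%:R = (i == j)%:R :> R[i].
    by case: (i == j); rewrite ?mulr1 ?mulr0.
  by apply; [exists i|exists j]; rewrite eqxx oner_eq0.
have c0 : a * (- (1 + 2 * (b / a))) = (- (al + 2 * be))%:C.
  by rewrite !realcE -/a -/b; move: a0; move: a b => u v u0; field.
rewrite /BG_condition; case: eqP => [_|n2'].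
  have := form i1 i1 isT isT; rewrite eqxx /= mulrDr c0 mulr1.
  rewrite /a -realcD ler0c; lra.
have n3 : (2 < n)%N by rewrite ltn_neqAle n2 andbT eq_sym; apply/eqP.
have := form i1 (Ordinal n3) isT isT.
by rewrite (_ : (i1 == _) = false) // addr0 c0 ler0c oppr_ge0.
Qed.

End BismutGriffiths.

(** * Smoothness of families g(alpha(t), beta(t)) *)

Section SmoothClass.
Context {R : realType} {V : normedModType R}.
Variables (U : set V) (At : set (V -> R)).
Implicit Types f g : V -> R.

(** Polynomials in a set of atoms. When the derivatives of the atoms are
    again polynomials in the atoms, the class is closed under
    differentiation, and smoothness to every order follows from continuity of
    the atoms. *)
Inductive sm : (V -> R) -> Prop :=
| sm_cst c : sm (fun=> c)
| sm_atom f : At f -> sm f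
| sm_add f g : sm f -> sm g -> sm (fun q => f q + g q)
| sm_mul f g : sm f -> sm g -> sm (fun q => f q * g q).

Lemma sm_opp f : sm f -> sm (fun q => - f q).
Proof.
move=> h; have := sm_mul (sm_cst (-1)) h.
by under eq_fun do rewrite mulN1r.
Qed.

Lemma sm_sum (I : finType) (F : I -> V -> R) :
  (forall i, sm (F i)) -> sm (fun q => \sum_i F i q).
Proof.
move=> h; have: forall s : seq I, sm (fun q => \sum_(i <- s) F i q); last exact.
elim=> [|i s ih].
  by under eq_fun do rewrite big_nil; exact: sm_cst.
by under eq_fun do rewrite big_cons; exact: sm_add.
Qed.

Hypothesis atom_continuous : forall f p, At f -> U p -> {for p, continuous f}.
Hypothesis atom_derive : forall f v, At f ->
  exists2 f', sm f' & forall p, U p -> is_derive p v f (f' p).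

Lemma sm_continuous f p : sm f -> U p -> {for p, continuous f}.
Proof.
move=> h Up; elim: h => [c|{}f|{}f g _ cf _ cg|{}f g _ cf _ cg].
- exact: cst_continuous.
- by move=> ?; exact: atom_continuous.
- exact: continuousD.
- exact: continuousM.
Qed.

Lemma sm_derive f v : sm f ->
  exists2 f', sm f' & forall p, U p -> is_derive p v f (f' p).
Proof.
elim=> [c|{}f af|{}f g _ [f' sf hf] _ [g' sg hg]|{}f g smf [f' sf hf] smg [g' sg hg]].
- by exists (fun=> 0); [exact: sm_cst|move=> p _; exact: is_derive_cst].
- exact: atom_derive.
- exists (fun q => f' q + g' q); first exact: sm_add.
  by move=> p Up; have := hf p Up; have := hg p Up => ? ?; exact: is_deriveD.
- exists (fun q => f q * g' q + g q * f' q).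
    by apply: sm_add; exact: sm_mul.
  by move=> p Up; have := hf p Up; have := hg p Up => ? ?; exact: is_deriveM.
Qed.

(** The regularity clause asks for derivatives in the interior only but for
    continuity on all of D; both hold on the larger set U. *)
Lemma sm_Ck k (D : set V) f : D `<=` U -> sm f -> Ck k D f.
Proof.
move=> DU; elim: k f => [|k ih] f sf; (split; last first).
- by [].
- by apply: continuous_in_subspaceT => p /[1!inE] /DU Up; exact: sm_continuous.
- move=> v; have [f' sf' hf] := sm_derive v sf.
  exists f'; last exact: ih.
  by move=> p /interior_subset /DU; exact: hf.
- by apply: continuous_in_subspaceT => p /[1!inE] /DU Up; exact: sm_continuous.
Qed.

Definition csm (f : V -> R[i]) := sm (fun q => Rep (f q)) /\ sm (fun q => Imp (f q)).

Lemma csm_smooth (D : set V) (f : V -> R[i]) : D `<=` U -> csm f -> smooth D f.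
Proof. by move=> DU [a b] k; split; exact: sm_Ck. Qed.

Lemma csm_ext (f g : V -> R[i]) : f =1 g -> csm f -> csm g.
Proof. by move=> /funext ->. Qed.

Lemma csm_real f : sm f -> csm (fun q => (f q)%:C).
Proof. by move=> h; split=> //=; exact: sm_cst. Qed.

Lemma csm_cst c : csm (fun=> c).
Proof. by split; exact: sm_cst. Qed.

Lemma csmD (f g : V -> R[i]) : csm f -> csm g -> csm (fun q => f q + g q).
Proof.
by move=> [a b] [c d]; split; [under eq_fun do rewrite raddfD /=|
  under eq_fun do rewrite raddfD /=]; exact: sm_add.
Qed.

Lemma csmM (f g : V -> R[i]) : csm f -> csm g -> csm (fun q => f q * g q).
Proof.
move=> [a b] [c d]; split.
  under eq_fun do rewrite Re_mul.
  by apply: sm_add; [exact: sm_mul|apply: sm_opp; exact: sm_mul].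
by under eq_fun do rewrite Im_mul; apply: sm_add; exact: sm_mul.
Qed.

Lemma csm_conj (f : V -> R[i]) : csm f -> csm (fun q => (f q)^*%C).
Proof.
move=> [a b]; have ReJ (x : R[i]) : Rep x^*%C = Rep x by case: x.
have ImJ (x : R[i]) : Imp x^*%C = - Imp x by case: x.
split; first by under eq_fun do rewrite ReJ.
by under eq_fun do rewrite ImJ; exact: sm_opp.
Qed.

End SmoothClass.

Lemma sm_mono {R : realType} {V : normedModType R} (A B : set (V -> R)) f :
  A `<=` B -> sm A f -> sm B f.
Proof.
move=> AB; elim=> [c|g /AB Bg|g h _ ? _ ?|g h _ ? _ ?].
- exact: sm_cst.
- exact: sm_atom.
- exact: sm_add.
- exact: sm_mul.
Qed.

Section SpaceFunctions.
Context {R : realType} {n : nat}.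

Definition coord_atoms : set (Cn R n -> R) :=
  [set f | exists i, f = (fun q : Cn R n => q.1 0 i) \/
                     f = (fun q : Cn R n => q.2 0 i)].

Lemma coord_atom_continuous f p : coord_atoms f -> {for p, continuous f}.
Proof.
case=> i [->|->].
  apply: (continuous_comp (f := fst) (g := fun x : 'rV[R]_n => x 0 i)).
    exact: cvg_fst.
  exact: coord_continuous.
apply: (continuous_comp (f := snd) (g := fun x : 'rV[R]_n => x 0 i)).
  exact: cvg_snd.
exact: coord_continuous.
Qed.

Lemma coord_atom_derive f v (B : set (Cn R n -> R)) : coord_atoms f ->
  exists2 f', sm B f' & forall p, is_derive p v f (f' p).
Proof.
move=> cf; exists (fun=> f v); first exact: sm_cst.
by move=> p; apply: is_derive_linear => c u w; case: cf => i [->|->]; rewrite !mxE.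
Qed.

Definition sqnorm (p : Cn R n) : R :=
  \sum_i (p.1 0 i * p.1 0 i + p.2 0 i * p.2 0 i).

Lemma znorm2_sqnorm p : znorm2 p = (sqnorm p)%:C.
Proof.
rewrite znorm2E /sqnorm (big_morph _ (@realcD R) (erefl : (0 : R)%:C = 0)).
apply: eq_bigr => i _; rewrite /zc; simpc; congr (_ +i* _); ring.
Qed.

Lemma sqnorm_sm (B : set (Cn R n -> R)) : coord_atoms `<=` B -> sm B sqnorm.
Proof.
move=> cB; apply: sm_sum => i; apply: sm_add; apply: sm_mul; apply: sm_atom;
  apply: cB; exists i; first [by left | by right].
Qed.

Lemma sqnorm_neq0 p : punctured p -> sqnorm p != 0.
Proof. by move=> /punctured_r; rewrite znorm2_sqnorm eq_complex /= eqxx andbT. Qed.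

(** The atom 1 / |z|^2: its derivatives are polynomials in itself and the
    coordinates. *)
Definition rho (p : Cn R n) : R := (sqnorm p)^-1.
Definition space_atoms : set (Cn R n -> R) := coord_atoms `|` [set rho].

Lemma space_atom_continuous f p : space_atoms f -> punctured p -> {for p, continuous f}.
Proof.
case=> [cf _|->]; first exact: coord_atom_continuous.
move=> pp; apply: continuousV; first exact: sqnorm_neq0.
apply: (@sm_continuous _ _ setT coord_atoms) => //.
- by move=> g q cg _; exact: coord_atom_continuous.
- exact: sqnorm_sm.
Qed.

Lemma space_atom_derive f v : space_atoms f ->
  exists2 f', sm space_atoms f' & forall p, punctured p -> is_derive p v f (f' p).
Proof.
case=> [cf|->].
  have [f' sf hf] := @coord_atom_derive f v space_atoms cf.
  by exists f' => // p _; exact: hf.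
have cs : coord_atoms `<=` space_atoms by move=> g; left.
have [d sd hd] : exists2 f', sm coord_atoms f' &
    forall p, setT p -> is_derive p v sqnorm (f' p).
  apply: sm_derive; last exact: sqnorm_sm.
  by move=> g w cg; have [g' sg hg] := @coord_atom_derive g w coord_atoms cg; exists g'.
have sr : sm space_atoms rho by apply: sm_atom; right.
exists (fun q => - (rho q * rho q * d q)).
  by apply: sm_opp; apply: sm_mul; [exact: sm_mul|exact: (sm_mono cs)].
move=> p pp; have dp := hd p I; have p0 := sqnorm_neq0 pp.
have : is_derive p v rho (- sqnorm p ^- 2 *: d p).
  apply: DeriveDef; first by apply: derivableV => //; case: dp.
  by rewrite deriveV //; case: dp => // _ ->.
by move=> h; apply: (is_derive_eq h); rewrite /rho /GRing.scale /= -exprVn expr2 mulNr.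
Qed.

Lemma csm_zc (B : set (Cn R n -> R)) i : coord_atoms `<=` B -> csm B (fun q => zc q i).
Proof.
by move=> cB; split; apply: sm_atom; apply: cB; exists i; [left|right].
Qed.

End SpaceFunctions.

Section TimeSpace.
Context {R : realType} {n : nat}.
Variables (J : set R) (TA : set (R -> R)).
Hypothesis time_continuous : forall f t, TA f -> J t -> {for t, continuous f}.
Hypothesis time_derive : forall f v, TA f ->
  exists2 f', sm TA f' & forall t, J t -> is_derive t v f (f' t).

Lemma is_derive_fst (f : R -> R) (q w : R * Cn R n) d :
  is_derive q.1 w.1 f d -> is_derive q w (fun z : R * Cn R n => f z.1) d.
Proof. by move=> [a b]; split. Qed.

Lemma is_derive_snd (f : Cn R n -> R) (q w : R * Cn R n) d :
  is_derive q.2 w.2 f d -> is_derive q w (fun z : R * Cn R n => f z.2) d.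
Proof. by move=> [a b]; split. Qed.

(** Separate atoms in time and space; the family g(alpha(t), beta(t)) is
    bilinear in them. *)
Definition time_space_atoms : set (R * Cn R n -> R) :=
  [set f | (exists2 h, TA h & f = (fun q => h q.1)) \/
           (exists2 h, space_atoms h & f = (fun q => h q.2))].

Lemma sm_time f : sm TA f -> sm time_space_atoms (fun q => f q.1).
Proof.
elim=> [c|g Tg|g h _ ? _ ?|g h _ ? _ ?].
- exact: sm_cst.
- by apply: sm_atom; left; exists g.
- exact: sm_add.
- exact: sm_mul.
Qed.

Lemma sm_space f : sm space_atoms f -> sm time_space_atoms (fun q => f q.2).
Proof.
elim=> [c|g Tg|g h _ ? _ ?|g h _ ? _ ?].
- exact: sm_cst.
- by apply: sm_atom; right; exists g.
- exact: sm_add.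
- exact: sm_mul.
Qed.

Let U : set (R * Cn R n) := [set q | J q.1 /\ punctured q.2].

Lemma time_space_continuous f q : time_space_atoms f -> U q -> {for q, continuous f}.
Proof.
case=> -[h hh ->] [Jq pq].
  apply: (continuous_comp (f := fst) (g := h)); first exact: cvg_fst.
  exact: time_continuous.
apply: (continuous_comp (f := snd) (g := h)); first exact: cvg_snd.
exact: space_atom_continuous.
Qed.

Lemma time_space_derive f w : time_space_atoms f ->
  exists2 f', sm time_space_atoms f' & forall q, U q -> is_derive q w f (f' q).
Proof.
case=> -[h hh ->].
  have [h' sh dh] := time_derive w.1 hh; exists (fun q => h' q.1); first exact: sm_time.
  by move=> q [Jq _]; apply: is_derive_fst; exact: dh.
have [h' sh dh] := space_atom_derive w.2 hh; exists (fun q => h' q.2); first exact: sm_space.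
by move=> q [_ pq]; apply: is_derive_snd; exact: dh.
Qed.

Lemma csm_space f : csm space_atoms f -> csm time_space_atoms (fun q => f q.2).
Proof. by move=> [a b]; split; [exact: (sm_space a)|exact: (sm_space b)]. Qed.

Lemma gab_entryE (al be : R) (p : Cn R n) i j : gab al be p i j =
  al%:C * ((i == j)%:R * (rho p)%:C)
  + be%:C * (((zc p i)^*%C * zc p j) * ((rho p)%:C * (rho p)%:C)).
Proof.
rewrite mxE znorm2_sqnorm /rho !realcV.
by rewrite !mulrA expr2 invfM !mulrA.
Qed.

Lemma csm_gab_space : (forall i j, csm space_atoms
     (fun p : Cn R n => (i == j :> 'I_n)%:R * (rho p)%:C)) /\
  (forall i j, csm space_atoms
     (fun p : Cn R n => ((zc p i)^*%C * zc p j) * ((rho p)%:C * (rho p)%:C))).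
Proof.
have sr : csm space_atoms (fun p : Cn R n => (rho p)%:C).
  by apply: csm_real; apply: sm_atom; right.
have cz i : csm space_atoms (fun p : Cn R n => zc p i).
  by apply: csm_zc => g; left.
split=> i j; apply: csmM => //; first exact: csm_cst.
- by apply: csmM => //; exact: csm_conj.
- exact: csmM.
Qed.

Lemma gab_smooth (al be : R) i j :
  smooth (@punctured R n) (fun p => gab al be p i j).
Proof.
have [c1 c2] := csm_gab_space.
apply: (@csm_smooth _ _ punctured space_atoms) => //.
- exact: space_atom_continuous.
- exact: space_atom_derive.
- apply: (csm_ext (f := fun p => al%:C * ((i == j)%:R * (rho p)%:C)
    + be%:C * (((zc p i)^*%C * zc p j) * ((rho p)%:C * (rho p)%:C)))).
    by move=> p; rewrite gab_entryE.
  by apply: csmD; apply: csmM => //; exact: csm_cst.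
Qed.

Lemma gab_time_smooth (D : set (R * Cn R n)) (al be : R -> R) i j :
  sm TA al -> sm TA be -> D `<=` U ->
  smooth D (fun q : R * Cn R n => gab (al q.1) (be q.1) q.2 i j).
Proof.
move=> sal sbe DU; have [c1 c2] := csm_gab_space.
apply: (@csm_smooth _ _ U time_space_atoms) => //.
- exact: time_space_continuous.
- exact: time_space_derive.
- apply: (csm_ext (f := fun q : R * Cn R n =>
      (al q.1)%:C * ((i == j)%:R * (rho q.2)%:C)
    + (be q.1)%:C * (((zc q.2 i)^*%C * zc q.2 j) * ((rho q.2)%:C * (rho q.2)%:C)))).
    by move=> p; rewrite gab_entryE.
  apply: csmD; apply: csmM.
  + by apply: csm_real; exact: (sm_time sal).
  + exact: (csm_space (c1 i j)).
  + by apply: csm_real; exact: (sm_time sbe).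
  + exact: (csm_space (c2 i j)).
Qed.

End TimeSpace.

(** * The reduced ordinary differential equation *)

Section TimeChange.
Context {R : realType}.
Implicit Types f : R -> R.

Lemma is_derive1_scale (c : R) f (x d : R) :
  is_derive x 1 f d -> is_derive x 1 (fun z => c * f z) (c * d).
Proof. by move=> h; exact: is_deriveZ. Qed.

Lemma is_derive1_continuous f (x d : R) : is_derive x 1 f d -> {for x, continuous f}.
Proof.
by move=> [h _]; apply: differentiable_continuous; exact/derivable1_diffP.
Qed.

(** The inverse of the primitive th of a positive function. The primitive
    starts at lo / 2 < 0 rather than at 0, so that th and its inverse are
    differentiable at time 0 and not only to its right. *)
Lemma time_change f (lo : R) : lo < 0 -> (forall x, lo < x -> 0 < f x) ->
  (forall x, lo < x -> {for x, continuous f}) ->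
  exists th si : R -> R, [/\ th 0 = 0,
    forall x, lo / 2 < x -> is_derive x 1 th (f x),
    forall x y, lo / 2 < x -> x < y -> th x < th y,
    forall x, lo / 2 < x -> si (th x) = x &
    forall x, lo / 2 < x -> is_derive (th x) 1 si (f x)^-1].
Proof.
move=> lo0 fpos fcont.
have lo2 : lo < lo / 2 by lra.
pose F x := (\int[@lebesgue_measure R]_(t in [set` `[lo / 2, x]]) (f t))%R.
pose th x := F x - F 0.
have dF x : lo / 2 < x -> is_derive x 1 F (f x).
  move=> lx; have fi : (@lebesgue_measure R).-integrable `[lo / 2, x + 1] (EFin \o f).
    apply: continuous_compact_integrable; first exact: segment_compact.
    apply: continuous_in_subspaceT => z; rewrite inE /= in_itv /= => /andP[lz _].
    by apply: fcont; apply: lt_le_trans lz.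
  have x1 : x < x + 1 by rewrite ltrDl.
  have [d1 d2] := continuous_FTC1_closed x1 fi lx (fcont x (lt_trans lo2 lx)).
  by apply: DeriveDef; [exact: d1|rewrite -derive1E; exact: d2].
have dth x : lo / 2 < x -> is_derive x 1 th (f x).
  by move=> /dF d; have := is_deriveB d (is_derive_cst (F 0) x 1); rewrite subr0.
have thc x : lo / 2 < x -> {for x, continuous th}.
  by move=> /dth /is_derive1_continuous.
have inc x y : lo / 2 < x -> x < y -> th x < th y.
  move=> lx xy; rewrite -subr_gt0.
  have [z||z zxy ->] := MVT xy (f := th) (df := f).
  - by rewrite in_itv /= => /andP[xz _]; apply: dth; apply: lt_trans xz.
  - apply: continuous_in_subspaceT => z; rewrite inE /= in_itv /= => /andP[xz _].
    by apply: thc; apply: lt_le_trans xz.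
  - rewrite mulr_gt0 ?subr_gt0 // fpos //.
    move: zxy; rewrite in_itv /= => /andP[xz _].
    exact: (lt_trans (lt_trans lo2 lx) xz).
have inj x y : lo / 2 < x -> lo / 2 < y -> th x = th y -> x = y.
  move=> lx ly e; have [xy|yx|//] := ltgtP x y.
    by have := inc _ _ lx xy; rewrite e ltxx.
  by have := inc _ _ ly yx; rewrite e ltxx.
pose si t := xget 0 [set x | lo / 2 < x /\ th x = t].
have siK x : lo / 2 < x -> si (th x) = x.
  move=> lx; rewrite /si; case: xgetP => [y _ [ly e]|/(_ x)].
    exact: inj.
  by case.
exists th, si; split=> //; first by rewrite /th subrr.
move=> x lx; apply: is_derive_inverse.
- near=> z; apply: siK; near: z; exact: lt_nbhsr.
- near=> z; apply: thc; near: z; exact: lt_nbhsr.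
- exact: dth.
- by rewrite gt_eqF // fpos //; exact: lt_trans lx.
Unshelve. all: by end_near. Qed.

End TimeChange.

Section HomogeneousSystem.
Context {R : realType}.
Variables (N A B : R) (al0 y0 : R).
Hypothesis (N0 : 0 < N) (A0 : 0 <= A) (B0 : 0 <= B) (K0 : 0 < A + B)
  (al00 : 0 < al0) (y00 : 0 < y0).
Let K := A + B.

Let E x := expR (N * x).
(** The solution of al' = - N + B s / al, s' = - A (s / al)^2 in the time x
    with dt = al dx, for y = s / al: y is the logistic curve and al is the
    exponential of a primitive of - N + B y. *)
Definition flow_den x := N + K * y0 * (E x - 1).
Definition flow_y x := N * y0 * E x / flow_den x.
Definition flow_al x := al0 * expR (- (N * x) + B / K * ln (flow_den x / N)).
Let lo := - (K * y0)^-1.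

Lemma Ky0 : 0 < K * y0. Proof. exact: mulr_gt0. Qed.

Lemma lo_lt0 : lo < 0. Proof. by rewrite oppr_lt0 invr_gt0 Ky0. Qed.

(** The logistic curve exists for all x >= 0 and a little before. *)
Lemma flow_den_gt0 x : lo < x -> 0 < flow_den x.
Proof.
move=> lx; have h := expR_ge1Dx (N * x).
apply: (@lt_le_trans _ _ (N + K * y0 * (N * x))); last first.
  rewrite lerD2l; apply: ler_wpM2l; first by rewrite ltW // Ky0.
  by rewrite /E; lra.
have : 0 < N * (K * y0) * (x - lo) by rewrite mulr_gt0 ?subr_gt0 ?mulr_gt0 ?Ky0.
suff -> : N * (K * y0) * (x - lo) = N + K * y0 * (N * x) by [].
by rewrite /lo; move: Ky0; move: (K * y0) => u u0; field; rewrite gt_eqF.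
Qed.

Lemma flow_y_gt0 x : lo < x -> 0 < flow_y x.
Proof. by move=> lx; rewrite divr_gt0 ?flow_den_gt0 // !mulr_gt0 // expR_gt0. Qed.

Lemma flow_al_gt0 x : 0 < flow_al x.
Proof. by rewrite mulr_gt0 // expR_gt0. Qed.

Lemma is_derive_E (x : R) : is_derive x 1 E (N * E x).
Proof.
have d1 : is_derive x 1 (fun z : R => N * z) N.
  by have := is_derive1_scale N (is_derive_id x (1 : R)); rewrite mulr1.
have := @is_derive1_comp R expR (fun z => N * z) x _ _ (is_derive_expR _) d1.
by rewrite mulrC.
Qed.

Lemma is_derive_den (x : R) : is_derive x 1 flow_den (K * y0 * (N * E x)).
Proof.
have dE := is_derive_E x.
have d1 : is_derive x 1 (fun z => K * y0 * (E z - 1)) (K * y0 * (N * E x - 0)).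
  exact: (is_derive1_scale (K * y0) (is_deriveB dE (is_derive_cst (1 : R) x (1 : R)))).
have := is_deriveD (is_derive_cst N x (1 : R)) d1.
by rewrite add0r subr0.
Qed.

Lemma is_derive_flow_y (x : R) : lo < x ->
  is_derive x 1 flow_y (flow_y x * (N - K * flow_y x)).
Proof.
move=> lx; have D0 := flow_den_gt0 lx; have dE := is_derive_E x.
have dD := is_derive_den x.
have dV : is_derive x 1 (fun q => (flow_den q)^-1)
    (- flow_den x ^- 2 *: (K * y0 * (N * E x))).
  by apply: is_deriveV => //; rewrite gt_eqF.
have dN : is_derive x 1 (fun z => N * y0 * E z) (N * y0 * (N * E x)).
  exact: is_derive1_scale.
apply: (is_derive_eq (is_deriveM dN dV)).
rewrite /flow_y /GRing.scale /=; field.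
by rewrite gt_eqF.
Qed.

Lemma is_derive_flow_al (x : R) : lo < x ->
  is_derive x 1 flow_al (flow_al x * (- N + B * flow_y x)).
Proof.
move=> lx; have D0 := flow_den_gt0 lx.
have dD := is_derive_den x.
have d1 : is_derive x 1 (fun z => flow_den z / N) (N^-1 * (K * y0 * (N * E x))).
  by under eq_fun do rewrite mulrC; exact: is_derive1_scale.
have l0 : 0 < flow_den x / N by rewrite divr_gt0.
have d2 := @is_derive1_comp R (@ln R) (fun z => flow_den z / N) x _ _
  (is_derive1_ln l0) d1.
have d3 : is_derive x 1 (fun z => - (N * z)) (- (N * 1)).
  by apply: is_deriveN; exact: is_derive1_scale.
have d4 := is_deriveD d3 (is_derive1_scale (B / K) d2).
have d5 := is_derive1_scale al0 (@is_derive1_comp R expR _ x _ _ (is_derive_expR _) d4).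
apply: (is_derive_eq d5); rewrite /flow_al /flow_y /=.
rewrite -[expR ((_ + _) x)]/(expR (- (N * x) + B / K * ln (flow_den x / N))).
move: (expR (- (N * x) + _)) (E x) D0; move: (flow_den x) => D e e' D0.
by field; rewrite !gt_eqF.
Qed.

Lemma flow_den0 : flow_den 0 = N.
Proof. by rewrite /flow_den /E mulr0 expR0 subrr mulr0 addr0. Qed.

Lemma flow_y0 : flow_y 0 = y0.
Proof. by rewrite /flow_y flow_den0 /E mulr0 expR0; field; rewrite gt_eqF. Qed.

Lemma flow_al0 : flow_al 0 = al0.
Proof.
by rewrite /flow_al flow_den0 divff ?gt_eqF // ln1 mulr0 mulr0 oppr0 addr0 expR0 mulr1.
Qed.

(** Back in the original time. For each x1 the solution extends to a set J
    that contains the times 0 <= t < th x1 in its interior, so that it is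
    smooth up to the initial time. *)
Lemma homogeneous_system_solution : exists th : R -> R,
  [/\ th 0 = 0, forall x y, 0 <= x -> x < y -> th x < th y,
      forall x, 0 <= x -> {for x, continuous th} &
  exists al sl : R -> R, forall x1, 0 < x1 ->
    exists2 J : set R, (forall t, 0 <= t -> t < th x1 -> J t) &
    [/\ forall t, J t -> 0 < al t /\ 0 < sl t,
        forall t, J t -> is_derive t 1 al (- N + B * (sl t / al t)),
        forall t, J t -> is_derive t 1 sl (- A * (sl t / al t) ^+ 2) &
        forall x, 0 <= x -> al (th x) = flow_al x /\
                            sl (th x) = flow_y x * flow_al x]].
Proof.
have [th [si [th0 dth inc siK dsi]]] := time_change lo_lt0
  (fun x lx => flow_al_gt0 x)
  (fun x lx => is_derive1_continuous (is_derive_flow_al lx)).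
have lol : lo < lo / 2 by have := lo_lt0; lra.
have lo20 : lo / 2 < 0 by have := lo_lt0; lra.
have lpos x : 0 <= x -> lo / 2 < x by exact: lt_le_trans.
exists th; split=> //.
- by move=> x y /lpos; exact: inc.
- by move=> x /lpos /dth /is_derive1_continuous.
exists (fun t => flow_al (si t)), (fun t => flow_y (si t) * flow_al (si t)).
move=> x1 x10; exists (th @` [set x | lo / 2 < x]).
  move=> t t0 tx; have [||x] := @IVT R th 0 x1 t (ltW x10).
  - apply: continuous_in_subspaceT => z; rewrite inE /= in_itv /= => /andP[z0 _].
    exact: (is_derive1_continuous (dth z (lpos z z0))).
  - rewrite th0; apply/andP; split; first by rewrite ge_min t0.
    by rewrite le_max (ltW tx) orbT.
  - by rewrite in_itv /= => /andP[x0 _] <-; exists x => //=; exact: lpos.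
split.
- move=> _ [x /= lx <-]; rewrite siK // flow_al_gt0; split=> //.
  by rewrite mulr_gt0 ?flow_al_gt0 // flow_y_gt0 //; exact: lt_trans lx.
- move=> _ [x /= lx <-]; have llx := lt_trans lol lx.
  have d : is_derive (si (th x)) 1 flow_al (flow_al x * (- N + B * flow_y x)).
    rewrite (siK x lx); exact: (is_derive_flow_al llx).
  apply: (is_derive_eq (is_derive1_comp d (dsi x lx))); rewrite (siK x lx); have := flow_al_gt0 x => ax.
  by move: ax; move: (flow_al x) (flow_y x) => u v u0; field; rewrite gt_eqF.
- move=> _ [x /= lx <-]; have llx := lt_trans lol lx.
  have d := is_deriveM (is_derive_flow_y llx) (is_derive_flow_al llx).
  rewrite -{1}(siK x lx) in d.
  apply: (is_derive_eq (is_derive1_comp d (dsi x lx))); rewrite (siK x lx); have := flow_al_gt0 x => ax.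
  rewrite /K /GRing.scale /=.
  by move: ax; move: (flow_al x) (flow_y x) => u v u0; field; rewrite gt_eqF.
- by move=> x /lpos lx; rewrite siK.
Qed.

End HomogeneousSystem.

(** * Gram decomposition of the inverse metric *)

Section Gram.
Context {R : realType} {n : nat}.
Local Open Scope sesquilinear_scope.

(** Diagonalize by a unitary matrix and take square roots of the inverse
    eigenvalues. The columns of V are directions in which the operator g^{k
    lbar} d_k d_lbar becomes a sum of Laplacians on complex lines. *)
Lemma posdef_gram (h : 'M[R[i]]_n) : hermitian_posdef h ->
  exists V : 'I_n -> 'I_n -> R[i],
    forall k l, (invmx h) l k = \sum_m V k m * (V l m)^*%C.
Proof.
move=> [her pos].
have nh : h \is normalmx.
  apply/normalmxP; have -> : (h ^t*) = h; last by [].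
  by apply/matrixP => i j; rewrite !mxE [RHS]her.
have := orthomx_spectralP nh.
set P := spectralmx h; set D := spectral_diag h => hE.
have perp_proj : P \is unitarymx := spectral_unitarymx h.
have PP : P *m P^t* = 1%:M by apply/unitarymxP.
have uPm : P \in unitmx := spectral_unit h.
rewrite invmx_unitary // in hE.
have D0 m : 0 < D 0 m.
  have : P *m h *m P^t* = diag_mx D.
    by rewrite hE !mulmxA PP mul1mx -mulmxA PP mulmx1.
  move=> /matrixP/(_ m m); rewrite [RHS]mxE eqxx mulr1n => <-.
  have : exists i, P m i != 0.
    apply: contrapT => nP; have := PP => /matrixP/(_ m m).
    rewrite !mxE eqxx mulr1n big1 => [/eqP|i _]; first by rewrite eq_sym oner_eq0.
    rewrite (_ : P m i = 0) ?mul0r //; apply/eqP/negPn/negP => Pi.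
    by apply: nP; exists i.
  move=> /pos; rewrite exchange_big /= => lt0.
  apply: lt_le_trans lt0 _; rewrite le_eqVlt; apply/orP; left; apply/eqP.
  rewrite mxE; apply: eq_bigr => j _; rewrite !mxE mulr_suml; apply: eq_bigr => i _.
  by rewrite (mulrC (P m i)).
pose V k m := P m k * sqrtC (D 0 m)^-1.
exists V => k l.
have iE : invmx h = P^t* *m diag_mx (\row_m (D 0 m)^-1) *m P.
  apply: (can_inj (mulKmx (posdef_unit (conj her pos)))).
  rewrite mulmxV ?(posdef_unit (conj her pos)) // {1}hE !mulmxA -(mulmxA _ P) PP mulmx1.
  rewrite -(mulmxA _ (diag_mx D)).
  have -> : diag_mx D *m diag_mx (\row_m (D 0 m)^-1) = 1%:M.
    apply/matrixP => i j; rewrite mul_diag_mx !mxE.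
    by case: (i == j); rewrite ?mulr1n ?mulr0n ?mulr0 // divff // gt_eqF.
  by rewrite mulmx1; apply/esym; apply: mulmx1C.
rewrite iE mxE; apply: eq_bigr => m _; rewrite mul_mx_diag !mxE /V.
have s0 : 0 <= sqrtC (D 0 m)^-1 by rewrite sqrtC_ge0 invr_ge0 ltW.
have sc : (sqrtC (D 0 m)^-1)^*%C = sqrtC (D 0 m)^-1 by exact: (geC0_conj s0).
have sq : (D 0 m)^-1 = sqrtC (D 0 m)^-1 * sqrtC (D 0 m)^-1 by rewrite -expr2 sqrtCK.
rewrite conjcMx sc [in LHS]sq; move: (sqrtC (D 0 m)^-1) => q.
rewrite -[Num.conj (P m l)]/((P m l)^*%C).
by move: (P m l)^*%C (P m k) => *; ring.
Qed.

End Gram.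


(** * Real-linearity of directional derivatives *)

Section Lines.
Context {R : realType} {V : normedModType R}.
Implicit Types (f : V -> R) (p v w : V) (d : R).

Lemma is_derive_line f p v d :
  is_derive p v f d <-> is_derive (0 : R) (1 : R) (fun h : R => f (h *: v + p)) d.
Proof.
have e : (fun h : R => h^-1 *: ((f \o shift p) (h *: v) - f p)) =
  (fun h : R => h^-1 *: (((fun s : R => f (s *: v + p)) \o shift 0) (h *: 1) -
     (fun s : R => f (s *: v + p)) 0)).
  by apply/funext => h /=; rewrite addr0 scale0r add0r [_%:A]mulr1.
split=> -[a b]; split.
- by rewrite /derivable -e.
- by rewrite /derive -e.
- by rewrite /derivable e.
- by rewrite /derive e.
Qed.

End Lines.

Section DirectionalDerivative.
Context {R : realType} {V : normedModType R}.
Implicit Types (f : V -> R) (p v w : V) (d : R).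

Lemma is_derive_line_at f p v (s : R) d : is_derive (s *: v + p) v f d ->
  is_derive s (1 : R) (fun h : R => f (h *: v + p)) d.
Proof.
move=> /is_derive_line h; apply/(is_derive_line (V := R)).
suff -> : (fun h : R => f ((h *: 1 + s) *: v + p)) =
          (fun h : R => f (h *: v + (s *: v + p))) by [].
by apply/funext => z; rewrite [_ *: 1]mulr1 scalerDl addrA.
Qed.

Lemma is_derive_dirZ f p v (c : R) d :
  is_derive p v f d -> is_derive p (c *: v) f (c * d).
Proof.
move=> /is_derive_line h; apply/is_derive_line.
have dc : is_derive (0 : R) (1 : R) (fun s : R => c * s) c.
  by have := is_derive1_scale c (is_derive_id (0 : R) (1 : R)); rewrite mulr1.
have h0 : is_derive (c * 0) (1 : R) (fun s : R => f (s *: v + p)) d by rewrite mulr0.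
have := is_derive1_comp h0 dc; rewrite mulrC.
suff -> : ((fun s : R => f (s *: v + p)) \o (fun s => c * s)) =
  (fun s : R => f (s *: (c *: v) + p)) by [].
by apply/funext => s /=; rewrite scalerA mulrC.
Qed.

(** The mean value theorem along a segment. *)
Lemma increment_mvt f (fw : V -> R) q w (h : R) :
  (forall s : R, 0 <= s <= 1 -> is_derive (s *: (h *: w) + q) w f (fw (s *: (h *: w) + q))) ->
  exists2 c : R, 0 <= c <= 1 & f (h *: w + q) - f q = h * fw (c *: (h *: w) + q).
Proof.
move=> H; have D (s : R) : 0 <= s <= 1 ->
    is_derive s (1 : R) (fun z : R => f (z *: (h *: w) + q)) (h * fw (s *: (h *: w) + q)).
  by move=> s01; apply: is_derive_line_at; apply: is_derive_dirZ; exact: H.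
have [||c] := @MVT R (fun z : R => f (z *: (h *: w) + q))
   (fun s => h * fw (s *: (h *: w) + q)) 0 1 ltr01.
- by move=> s; rewrite in_itv /= => /andP[/ltW s0 /ltW s1]; apply: D; rewrite s0.
- apply: continuous_in_subspaceT => s; rewrite inE /= in_itv /= => s01.
  exact: (is_derive1_continuous (D s s01)).
- rewrite in_itv /= => /andP[/ltW c0 /ltW c1].
  rewrite scale1r scale0r add0r subr0 mulr1 => e.
  by exists c => //; rewrite c0.
Qed.

(** Directional derivatives need not be additive in the direction; continuity
    of one of them at the point suffices. The increment along v + w is split
    at the end of the step along v, and the second part is estimated by the
    mean value theorem. *)
Lemma is_derive_dirD f (fw : V -> R) p v w d :
  (\forall q \near p, is_derive q w f (fw q)) -> {for p, continuous fw} ->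
  is_derive p v f d -> is_derive p (v + w) f (d + fw p).
Proof.
move=> fwd fwc [dv dvE].
have c1 : (fun h : R => h^-1 *: (f (h *: v + p) - f p)) @ 0^' --> d.
  by rewrite -dvE; exact: dv.
have c2 : (fun h : R => h^-1 *: (f (h *: w + (h *: v + p)) - f (h *: v + p))) @ 0^'
    --> fw p.
  apply/cvgrPdist_lt => e e0.
  have [del /= del0 hd] : exists2 del : R, 0 < del & forall q, `|q - p| < del ->
      is_derive q w f (fw q) /\ `|fw p - fw q| < e.
    have n1 : \forall q \near p, is_derive q w f (fw q) /\ `|fw p - fw q| < e.
      near=> q; split; first by near: q.
      by near: q; move/cvgrPdist_lt : fwc; apply.
    move: n1 => /nbhs_normP[del /= del0 H]; exists del => // q qp.
    by apply: H; rewrite /= distrC.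
  have M0 : 0 < `|v| + `|w| + 1 by rewrite ltr_wpDl // addr_ge0.
  near=> h.
  have h0 : h != 0 by near: h; exact: nbhs_dnbhs_neq.
  have hs : `|h| < del / (`|v| + `|w| + 1).
    near: h; apply: dnbhs0_lt; exact: divr_gt0.
  have inball (s : R) : 0 <= s <= 1 -> `|s *: (h *: w) + (h *: v + p) - p| < del.
    move=> /andP[s0 s1]; rewrite addrA addrK.
    apply: (@le_lt_trans _ _ (`|h| * (`|v| + `|w| + 1))).
      apply: (le_trans (ler_normD _ _)); rewrite !normrZ.
      have : `|s| * (`|h| * `|w|) <= 1 * (`|h| * `|w|).
        by apply: ler_wpM2r; [exact: mulr_ge0|rewrite ger0_norm].
      by rewrite mul1r => H; rewrite !mulrDr mulr1; have := normr_ge0 h; lra.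
    by rewrite -ltr_pdivlMr.
  have [s s01|c c01 ->] := @increment_mvt f fw (h *: v + p) w h.
    by have [] := hd _ (inball s s01).
  by rewrite [_ *: _]mulrA mulVf // mul1r; have [] := hd _ (inball c c01).
have c12 := cvgD c2 c1.
have c3 : (fun h : R => h^-1 *: ((f \o shift p) (h *: (v + w)) - f p)) @ 0^' --> d + fw p.
  have -> : (fun h : R => h^-1 *: ((f \o shift p) (h *: (v + w)) - f p)) =
     (fun h : R => h^-1 *: (f (h *: w + (h *: v + p)) - f (h *: v + p))
                   + h^-1 *: (f (h *: v + p) - f p)).
    apply/funext => h; rewrite -scalerDr addrA subrK /=.
    by rewrite addrA -scalerDr [w + v]addrC.
  by rewrite addrC; exact: c12.
by apply: DeriveDef; [apply/cvg_ex; exists (d + fw p)|exact: cvg_lim].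
Unshelve. all: by end_near. Qed.

End DirectionalDerivative.

Section ComplexLines.
Context {R : realType} {n : nat}.
Implicit Types (f g : Cn R n -> R[i]) (p v w : Cn R n).

(** The differential of f is the sum of its (1,0) and (0,1) parts;
    equivalently, the directional derivative is real-linear in the direction. *)
Definition wirtinger_linear f p := forall w, is_cderive f p w
  (\sum_k (zc w k * pd (inl k) f p + (zc w k)^*%C * pd (inr k) f p)).

Lemma Cn_decomp w : w = \sum_(k < n)
   ((Rep (zc w k)) *: xdir (inl k) + (Imp (zc w k)) *: ydir (inl k)).
Proof.
rewrite [LHS]surjective_pairing; apply/esym.
have f1 : (\sum_(k < n) ((Rep (zc w k)) *: @xdir R n (inl k)
    + (Imp (zc w k)) *: @ydir R n (inl k))).1 = w.1.
  rewrite (big_morph fst (fun x y => erefl) erefl) [RHS]row_sum_delta.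
  by apply: eq_bigr => k _; rewrite /= scaler0 addr0.
have f2 : (\sum_(k < n) ((Rep (zc w k)) *: @xdir R n (inl k)
    + (Imp (zc w k)) *: @ydir R n (inl k))).2 = w.2.
  rewrite (big_morph snd (fun x y => erefl) erefl) [RHS]row_sum_delta.
  by apply: eq_bigr => k _; rewrite /= scaler0 add0r.
by rewrite [LHS]surjective_pairing f1 f2.
Qed.

Lemma Ck_derive_sum (D : set (Cn R n)) (f : Cn R n -> R) p w : open D -> D p ->
  Ck 1 D f -> is_derive p w f (\sum_(k < n)
     (Rep (zc w k) * 'D_(xdir (inl k)) f p + Imp (zc w k) * 'D_(ydir (inl k)) f p)).
Proof.
move=> oD Dp [_ h].
have dq v : exists2 f', (forall q, D q -> is_derive q v f (f' q)) & {for p, continuous f'}.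
  have [f' hf' [cf' _]] := h v; exists f'.
    by move=> q Dq; apply: hf'; rewrite (interior_id _).1.
  by rewrite continuous_open_subspace // in cf'; apply: cf'; rewrite inE.
have add v1 v2 d1 d2 : is_derive p v1 f d1 -> is_derive p v2 f d2 ->
    is_derive p (v1 + v2) f (d1 + d2).
  move=> h1 h2; have [f' hf' cf'] := dq v2.
  have -> : d2 = f' p.
    by rewrite -(@derive_val _ _ _ _ _ _ _ h2) (@derive_val _ _ _ _ _ _ _ (hf' p Dp)).
  apply: is_derive_dirD => //.
  by apply: filterS (open_nbhs_nbhs (conj oD Dp)) => q; exact: hf'.
have dv v : is_derive p v f ('D_v f p).
  by have [f' hf' _] := dq v; rewrite (@derive_val _ _ _ _ _ _ _ (hf' p Dp)); exact: hf'.
rewrite {1}(Cn_decomp w).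
have: forall s : seq 'I_n, is_derive p (\sum_(k <- s)
   ((Rep (zc w k)) *: xdir (inl k) + (Imp (zc w k)) *: ydir (inl k))) f
   (\sum_(k <- s) (Rep (zc w k) * 'D_(xdir (inl k)) f p + Imp (zc w k) * 'D_(ydir (inl k)) f p)).
  elim=> [|k s ih]; first by rewrite !big_nil; exact: is_derive0.
  rewrite !big_cons; apply: (add) => //.
  by apply: add; apply: is_derive_dirZ.
exact.
Qed.

Lemma C1_wirtinger_linear (D : set (Cn R n)) f p : open D -> D p ->
  cCk 1 D f -> wirtinger_linear f p.
Proof.
move=> oD Dp [c1 c2] w.
have h1 := Ck_derive_sum w oD Dp c1; have h2 := Ck_derive_sum w oD Dp c2.
have e : \sum_(k < n) (zc w k * pd (inl k) f p + (zc w k)^*%C * pd (inr k) f p) =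
  \sum_(k < n) ((Rep (zc w k))%:C * cderive f p (xdir (inl k))
     + (Imp (zc w k))%:C * cderive f p (ydir (inl k))).
  apply: eq_bigr => k _; rewrite !pdE [xdir (inr k)]/(xdir (inl k)) [ydir (inr k)]/(ydir (inl k)).
  have -> : @Jev R n (inr k) = - 'i%C by [].
  have -> : @Jev R n (inl k) = 'i%C by [].
  move: (cderive f p (xdir (inl k))) (cderive f p (ydir (inl k))) => X Y.
  have := complexE (zc w k); move: (Rep (zc w k)) (Imp (zc w k)) => a b ->.
  rewrite !conjcE [('i%C)^*%C](_ : _ = - 'i%C); last by simpc.
  move: (a%:C) (b%:C) => a' b'.
  have : 'i%C * 'i%C = -1 :> R[i] by exact: mulii.
  move: ('i%C : R[i]) => j jj.
  transitivity (a' * X - (j * j) * b' * Y); first by field.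
  by rewrite jj; ring.
rewrite e; split.
  apply: (is_derive_eq h1); rewrite raddf_sum; apply: eq_bigr => k _.
  rewrite /cderive.
  move: ('D_(xdir (inl k)) (fun q => Rep (f q)) p) ('D_(ydir (inl k)) (fun q => Rep (f q)) p)
    ('D_(xdir (inl k)) (fun q => Imp (f q)) p) ('D_(ydir (inl k)) (fun q => Imp (f q)) p).
  by move=> x1 y1 x2 y2; rewrite raddfD /= !mul0r !subr0.
apply: (is_derive_eq h2); rewrite raddf_sum; apply: eq_bigr => k _.
  rewrite /cderive.
  move: ('D_(xdir (inl k)) (fun q => Rep (f q)) p) ('D_(ydir (inl k)) (fun q => Rep (f q)) p)
    ('D_(xdir (inl k)) (fun q => Imp (f q)) p) ('D_(ydir (inl k)) (fun q => Imp (f q)) p).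
  by move=> x1 y1 x2 y2; rewrite raddfD /= !mul0r !addr0.
Qed.

End ComplexLines.

(** * The second derivative test for the Laplacian of a metric *)

Section SecondDerivativeTest.
Context {R : realType}.

(** If the second derivative were positive, the first would be positive just
    to the right of the critical point, and f would increase there. *)
Lemma second_derivative_test_line (f f1 : R -> R) (d : R) :
  (\forall s \near (0 : R), is_derive s (1 : R) f (f1 s)) -> is_derive (0 : R) (1 : R) f1 d ->
  (\forall s \near (0 : R), f s <= f 0) -> d <= 0.
Proof.
move=> hf [df1 dE] hmax; rewrite leNgt; apply/negP => d0.
have [del /= del0 H] : exists2 del : R, 0 < del & forall s, `|s| < del ->
    is_derive s (1 : R) f (f1 s) /\ f s <= f 0.
  have n1 : \forall s \near (0 : R), is_derive s (1 : R) f (f1 s) /\ f s <= f 0.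
    by near=> s; split; near: s.
  move: n1 => /nbhs_normP[del /= del0 H]; exists del => // s sd.
  by apply: H; rewrite /= sub0r normrN.
have f10 : f1 0 = 0.
  have := @derive1_at_max R f (- del) del 0.
  case=> [||||d1 d2].
  - by rewrite ge0_cp // ltW.
  - move=> t; rewrite in_itv /= -ltr_norml => td; by have [[]] := H t td.
  - by rewrite in_itv /= oppr_lt0 del0.
  - by move=> t; rewrite in_itv /= -ltr_norml => td; have [] := H t td.
  - have n0 : `|0 : R| < del by rewrite normr0.
    by have [h0 _] := H 0 n0; rewrite -(@derive_val _ _ _ _ _ _ _ h0) d2.
have c : (fun h : R => h^-1 *: (f1 h - 0)) @ 0^' --> d.
  have : (fun h : R => h^-1 *: ((f1 \o shift 0) (h *: 1) - f1 0)) @ 0^' --> d.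
    by rewrite -dE; exact: df1.
  rewrite f10.
  suff -> : (fun h : R => h^-1 *: ((f1 \o shift 0) (h *: 1) - 0)) =
            (fun h : R => h^-1 *: (f1 h - 0)) by [].
  by apply/funext => h /=; rewrite addr0 [_ *: 1]mulr1.
have pos : \forall h \near (0 : R)^', 0 < h^-1 *: (f1 h - 0).
  by apply: (cvgr_gt _ c).
move: pos; rewrite near_withinE => /nbhs_normP[e /= e0 He].
(* half the smaller radius keeps the whole segment from 0 to s inside both
   neighbourhoods *)
pose s := Num.min del e / 2.
have m0 : 0 < Num.min del e by rewrite lt_min del0 e0.
have s0 : 0 < s by rewrite divr_gt0.
have sm : s < Num.min del e by rewrite /s; lra.
have sd : s < del by apply: lt_le_trans sm _; rewrite ge_min lexx.
have se : s < e by apply: lt_le_trans sm _; rewrite ge_min lexx orbT.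
have [x|x|x + xe] := @MVT R f f1 0 s s0.
- rewrite in_itv /= => /andP[x0 xs]; have [] := H x _ => //.
  by rewrite gtr0_norm // (lt_trans xs).
- apply: continuous_in_subspaceT => {}x; rewrite inE /= in_itv /= => /andP[x0 xs].
  have xd : `|x| < del by rewrite ger0_norm // (le_lt_trans xs).
  by have [h _] := H x xd; exact: (is_derive1_continuous h).
rewrite in_itv /= => /andP[x0 xs].
have := He x; rewrite /= sub0r normrN gtr0_norm // => /(_ (lt_trans xs se)).
rewrite gt_eqF // => /(_ isT); rewrite subr0 pmulr_rgt0 ?invr_gt0 // => f1x.
have sdel : `|s| < del by rewrite gtr0_norm.
by have [_] := H s sdel; rewrite leNgt -subr_gt0 xe subr0 mulr_gt0.
Unshelve. all: by end_near. Qed.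

Lemma near_line (V : normedModType R) (P : V -> Prop) (p v : V) :
  (\forall q \near p, P q) -> \forall s \near (0 : R), P (s *: v + p).
Proof.
move=> h; have c : {for (0 : R), continuous (fun s : R => s *: v + p)}.
  apply: continuousD; last exact: cst_continuous.
  by move=> ?; exact: scalel_continuous.
by have := c; rewrite /prop_for /continuous_at scale0r add0r; apply.
Qed.

Lemma second_derivative_test (V : normedModType R) (f f1 : V -> R) (p v : V) (d : R) :
  (\forall q \near p, is_derive q v f (f1 q)) -> is_derive p v f1 d ->
  (\forall q \near p, f q <= f p) -> d <= 0.
Proof.
move=> h1 h2 h3.
apply: (@second_derivative_test_line (fun s => f (s *: v + p)) (fun s => f1 (s *: v + p))).
- have := near_line v h1; apply: filterS => s; exact: is_derive_line_at.
- exact: ((is_derive_line f1 p v d).1 h2).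
- by rewrite scale0r add0r; exact: (near_line v h3).
Qed.

End SecondDerivativeTest.

Section MaximumPoint.
Context {R : realType} {n : nat}.
Implicit Types (f : Cn R n -> R[i]) (p v w : Cn R n).

(** The square of the modulus as a real number. *)
Definition nsq (z : R[i]) : R := Rep z * Rep z + Imp z * Imp z.

Lemma nsq_ge0 z : 0 <= nsq z.
Proof. by rewrite addr_ge0 // -expr2 sqr_ge0. Qed.

Lemma nsqE z : (nsq z)%:C = z * z^*%C.
Proof. by case: z => x y; rewrite /nsq /=; simpc; congr (_ +i* _); ring. Qed.

Lemma nsq_conj z : nsq z^*%C = nsq z.
Proof. by case: z => x y; rewrite /nsq /=; ring. Qed.

Lemma Re_sum (I : finType) (F : I -> R[i]) : Rep (\sum_i F i) = \sum_i Rep (F i).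
Proof. exact: raddf_sum. Qed.

(** The second derivative test for a sum of squares, along one direction. *)
Lemma sum_nsq_max_test (I : finType) (F D : I -> Cn R n -> R[i]) (D2 : I -> R[i]) p v :
  (forall i, \forall q \near p, is_cderive (F i) q v (D i q)) ->
  (forall i, is_cderive (D i) p v (D2 i)) ->
  (\forall q \near p, \sum_i nsq (F i q) <= \sum_i nsq (F i p)) ->
  \sum_i (nsq (D i p) + Rep ((F i p)^*%C * D2 i)) <= 0.
Proof.
move=> h1 h2 h3.
have sum_derive (G : I -> Cn R n -> R) (dG : I -> R) q :
   (forall i, is_derive q v (G i) (dG i)) ->
   is_derive q v (fun z => \sum_i G i z) (\sum_i dG i).
  move=> h; have: forall s : seq I,
     is_derive q v (fun z => \sum_(i <- s) G i z) (\sum_(i <- s) dG i); last exact.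
  elim=> [|i s ih].
    by rewrite big_nil; under eq_fun do rewrite big_nil; exact: is_derive_cst.
  by rewrite big_cons; under eq_fun do rewrite big_cons; exact: is_deriveD.
pose f1 q := \sum_i (2 * (Rep (F i q) * Rep (D i q) + Imp (F i q) * Imp (D i q))).
pose d := \sum_i (2 * (nsq (D i p) + Rep ((F i p)^*%C * D2 i))).
have h1' : \forall q \near p, forall i, is_cderive (F i) q v (D i q).
  by apply: (@filter_forall _ I (fun i q => is_cderive (F i) q v (D i q)) (nbhs p)); exact: h1.
have : d <= 0.
  apply: (second_derivative_test (f := fun q => \sum_i nsq (F i q)) (f1 := f1) _ _ h3).
    apply: filterS h1' => q hq; apply: sum_derive => i; have [a b] := hq i.
    by apply: is_derive_eq; rewrite /GRing.scale /=; ring.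
  have h0 := nbhs_singleton h1'.
  apply: sum_derive => i; have [a b] := h0 i; have [a2 b2] := h2 i.
  have e : is_derive p v (fun q => Rep (F i q) * Rep (D i q) + Imp (F i q) * Imp (D i q))
    (nsq (D i p) + Rep ((F i p)^*%C * D2 i)).
    apply: is_derive_eq; rewrite /GRing.scale /= /nsq Re_mul.
    by case: (F i p) => x y /=; ring.
  exact: (is_deriveZ 2 e).
by rewrite /d -mulr_sumr pmulr_rle0.
Qed.

(** Multiplication of a direction by i. *)
Definition idir w : Cn R n := (- w.2, w.1).

Lemma zc_idir w k : zc (idir w) k = 'i%C * zc w k.
Proof. by rewrite /zc !mxE; simpc. Qed.

(** Two derivatives, each real-linear in its direction: the regularity under
    which the second derivative test can be written in the frame. It is
    stable under sums and products. *)
Definition bidiff f p := [/\ \forall q \near p, wirtinger_linear f q &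
  forall A, wirtinger_linear (pd A f) p].

(** The second derivative along w in terms of the frame. No symmetry of mixed
    derivatives is assumed, so d dbar and dbar d both occur. *)
Lemma bidiff_derive2 f p w : bidiff f p ->
  (\forall q \near p, is_cderive f q w (cderive f q w)) /\
  is_cderive (fun q => cderive f q w) p w
    (\sum_k \sum_l (zc w k * (zc w l * pd (inl l) (pd (inl k) f) p
                              + (zc w l)^*%C * pd (inr l) (pd (inl k) f) p)
                 + (zc w k)^*%C * (zc w l * pd (inl l) (pd (inr k) f) p
                              + (zc w l)^*%C * pd (inr l) (pd (inr k) f) p))).
Proof.
move=> [h1 h2]; split; first by apply: filterS h1 => q hq; rewrite (cderiveE (hq w)).
have e : \forall q \near p,
   \sum_k (zc w k * pd (inl k) f q + (zc w k)^*%C * pd (inr k) f q) = cderive f q w.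
  by apply: filterS h1 => q hq; rewrite (cderiveE (hq w)).
apply: (is_cderive_near e); apply: is_cderive_sum => k.
rewrite (eq_bigr (fun l => zc w k * (zc w l * pd (inl l) (pd (inl k) f) p
     + (zc w l)^*%C * pd (inr l) (pd (inl k) f) p)
   + (zc w k)^*%C * (zc w l * pd (inl l) (pd (inr k) f) p
     + (zc w l)^*%C * pd (inr l) (pd (inr k) f) p))) //.
rewrite big_split -!mulr_sumr /=; apply: is_cderiveD.
  have := is_cderiveM (is_cderive_cst (zc w k) p w) (h2 (inl k) w).
  by rewrite mul0r add0r.
have := is_cderiveM (is_cderive_cst (zc w k)^*%C p w) (h2 (inr k) w).
by rewrite mul0r add0r.
Qed.

(** The parallelogram identity, which removes the pure second derivatives
    when the tests along w and i w are added. *)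
Lemma nsq_iD (x y : R[i]) :
  nsq (x + y) + nsq ('i%C * x - 'i%C * y) = 2 * (nsq x + nsq y).
Proof. by case: x => a b; case: y => c d; rewrite /nsq; simpc => /=; ring. Qed.

Lemma sum_swap (A : nmodType) (G : 'I_n * 'I_n -> A) :
  \sum_x G (x.2, x.1) = \sum_x G x.
Proof.
have i : injective (fun x : 'I_n * 'I_n => (x.2, x.1)) by move=> [a b] [c d] [-> ->].
by rewrite [RHS](reindex_inj i).
Qed.

Lemma sum2D (X Y : 'I_n -> 'I_n -> R[i]) :
  \sum_k \sum_l X k l + \sum_k \sum_l Y k l = \sum_k \sum_l (X k l + Y k l).
Proof. by rewrite -big_split; apply: eq_bigr => k _; rewrite -big_split. Qed.

(** Adding the tests along w and i w leaves d dbar and dbar d terms. For a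
    field of Hermitian matrices they are conjugate after exchanging the two
    indices, so the sum over the indices needs only one of them, and
    Schwarz's theorem is avoided. *)
Lemma maximum_point (F : 'I_n * 'I_n -> Cn R n -> R[i]) p w :
  (forall x, bidiff (F x) p) ->
  (\forall q \near p, forall x, F (x.2, x.1) q = (F x q)^*%C) ->
  (\forall q \near p, \sum_x nsq (F x q) <= \sum_x nsq (F x p)) ->
  \sum_x Rep ((F x p)^*%C * \sum_k \sum_l zc w k * (zc w l)^*%C
      * pd (inr l) (pd (inl k) (F x)) p)
  <= - \sum_x nsq (\sum_k zc w k * pd (inl k) (F x) p).
Proof.
move=> bd her hmax.
pose a x k := pd (inl k) (F x) p.
pose b x k := pd (inr k) (F x) p.
have cd x : \forall q \near p, cdiff (F x) q.
  have [h _] := bd x; apply: filterS h => q hq v; eexists; exact: hq.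
have bE x k : b x k = (a (x.2, x.1) k)^*%C.
  rewrite /a /b (_ : inl k = barI (inr k)) // -pd_conj; last exact: (nbhs_singleton (cd _)).
  by apply: pd_near; apply: filterS her => q /(_ (x.2, x.1)) <-; case: (x).
have b2E x k l : pd (inl l) (pd (inr k) (F x)) p =
    (pd (inr l) (pd (inl k) (F (x.2, x.1))) p)^*%C.
  rewrite (_ : inr l = barI (inl l)) // -pd_conj; last first.
    by move=> v; have [_ h] := bd (x.2, x.1); eexists; exact: h.
  apply: pd_near.
  apply: filterS2 (nbhs_interior her) (cd (x.2, x.1)) => q hq cq.
  rewrite (_ : inl k = barI (inr k)) // -pd_conj //.
  by apply: pd_near; apply: filterS hq => z /(_ (x.2, x.1)) <-; case: (x).
pose A x := \sum_k zc w k * a x k.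
pose B x := \sum_k (zc w k)^*%C * b x k.
have BE x : B x = (A (x.2, x.1))^*%C.
  by rewrite conjc_sum; apply: eq_bigr => k _; rewrite [RHS]conjcMx -bE.
pose Q x := \sum_k \sum_l zc w k * (zc w l)^*%C * pd (inr l) (pd (inl k) (F x)) p.
pose Q' x := \sum_k \sum_l (zc w k)^*%C * zc w l * pd (inl l) (pd (inr k) (F x)) p.
have QE x : Q' x = (Q (x.2, x.1))^*%C.
  rewrite /Q conjc_sum; apply: eq_bigr => k _; rewrite conjc_sum; apply: eq_bigr => l _.
  by rewrite b2E [RHS]conjcMx [in RHS]conjcMx conjcK.
pose D1 x v := cderive (F x) p v.
pose D2 x v := \sum_k \sum_l (zc v k * (zc v l * pd (inl l) (pd (inl k) (F x)) p
                              + (zc v l)^*%C * pd (inr l) (pd (inl k) (F x)) p)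
                 + (zc v k)^*%C * (zc v l * pd (inl l) (pd (inr k) (F x)) p
                              + (zc v l)^*%C * pd (inr l) (pd (inr k) (F x)) p)).
have test v : \sum_x (nsq (D1 x v) + Rep ((F x p)^*%C * D2 x v)) <= 0.
  exact: (sum_nsq_max_test (fun x => (bidiff_derive2 v (bd x)).1)
    (fun x => (bidiff_derive2 v (bd x)).2) hmax).
have d1 x v : D1 x v = \sum_k (zc v k * a x k + (zc v k)^*%C * b x k).
  by have [h _] := bd x; exact: (cderiveE (nbhs_singleton h v)).
have ic : ('i%C : R[i])^*%C = - 'i%C by simpc.
have := lerD (test w) (test (idir w)); rewrite addr0 -big_split /=.
rewrite (eq_bigr (fun x => 2 * (nsq (A x) + nsq (B x))
   + 2 * (Rep ((F x p)^*%C * Q x) + Rep ((F x p)^*%C * Q' x)))); last first.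
  move=> x _; rewrite addrACA !d1; congr (_ + _).
    rewrite -nsq_iD; congr (nsq _ + nsq _); first by rewrite big_split.
    rewrite /A /B !mulr_sumr -sumrB; apply: eq_bigr => k _.
    have iw : ('i%C * zc w k)^*%C = - 'i%C * (zc w k)^*%C by rewrite conjcMx ic.
    rewrite zc_idir iw; move: ('i%C : R[i]) (zc w k) (zc w k)^*%C (a x k) (b x k) => *.
    by ring.
  have e : forall X Y : R[i], Rep X + Rep Y = Rep (X + Y) by move=> X Y; rewrite raddfD.
  have e2 : forall X : R[i], 2 * Rep X = Rep (2 * X).
    by move=> X; rewrite [LHS]mulr_natl [2 * X]mulr_natl !mulr2n raddfD.
  rewrite !e e2 -!mulrDr; congr (Rep _); rewrite mulrCA; congr (_ * _).
  rewrite /D2 /Q /Q' !sum2D mulr_sumr; apply: eq_bigr => k _.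
  rewrite mulr_sumr; apply: eq_bigr => l _.
  have iw m : ('i%C * zc w m)^*%C = - 'i%C * (zc w m)^*%C by rewrite conjcMx ic.
  rewrite !zc_idir !iw.
  have : 'i%C * 'i%C = -1 :> R[i] by exact: mulii.
  move: ('i%C : R[i]) (zc w k) (zc w l) (zc w k)^*%C (zc w l)^*%C => j y z y' z' jj.
  move: (pd (inl l) (pd (inl k) (F x)) p) (pd (inr l) (pd (inl k) (F x)) p).
  move: (pd (inl l) (pd (inr k) (F x)) p) (pd (inr l) (pd (inr k) (F x)) p) => t1 t2 t3 t4.
  transitivity ((1 + j * j) * (y * z * t3 + y' * z' * t2)
     + (1 - j * j) * (y * z' * t4 + y' * z * t1)); first by ring.
  by rewrite jj; ring.
have -> : \sum_x (2 * (nsq (A x) + nsq (B x))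
     + 2 * (Rep ((F x p)^*%C * Q x) + Rep ((F x p)^*%C * Q' x))) =
   2 * (\sum_x nsq (A x) + \sum_x nsq (B x))
   + 2 * (\sum_x Rep ((F x p)^*%C * Q x) + \sum_x Rep ((F x p)^*%C * Q' x)).
  by rewrite big_split -!mulr_sumr !big_split.
have -> : \sum_x nsq (B x) = \sum_x nsq (A x).
  by rewrite -(sum_swap (fun x => nsq (A x))); apply: eq_bigr => x _; rewrite BE nsq_conj.
have -> : \sum_x Rep ((F x p)^*%C * Q' x) = \sum_x Rep ((F x p)^*%C * Q x).
  rewrite -(sum_swap (fun x => Rep ((F x p)^*%C * Q x))); apply: eq_bigr => x _.
  rewrite QE (nbhs_singleton her x) conjcK -conjcMx.
  by case: (F x p * _).
rewrite -/(Q _); lra.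
Qed.

End MaximumPoint.

(** * Bounds on compact sets and twice differentiable functions *)

Section CkBasics.
Context {R : realType} {V : normedModType R}.
Implicit Types (D C : set V) (f g : V -> R[i]).

Lemma Ck_continuous k D (f : V -> R) : Ck k D f -> {within D, continuous f}.
Proof. by case: k => [|k] []. Qed.

Lemma CkW k D (f : V -> R) : Ck k.+1 D f -> Ck k D f.
Proof.
elim: k f => [|k ih] f [cf h]; first by split.
by split=> // v; have [f' hf' c] := h v; exists f' => //; exact: ih.
Qed.

Lemma cCkW k D f : cCk k.+1 D f -> cCk k D f.
Proof. by move=> [a b]; split; exact: CkW. Qed.

Lemma withinD C (u v : V -> R) : {within C, continuous u} -> {within C, continuous v} ->
  {within C, continuous (fun q => u q + v q)}.
Proof. by move=> a b x; apply: continuousD; [exact: a|exact: b]. Qed.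

Lemma withinM C (u v : V -> R) : {within C, continuous u} -> {within C, continuous v} ->
  {within C, continuous (fun q => u q * v q)}.
Proof. by move=> a b x; apply: continuousM; [exact: a|exact: b]. Qed.

Lemma withinN C (u : V -> R) : {within C, continuous u} ->
  {within C, continuous (fun q => - u q)}.
Proof. by move=> a x; apply: continuousN; exact: a. Qed.

(** Continuity up to the boundary of the set, as provided by the definition
    of smoothness. *)
Definition ccont C f := {within C, continuous (fun q => Rep (f q))} /\
  {within C, continuous (fun q => Imp (f q))}.

Lemma cCk_ccont k D C f : C `<=` D -> cCk k D f -> ccont C f.
Proof.
by move=> CD [/Ck_continuous a /Ck_continuous b]; split; apply: continuous_subspaceW CD _.
Qed.

Lemma ccont_cst C c : ccont C (fun=> c).
Proof. by split=> ?; exact: cst_continuous. Qed.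

Lemma ccontD C f g : ccont C f -> ccont C g -> ccont C (fun q => f q + g q).
Proof.
move=> [a b] [c d]; split.
  under eq_fun do rewrite raddfD /=.
  by move=> x; apply: continuousD; [exact: a|exact: c].
under eq_fun do rewrite raddfD /=.
by move=> x; apply: continuousD; [exact: b|exact: d].
Qed.

Lemma ccontM C f g : ccont C f -> ccont C g -> ccont C (fun q => f q * g q).
Proof.
move=> [a b] [c d]; split.
  under eq_fun do rewrite Re_mul.
  by apply: withinD; [exact: withinM|apply: withinN; exact: withinM].
by under eq_fun do rewrite Im_mul; apply: withinD; exact: withinM.
Qed.

Lemma ccont_sum (I : finType) C (F : I -> V -> R[i]) :
  (forall i, ccont C (F i)) -> ccont C (fun q => \sum_i F i q).
Proof.
move=> h; have: forall s : seq I, ccont C (fun q => \sum_(i <- s) F i q); last exact.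
elim=> [|i s ih].
  by under eq_fun do rewrite big_nil; exact: ccont_cst.
by under eq_fun do rewrite big_cons; exact: ccontD.
Qed.

Lemma ccont_prod (I : finType) C (F : I -> V -> R[i]) :
  (forall i, ccont C (F i)) -> ccont C (fun q => \prod_i F i q).
Proof.
move=> h; have: forall s : seq I, ccont C (fun q => \prod_(i <- s) F i q); last exact.
elim=> [|i s ih].
  by under eq_fun do rewrite big_nil; exact: ccont_cst.
by under eq_fun do rewrite big_cons; exact: ccontM.
Qed.

Lemma ccont_det C n (M : V -> 'M[R[i]]_n) : (forall i j, ccont C (fun q => M q i j)) ->
  ccont C (fun q => \det (M q)).
Proof.
move=> h; rewrite /determinant; apply: ccont_sum => s.
by apply: ccontM; [exact: ccont_cst|exact: ccont_prod].
Qed.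

Lemma ccont_nsq C f : ccont C f -> {within C, continuous (fun q => nsq (f q))}.
Proof. by move=> [a b]; apply: withinD; exact: withinM. Qed.

Lemma compact_bounded_above C (f : V -> R) : compact C -> {within C, continuous f} ->
  exists2 M, 0 <= M & forall q, C q -> f q <= M.
Proof.
move=> cC cf; have [C0|nC] := pselect (C !=set0).
  have [c _ h] := compact_EVT_max C0 cC cf; exists (Num.max 0 (f c)).
    by rewrite le_max lexx.
  by move=> q Cq; rewrite le_max h ?orbT // inE.
by exists 0 => // q Cq; case: nC; exists q.
Qed.

Lemma compact_bounded_below C (f : V -> R) : compact C -> {within C, continuous f} ->
  (forall q, C q -> 0 < f q) -> exists2 m, 0 < m & forall q, C q -> m <= f q.
Proof.
move=> cC cf pf; have [C0|nC] := pselect (C !=set0).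
  have [c cC' h] := compact_EVT_min C0 cC cf; exists (f c).
    by apply: pf; rewrite inE in cC'.
  by move=> q Cq; apply: h; rewrite inE.
by exists 1 => // q Cq; case: nC; exists q.
Qed.

End CkBasics.

Section Modulus.
Context {R : realType}.
Implicit Types x y : R[i].
Local Notation N := (@ComplexField.Normc.normc R).

Lemma cmodD x y : N (x + y) <= N x + N y. Proof. exact: le_normcD. Qed.
Lemma cmodM x y : N (x * y) = N x * N y. Proof. exact: ComplexField.Normc.normcM. Qed.
Lemma cmodN x : N (- x) = N x. Proof. exact: normcN. Qed.
Lemma cmod0 : N 0 = 0. Proof. exact: ComplexField.Normc.normc0. Qed.

Lemma cmod_ge0 x : 0 <= N x. Proof. by case: x => a b; exact: sqrtr_ge0. Qed.

Lemma cmod_nsq x : N x ^+ 2 = nsq x.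
Proof. by case: x => a b; rewrite /nsq /= sqr_sqrtr ?addr_ge0 ?sqr_ge0 // !expr2. Qed.

Lemma cmod_conj x : N x^*%C = N x.
Proof. by case: x => a b; rewrite /= sqrrN. Qed.

Lemma cmodV x : N x^-1 = (N x)^-1. Proof. exact: ComplexField.Normc.normcV. Qed.

Lemma cmod_Re x : Rep x <= N x.
Proof.
have [h|h] := leP (Rep x) 0; first exact: le_trans h (cmod_ge0 _).
have : Rep x ^+ 2 <= N x ^+ 2 by rewrite cmod_nsq /nsq -!expr2 lerDl sqr_ge0.
by rewrite ler_pXn2r // nnegrE ?cmod_ge0 // ltW.
Qed.

Lemma cmod_sum (I : finType) (F : I -> R[i]) : N (\sum_i F i) <= \sum_i N (F i).
Proof.
have: forall s : seq I, N (\sum_(i <- s) F i) <= \sum_(i <- s) N (F i); last exact.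
elim=> [|i s ih]; first by rewrite !big_nil cmod0.
by rewrite !big_cons; apply: le_trans (cmodD _ _) _; rewrite lerD2l.
Qed.

End Modulus.
Notation cmod := ComplexField.Normc.normc.

Section Bidiff.
Context {R : realType} {n : nat}.
Implicit Types (f g : Cn R n -> R[i]) (p : Cn R n).

Lemma wirtinger_linear_cdiff f p : wirtinger_linear f p -> cdiff f p.
Proof. by move=> h v; eexists; exact: h. Qed.

Lemma wirtinger_linear_near f g p : (\forall q \near p, f q = g q) ->
  wirtinger_linear f p -> wirtinger_linear g p.
Proof.
move=> fg h w; have := is_cderive_near fg (h w).
by under eq_bigr do rewrite !(pd_near _ fg).
Qed.

Lemma wirtinger_linear_cst (c : R[i]) p : wirtinger_linear (fun=> c) p.
Proof.
move=> w; rewrite big1; first exact: is_cderive_cst.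
by move=> k _; rewrite !pd_cst !mulr0 addr0.
Qed.

Lemma sum1D (X Y : 'I_n -> R[i]) : \sum_k X k + \sum_k Y k = \sum_k (X k + Y k).
Proof. by rewrite big_split. Qed.

Lemma wirtinger_linearD f g p : wirtinger_linear f p -> wirtinger_linear g p ->
  wirtinger_linear (fun q => f q + g q) p.
Proof.
move=> hf hg w; have cf := wirtinger_linear_cdiff hf; have cg := wirtinger_linear_cdiff hg.
have e : \sum_k (zc w k * pd (inl k) f p + (zc w k)^*%C * pd (inr k) f p)
    + \sum_k (zc w k * pd (inl k) g p + (zc w k)^*%C * pd (inr k) g p) =
  \sum_k (zc w k * pd (inl k) (fun q => f q + g q) p
          + (zc w k)^*%C * pd (inr k) (fun q => f q + g q) p).
  rewrite sum1D; apply: eq_bigr => k _.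
  by rewrite (pdD (inl k) cf cg) (pdD (inr k) cf cg) !mulrDr addrACA.
by rewrite -e; exact: is_cderiveD (hf w) (hg w).
Qed.

Lemma wirtinger_linearM f g p : wirtinger_linear f p -> wirtinger_linear g p ->
  wirtinger_linear (fun q => f q * g q) p.
Proof.
move=> hf hg w; have cf := wirtinger_linear_cdiff hf; have cg := wirtinger_linear_cdiff hg.
have e : (\sum_k (zc w k * pd (inl k) f p + (zc w k)^*%C * pd (inr k) f p)) * g p
    + f p * \sum_k (zc w k * pd (inl k) g p + (zc w k)^*%C * pd (inr k) g p) =
  \sum_k (zc w k * pd (inl k) (fun q => f q * g q) p
          + (zc w k)^*%C * pd (inr k) (fun q => f q * g q) p).
  rewrite mulr_suml mulr_sumr sum1D; apply: eq_bigr => k _.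
  rewrite (pdM (inl k) cf cg) (pdM (inr k) cf cg).
  move: (f p) (g p) (pd (inl k) f p) (pd (inr k) f p) => x y x1 x2.
  move: (pd (inl k) g p) (pd (inr k) g p) (zc w k) (zc w k)^*%C => *; ring.
by rewrite -e; exact: is_cderiveM (hf w) (hg w).
Qed.

(** The frame derivatives of a twice continuously differentiable function are
    combinations of continuously differentiable ones. *)
Lemma C2_bidiff (D : set (Cn R n)) f p : open D -> D p -> cCk 2 D f -> bidiff f p.
Proof.
move=> oD Dp h; split.
  apply: filterS (open_nbhs_nbhs (conj oD Dp)) => q Dq.
  exact: (C1_wirtinger_linear oD Dq (cCkW h)).
move=> A; have [f1 h1 c1] := cCkS (xdir A) h.
have [f2 h2 c2] := cCkS (ydir A) h.
apply: (@wirtinger_linear_near (fun q => (f1 q + (- Jev A) * f2 q) * 2^-1)).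
  apply: filterS (open_nbhs_nbhs (conj oD Dp)) => q Dq.
  have Dq' : D° q by rewrite (interior_id _).1.
  by rewrite (is_pd (h1 _ Dq') (h2 _ Dq')) mulNr.
apply: wirtinger_linearM; last exact: wirtinger_linear_cst.
apply: wirtinger_linearD; first exact: C1_wirtinger_linear oD Dp c1.
by apply: wirtinger_linearM; [exact: wirtinger_linear_cst|exact: C1_wirtinger_linear oD Dp c2].
Qed.

Lemma bidiffM f g p : bidiff f p -> bidiff g p -> bidiff (fun q => f q * g q) p.
Proof.
move=> [f1 f2] [g1 g2]; split.
  by apply: filterS2 f1 g1 => q; exact: wirtinger_linearM.
move=> A; apply: (@wirtinger_linear_near (fun q => pd A f q * g q + f q * pd A g q)).
  by apply: filterS2 f1 g1 => q hf hg; rewrite pdM //; exact: wirtinger_linear_cdiff.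
have f0 := nbhs_singleton f1; have g0 := nbhs_singleton g1.
exact: wirtinger_linearD (wirtinger_linearM (f2 A) g0) (wirtinger_linearM f0 (g2 A)).
Qed.

Lemma bidiffD f g p : bidiff f p -> bidiff g p -> bidiff (fun q => f q + g q) p.
Proof.
move=> [f1 f2] [g1 g2]; split.
  by apply: filterS2 f1 g1 => q; exact: wirtinger_linearD.
move=> A; apply: (@wirtinger_linear_near (fun q => pd A f q + pd A g q)).
  by apply: filterS2 f1 g1 => q hf hg; rewrite pdD //; exact: wirtinger_linear_cdiff.
exact: wirtinger_linearD.
Qed.

Lemma bidiff_cst (c : R[i]) p : bidiff (fun=> c) p.
Proof.
split; first by near=> q; exact: wirtinger_linear_cst.
move=> A; apply: (@wirtinger_linear_near (fun=> 0)).
  by near=> q; rewrite pd_cst.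
exact: wirtinger_linear_cst.
Unshelve. all: by end_near. Qed.

Lemma bidiff_near f g p : (\forall q \near p, f q = g q) -> bidiff f p -> bidiff g p.
Proof.
move=> fg [h1 h2]; split.
  by apply: filterS2 (nbhs_interior fg) h1 => q; exact: wirtinger_linear_near.
move=> A; apply: wirtinger_linear_near (h2 A).
by apply: filterS (nbhs_interior fg) => q; exact: pd_near.
Qed.

Lemma bidiff_r p : bidiff (@znorm2 R n) p.
Proof.
have sm0 : smooth [set: Cn R n] (@znorm2 R n).
  apply: (@csm_smooth _ _ setT coord_atoms) => //.
  - by move=> f q cf _; exact: coord_atom_continuous.
  - move=> f v cf; have [f' sf hf] := @coord_atom_derive R n f v coord_atoms cf.
    by exists f'.
  - apply: (csm_ext (f := fun q => (sqnorm q)%:C)).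
      by move=> q; rewrite znorm2_sqnorm.
    by apply: csm_real; exact: sqnorm_sm.
exact: (C2_bidiff openT I (smooth_cCk 2 sm0)).
Qed.

End Bidiff.

(** * Quantities controlled by the distance of two metrics *)

Section Comparison.
Context {R : realType} {Q : Type}.
Variables (C : set Q) (delta : Q -> R).
Implicit Types X Y Z : Q -> R[i].

(** A calculus for the comparison of two metrics on a set C: delta measures
    their distance, together with the distance of their first derivatives.
    Bounded quantities, quantities of size delta, and pairs of bounded
    quantities that differ by that size are stable under polynomial
    operations. *)
Definition bdd X := exists2 M : R, 0 <= M & forall q, C q -> cmod (X q) <= M.
Definition small X := exists2 M : R, 0 <= M & forall q, C q -> cmod (X q) <= M * delta q.
Definition lip X Y := [/\ bdd X, bdd Y & small (fun q => X q - Y q)].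

Lemma bdd_cst (c : R[i]) : bdd (fun=> c).
Proof. by exists (cmod c) => //; exact: cmod_ge0. Qed.

Lemma bddD X Y : bdd X -> bdd Y -> bdd (fun q => X q + Y q).
Proof.
move=> [a a0 ha] [b b0 hb]; exists (a + b); first exact: addr_ge0.
by move=> q Cq; apply: le_trans (cmodD _ _) _; apply: lerD; [exact: ha|exact: hb].
Qed.

Lemma bddM X Y : bdd X -> bdd Y -> bdd (fun q => X q * Y q).
Proof.
move=> [a a0 ha] [b b0 hb]; exists (a * b); first exact: mulr_ge0.
by move=> q Cq; rewrite cmodM; apply: ler_pM; rewrite ?cmod_ge0 ?ha ?hb.
Qed.

Lemma bddN X : bdd X -> bdd (fun q => - X q).
Proof. by move=> [a a0 ha]; exists a => // q Cq; rewrite cmodN ha. Qed.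

Lemma bdd_conj X : bdd X -> bdd (fun q => (X q)^*%C).
Proof. by move=> [a a0 ha]; exists a => // q Cq; rewrite cmod_conj ha. Qed.

Lemma bdd_sum (I : finType) (X : I -> Q -> R[i]) :
  (forall i, bdd (X i)) -> bdd (fun q => \sum_i X i q).
Proof.
move=> h; have: forall s : seq I, bdd (fun q => \sum_(i <- s) X i q); last exact.
elim=> [|i s ih].
  by under eq_fun do rewrite big_nil; exact: bdd_cst.
by under eq_fun do rewrite big_cons; exact: bddD.
Qed.

Lemma bdd_prod (I : finType) (X : I -> Q -> R[i]) :
  (forall i, bdd (X i)) -> bdd (fun q => \prod_i X i q).
Proof.
move=> h; have: forall s : seq I, bdd (fun q => \prod_(i <- s) X i q); last exact.
elim=> [|i s ih].
  by under eq_fun do rewrite big_nil; exact: bdd_cst.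
by under eq_fun do rewrite big_cons; exact: bddM.
Qed.

Lemma bdd_ext X Y : (forall q, C q -> X q = Y q) -> bdd X -> bdd Y.
Proof. by move=> e [a a0 ha]; exists a => // q Cq; rewrite -e // ha. Qed.

Lemma bdd_det n (M : Q -> 'M[R[i]]_n) : (forall i j, bdd (fun q => M q i j)) ->
  bdd (fun q => \det (M q)).
Proof.
move=> h; rewrite /determinant; apply: bdd_sum => s.
by apply: bddM; [exact: bdd_cst|exact: bdd_prod].
Qed.

(** Cramer, with the determinant bounded away from zero. *)
Lemma bdd_invmx n (M : Q -> 'M[R[i]]_n) i j :
  (exists2 m : R, 0 < m & forall q, C q -> m <= cmod (\det (M q))) ->
  (forall i j, bdd (fun q => M q i j)) -> bdd (fun q => invmx (M q) i j).
Proof.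
move=> [m m0 hm] h.
apply: (@bdd_ext (fun q => (\det (M q))^-1 * \adj (M q) i j)).
  move=> q Cq; rewrite /invmx (_ : M q \in unitmx) ?mxE // unitmxE unitfE.
  by apply/eqP => d0; have := hm q Cq; rewrite d0 cmod0 leNgt m0.
apply: bddM.
  exists m^-1; first by rewrite invr_ge0 ltW.
  move=> q Cq; rewrite cmodV lef_pV2 ?posrE ?hm //.
  by apply: lt_le_trans m0 _; exact: hm.
under eq_fun do rewrite mxE /cofactor.
apply: bddM; first exact: bdd_cst.
by apply: bdd_det => k l; under eq_fun do rewrite !mxE; exact: h.
Qed.

Lemma small_ext X Y : (forall q, C q -> X q = Y q) -> small X -> small Y.
Proof. by move=> e [a a0 ha]; exists a => // q Cq; rewrite -e // ha. Qed.

Lemma smallD X Y : small X -> small Y -> small (fun q => X q + Y q).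
Proof.
move=> [a a0 ha] [b b0 hb]; exists (a + b); first exact: addr_ge0.
move=> q Cq; apply: le_trans (cmodD _ _) _; rewrite mulrDl.
by apply: lerD; [exact: ha|exact: hb].
Qed.

Lemma smallN X : small X -> small (fun q => - X q).
Proof. by move=> [a a0 ha]; exists a => // q Cq; rewrite cmodN ha. Qed.

Lemma small_conj X : small X -> small (fun q => (X q)^*%C).
Proof. by move=> [a a0 ha]; exists a => // q Cq; rewrite cmod_conj ha. Qed.

Lemma smallM X Y : bdd X -> small Y -> small (fun q => X q * Y q).
Proof.
move=> [a a0 ha] [b b0 hb]; exists (a * b); first exact: mulr_ge0.
by move=> q Cq; rewrite cmodM -mulrA; apply: ler_pM; rewrite ?cmod_ge0 ?ha ?hb.
Qed.

Lemma small0 : small (fun=> 0).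
Proof. by exists 0 => // q _; rewrite cmod0 mul0r. Qed.

Lemma small_sum (I : finType) (X : I -> Q -> R[i]) :
  (forall i, small (X i)) -> small (fun q => \sum_i X i q).
Proof.
move=> h; have: forall s : seq I, small (fun q => \sum_(i <- s) X i q); last exact.
elim=> [|i s ih].
  by under eq_fun do rewrite big_nil; exact: small0.
by under eq_fun do rewrite big_cons; exact: smallD.
Qed.

Lemma lip_refl X : bdd X -> lip X X.
Proof.
by move=> h; split=> //; apply: small_ext small0 => q _; rewrite subrr.
Qed.

Lemma lip_cst (c : R[i]) : lip (fun=> c) (fun=> c).
Proof. by apply: lip_refl; exact: bdd_cst. Qed.

Lemma lipD X Y X' Y' : lip X X' -> lip Y Y' ->
  lip (fun q => X q + Y q) (fun q => X' q + Y' q).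
Proof.
move=> [a b c] [a' b' c']; split; [exact: bddD|exact: bddD|].
by apply: small_ext (smallD c c') => q _; ring.
Qed.

Lemma lipN X X' : lip X X' -> lip (fun q => - X q) (fun q => - X' q).
Proof.
move=> [a b c]; split; [exact: bddN|exact: bddN|].
by apply: small_ext (smallN c) => q _; ring.
Qed.

Lemma lipM X Y X' Y' : lip X X' -> lip Y Y' ->
  lip (fun q => X q * Y q) (fun q => X' q * Y' q).
Proof.
move=> [a b c] [a' b' c']; split; [exact: bddM|exact: bddM|].
by apply: small_ext (smallD (smallM a' c) (smallM b c')) => q _; ring.
Qed.

Lemma lip_conj X X' : lip X X' -> lip (fun q => (X q)^*%C) (fun q => (X' q)^*%C).
Proof.
move=> [a b c]; split; [exact: bdd_conj|exact: bdd_conj|].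
by apply: small_ext (small_conj c) => q _; rewrite conjcBx.
Qed.

Lemma lip_sum (I : finType) (X X' : I -> Q -> R[i]) :
  (forall i, lip (X i) (X' i)) ->
  lip (fun q => \sum_i X i q) (fun q => \sum_i X' i q).
Proof.
move=> h; split; [by apply: bdd_sum => i; case: (h i)..|].
under eq_fun do rewrite -sumrB.
by apply: small_sum => i; case: (h i).
Qed.

(** The resolvent identity A^-1 - B^-1 = - A^-1 (A - B) B^-1. *)
Lemma lip_invmx n (A B : Q -> 'M[R[i]]_n) i j :
  (forall q, C q -> A q \in unitmx /\ B q \in unitmx) ->
  (forall i j, bdd (fun q => invmx (A q) i j)) ->
  (forall i j, bdd (fun q => invmx (B q) i j)) ->
  (forall i j, lip (fun q => A q i j) (fun q => B q i j)) ->
  lip (fun q => invmx (A q) i j) (fun q => invmx (B q) i j).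
Proof.
move=> u hA hB hAB; split=> //.
apply: (@small_ext (fun q => - \sum_l (\sum_k invmx (A q) i k * (A q k l - B q k l))
                              * invmx (B q) l j)).
  move=> q /u[uA uB].
  have : invmx (A q) - invmx (B q) = - (invmx (A q) *m (A q - B q) *m invmx (B q)).
    by rewrite mulmxBr mulmxBl mulVmx // mul1mx -mulmxA mulmxV // mulmx1 opprB.
  move=> /matrixP/(_ i j); rewrite !mxE => ->; congr (- _); apply: eq_bigr => l _.
  by rewrite !mxE; congr (_ * _); apply: eq_bigr => k _; rewrite !mxE.
apply: smallN; apply: small_sum => l.
apply: (@small_ext (fun q => invmx (B q) l j * \sum_k invmx (A q) i k * (A q k l - B q k l))).
  by move=> q _; rewrite mulrC.
apply: smallM => //; apply: small_sum => k; apply: smallM => //.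
by case: (hAB k l).
Qed.

(** Everything in the velocity but S is polynomial in the inverse metric and
    the torsion; S is added back so as not to involve second derivatives. *)
Lemma lip_hcf_algebraic n (b : R * R * R * R) (S S' H H' : Q -> 'I_n -> 'I_n -> R[i])
   (T T' : Q -> 'I_n -> 'I_n -> 'I_n -> R[i]) i j :
  (forall k l, lip (fun q => H q k l) (fun q => H' q k l)) ->
  (forall k l m, lip (fun q => T q k l m) (fun q => T' q k l m)) ->
  small (fun q => (hcf_algebraic b (S q) (H q) (T q) i j + S q i j)
    - (hcf_algebraic b (S' q) (H' q) (T' q) i j + S' q i j)).
Proof.
move=> hH hT; case: b => [[[b1 b2] b3] b4]; rewrite /hcf_algebraic.
have lipHH k l m r X X' : lip X X' ->
    lip (fun q => H q k l * H q m r * X q) (fun q => H' q k l * H' q m r * X' q).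
  by move=> h; apply: lipM => //; apply: lipM.
have l1 : lip (fun q => q1 (H q) (T q) i j) (fun q => q1 (H' q) (T' q) i j).
  do 4 apply: lip_sum => ?; apply: lipHH; apply: lipM => //; exact: lip_conj.
have l2 : lip (fun q => q2 (H q) (T q) i j) (fun q => q2 (H' q) (T' q) i j).
  do 4 apply: lip_sum => ?; apply: lipHH; apply: lipM => //; exact: lip_conj.
have l3 : lip (fun q => q3 (H q) (T q) i j) (fun q => q3 (H' q) (T' q) i j).
  do 4 apply: lip_sum => ?; apply: lipHH; apply: lipM => //; exact: lip_conj.
have l4 : lip (fun q => q4 (H q) (T q) i j) (fun q => q4 (H' q) (T' q) i j).
  apply: lipM; first exact: lip_cst.
  do 4 apply: lip_sum => ?; apply: lipHH; apply: lipD; apply: lipM => //; exact: lip_conj.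
have [_ _] := lipD (lipD (lipD (lipM (lip_cst b1%:C) l1) (lipM (lip_cst b2%:C) l2))
  (lipM (lip_cst b3%:C) l3)) (lipM (lip_cst b4%:C) l4).
apply: small_ext => q _.
move: (q1 _ _ i j) (q2 _ _ i j) (q3 _ _ i j) (q4 _ _ i j) (S q i j) => x1 x2 x3 x4 x5.
move: (q1 _ _ i j) (q2 _ _ i j) (q3 _ _ i j) (q4 _ _ i j) (S' q i j) => y1 y2 y3 y4 y5.
by move: (b1%:C) (b2%:C) (b3%:C) (b4%:C) => *; ring.
Qed.

End Comparison.

(** * Comparison of the velocities of two metrics *)

Section VelocityComparison.
Context {R : realType} {n : nat}.
Implicit Types (g : R -> Cn R n -> 'M[R[i]]_n) (C : set (R * Cn R n)).

Definition metric_pd g A i j (q : R * Cn R n) : R[i] := pd A (fun z => g q.1 z i j) q.2.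
Definition metric_pd2 g l k i j (q : R * Cn R n) : R[i] :=
  pd (inr l) (pd (inl k) (fun z => g q.1 z i j)) q.2.

(** Uniform bounds for the metric, its inverse and its derivatives of order
    at most two. *)
Definition bounded_geometry C g := [/\ forall q, C q -> g q.1 q.2 \in unitmx,
  forall i j, bdd C (fun q => g q.1 q.2 i j),
  forall i j, bdd C (fun q => invmx (g q.1 q.2) i j),
  forall A i j, bdd C (metric_pd g A i j) & forall l k i j, bdd C (metric_pd2 g l k i j)].

Variables (C : set (R * Cn R n)) (g1 g2 : R -> Cn R n -> 'M[R[i]]_n).
Hypothesis (b1 : bounded_geometry C g1) (b2 : bounded_geometry C g2).

Definition defect (q : R * Cn R n) : R := \sum_i \sum_j
  (cmod (g1 q.1 q.2 i j - g2 q.1 q.2 i j) + \sum_A cmod (metric_pd g1 A i j q - metric_pd g2 A i j q)).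

Let le_sum (I : finType) (F : I -> R) i : (forall i, 0 <= F i) -> F i <= \sum_j F j.
Proof. by move=> h; rewrite (bigD1 i) //= lerDl sumr_ge0. Qed.

Let defect0 q i j : 0 <= cmod (g1 q.1 q.2 i j - g2 q.1 q.2 i j)
  + \sum_A cmod (metric_pd g1 A i j q - metric_pd g2 A i j q).
Proof. by rewrite addr_ge0 ?cmod_ge0 ?sumr_ge0 // => ? _; exact: cmod_ge0. Qed.

Let defect_le q i j : cmod (g1 q.1 q.2 i j - g2 q.1 q.2 i j)
  + \sum_A cmod (metric_pd g1 A i j q - metric_pd g2 A i j q) <= defect q.
Proof.
apply: le_trans (le_sum (F := fun j => cmod (g1 q.1 q.2 i j - g2 q.1 q.2 i j)
  + \sum_A cmod (metric_pd g1 A i j q - metric_pd g2 A i j q)) j (fun j => defect0 q i j)) _.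
apply: (le_sum (F := fun i => \sum_j (cmod (g1 q.1 q.2 i j - g2 q.1 q.2 i j)
  + \sum_A cmod (metric_pd g1 A i j q - metric_pd g2 A i j q)))) => k.
by apply: sumr_ge0 => l _.
Qed.

Lemma small_metric i j : small C defect (fun q => g1 q.1 q.2 i j - g2 q.1 q.2 i j).
Proof.
exists 1 => // q _; rewrite mul1r; apply: le_trans (defect_le q i j).
by rewrite lerDl sumr_ge0 // => ? _; exact: cmod_ge0.
Qed.

Lemma small_metric_pd A i j : small C defect (fun q => metric_pd g1 A i j q - metric_pd g2 A i j q).
Proof.
exists 1 => // q _; rewrite mul1r; apply: le_trans (defect_le q i j).
apply: le_trans (le_sum (F := fun A => cmod (metric_pd g1 A i j q - metric_pd g2 A i j q)) A _) _.
  by move=> B; exact: cmod_ge0.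
by rewrite lerDr cmod_ge0.
Qed.

Let lip_metric_pd A i j : lip C defect (metric_pd g1 A i j) (metric_pd g2 A i j).
Proof.
by case: b1 b2 => _ _ _ h1 _ [_ _ _ h2 _]; split; [exact: h1|exact: h2|exact: small_metric_pd].
Qed.

Let lip_inv k l : lip C defect (fun q => ginv (g1 q.1) q.2 k l)
  (fun q => ginv (g2 q.1) q.2 k l).
Proof.
case: b1 b2 => u1 m1 i1 _ _ [u2 m2 i2 _ _].
apply: (lip_invmx (A := fun q => g1 q.1 q.2) (B := fun q => g2 q.1 q.2)) => //.
  by move=> q Cq; split; [exact: u1|exact: u2].
by move=> i j; split=> //; exact: small_metric.
Qed.

(** Second derivatives enter S only through g^{k lbar} d_k d_lbar g_ij. The
    difference of these terms is g1^{k lbar} d_k d_lbar (g1 - g2)_ij up to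
    (g1^{-1} - g2^{-1}) times the bounded second derivatives of g2. *)
Lemma velocity_comparison b i j : small C defect (fun q =>
  (hcf_algebraic b (chern_S (g1 q.1) q.2) (ginv (g1 q.1) q.2) (chern_torsion (g1 q.1) q.2) i j
   - hcf_algebraic b (chern_S (g2 q.1) q.2) (ginv (g2 q.1) q.2) (chern_torsion (g2 q.1) q.2) i j)
  - \sum_k \sum_l ginv (g1 q.1) q.2 k l * (metric_pd2 g1 l k i j q - metric_pd2 g2 l k i j q)).
Proof.
pose lap g (q : R * Cn R n) := \sum_k \sum_l ginv (g q.1) q.2 k l * metric_pd2 g l k i j q.
pose low g (q : R * Cn R n) := \sum_k \sum_l ginv (g q.1) q.2 k l *
   \sum_d chern_gamma (g q.1) q.2 k i d * metric_pd g (inr l) d j q.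
have SE g q : chern_S (g q.1) q.2 i j = low g q - lap g q.
  rewrite /chern_S /low /lap -sumrB; apply: eq_bigr => k _.
  rewrite -sumrB; apply: eq_bigr => l _; rewrite -mulrBr addrC; congr (_ * _).
have l1 : lip C defect (low g1) (low g2).
  apply: lip_sum => k; apply: lip_sum => l; apply: lipM => //.
  apply: lip_sum => d; apply: lipM => //.
  by apply: lip_sum => m; apply: lipM => //; exact: lip_metric_pd.
have hT k l m : lip C defect (fun q => chern_torsion (g1 q.1) q.2 k l m)
    (fun q => chern_torsion (g2 q.1) q.2 k l m).
  by apply: lipD; [exact: lip_metric_pd|apply: lipN; exact: lip_metric_pd].
have s1 := lip_hcf_algebraic b (fun q => chern_S (g1 q.1) q.2) (fun q => chern_S (g2 q.1) q.2)
  i j lip_inv hT.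
have [_ _ s2] := l1.
have s3 : small C defect (fun q => \sum_k \sum_l
    (metric_pd2 g2 l k i j q * (ginv (g1 q.1) q.2 k l - ginv (g2 q.1) q.2 k l))).
  apply: small_sum => k; apply: small_sum => l; apply: smallM.
    by case: b2 => _ _ _ _; apply.
  by case: (lip_inv k l).
apply: small_ext (smallD s1 (smallD (smallN s2) s3)) => q _.
have -> : \sum_k \sum_l ginv (g1 q.1) q.2 k l * (metric_pd2 g1 l k i j q - metric_pd2 g2 l k i j q) =
  lap g1 q - lap g2 q - \sum_k \sum_l
    (metric_pd2 g2 l k i j q * (ginv (g1 q.1) q.2 k l - ginv (g2 q.1) q.2 k l)).
  rewrite /lap -!sumrB; apply: eq_bigr => k _; rewrite -!sumrB; apply: eq_bigr => l _.
  move: (metric_pd2 g1 l k i j q) (metric_pd2 g2 l k i j q) (ginv (g1 q.1) q.2 k l) (ginv (g2 q.1) q.2 k l).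
  by move=> *; ring.
have E (a c x y z t w : R[i]) : a + (x - z) - (c + (y - t)) + (- (x - y) + w) =
  a - c - (z - t - w) by ring.
by rewrite (SE g1) (SE g2) E.
Qed.

End VelocityComparison.

Section Slices.
Context {R : realType} {n : nat}.
Implicit Types (D : set (R * Cn R n)) (X Y : R * Cn R n -> R[i]).

Lemma CkD (V : normedModType R) k (D : set V) (f g : V -> R) : Ck k D f -> Ck k D g ->
  Ck k D (fun q => f q + g q).
Proof.
elim: k f g => [|k ih] f g [cf hf] [cg hg]; (split; first exact: withinD) => // v.
have [f' df kf] := hf v; have [g' dg kg] := hg v.
exists (fun q => f' q + g' q); last exact: ih.
by move=> p Dp; apply: is_deriveD; [exact: df|exact: dg].
Qed.

Lemma CkZ (V : normedModType R) k (D : set V) (c : R) (f : V -> R) : Ck k D f ->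
  Ck k D (fun q => c * f q).
Proof.
elim: k f => [|k ih] f [cf hf]; (split;
  first by apply: withinM => // x; exact: cst_continuous) => // v.
have [f' df kf] := hf v; exists (fun q => c * f' q); last exact: ih.
by move=> p Dp; apply: (is_deriveZ c (df p Dp)).
Qed.

Lemma cCkD (V : normedModType R) k (D : set V) (f g : V -> R[i]) : cCk k D f -> cCk k D g ->
  cCk k D (fun q => f q + g q).
Proof.
move=> [a b] [c d]; split; under eq_fun do rewrite raddfD /=; exact: CkD.
Qed.

Lemma cCkZ (V : normedModType R) k (D : set V) (c : R[i]) (f : V -> R[i]) : cCk k D f ->
  cCk k D (fun q => c * f q).
Proof.
move=> [a b]; split.
  under eq_fun do rewrite Re_mul; apply: CkD; first exact: CkZ.
  by under eq_fun do rewrite -mulNr; exact: CkZ.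
by under eq_fun do rewrite Im_mul; apply: CkD; exact: CkZ.
Qed.

Lemma is_derive_slice (f : R * Cn R n -> R) t p v d :
  is_derive (t, p) (0, v) f d -> is_derive p v (fun z => f (t, z)) d.
Proof.
move=> /is_derive_line h; apply/is_derive_line.
suff -> : (fun h : R => f (t, h *: v + p)) =
  (fun h : R => f (h *: ((0, v) : R * Cn R n) + (t, p))) by [].
apply/funext => s; congr f; apply/eqP; rewrite xpair_eqE /= eqxx andbT.
by rewrite scaler0 add0r.
Qed.

(** A frame derivative in space of a function smooth in time and space is
    again the restriction of such a function; this is how bounds for spatial
    derivatives follow from compactness in space and time. *)
Lemma slice_pd k D X A : cCk k.+1 D X -> exists2 Y, cCk k D Y &
  forall t p, D° (t, p) -> pd A (fun z => X (t, z)) p = Y (t, p).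
Proof.
move=> h.
have [f1 h1 c1] := cCkS ((0, xdir A) : R * Cn R n) h.
have [f2 h2 c2] := cCkS ((0, ydir A) : R * Cn R n) h.
exists (fun q => 2^-1 * (f1 q + (- Jev A) * f2 q)).
  by apply: cCkZ; apply: cCkD => //; exact: cCkZ.
move=> t p Dp; rewrite (is_pd (a := f1 (t, p)) (b := f2 (t, p))); first 1 last.
- by have [a b] := h1 _ Dp; split; exact: is_derive_slice.
- by have [a b] := h2 _ Dp; split; exact: is_derive_slice.
by rewrite mulrC mulNr.
Qed.

Lemma bdd_compact D C E X : compact C -> C `<=` D -> E `<=` C -> cCk 0 D X -> bdd E X.
Proof.
move=> cC CD EC h.
have [M M0 hM] := compact_bounded_above cC (ccont_nsq (cCk_ccont CD h)).
exists (Num.sqrt M); first exact: sqrtr_ge0.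
move=> q /EC Cq; rewrite -[cmod _]ger0_norm ?cmod_ge0 // -sqrtr_sqr.
by rewrite ler_sqrt ?cmod_nsq ?hM.
Qed.

End Slices.

(** * Bounded geometry of solutions on compact sets *)

Section Annulus.
Context {R : realType} {n : nat}.

Definition annulus (c1 c2 : R) : set (Cn R n) := [set p | c1 <= sqnorm p <= c2].

Lemma sqnorm_continuous : continuous (@sqnorm R n).
Proof.
move=> p; apply: (@sm_continuous _ _ setT coord_atoms) => //.
  by move=> g q cg _; exact: coord_atom_continuous.
exact: sqnorm_sm.
Qed.

Lemma annulus_closed c1 c2 : closed (annulus c1 c2).
Proof.
have -> : annulus c1 c2 = @sqnorm R n @^-1` [set x | c1 <= x] `&`
                          @sqnorm R n @^-1` [set x | x <= c2].
  by apply/seteqP; split=> p /= => [/andP[]|[a b]] //; apply/andP.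
have c (A : set R) : closed A -> closed (@sqnorm R n @^-1` A).
  by apply: closed_comp => p _; exact: sqnorm_continuous.
by apply: closedI; apply: c; [exact: closed_ge|exact: closed_le].
Qed.

Lemma coord_le_sqnorm (p : Cn R n) i : p.1 0 i ^+ 2 <= sqnorm p /\ p.2 0 i ^+ 2 <= sqnorm p.
Proof.
have h0 j : 0 <= p.1 0 j * p.1 0 j + p.2 0 j * p.2 0 j by rewrite -!expr2 addr_ge0 ?sqr_ge0.
have : p.1 0 i * p.1 0 i + p.2 0 i * p.2 0 i <= sqnorm p.
  by rewrite /sqnorm (bigD1 i) //= lerDl sumr_ge0.
by rewrite -!expr2; have := sqr_ge0 (p.1 0 i); have := sqr_ge0 (p.2 0 i); split; lra.
Qed.

Lemma annulus_compact c1 c2 : compact (annulus c1 c2).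
Proof.
pose M := 1 + `|c2|; pose B := [set v : 'rV[R]_n | forall i, `[- M, M]%classic (v ord0 i)].
have cB : compact B.
  by apply: (@rV_compact _ _ (fun=> `[- M, M]%classic)) => i; exact: segment_compact.
have cBB : compact (B `*` B : set (Cn R n)) by exact: compact_setX.
apply: subclosed_compact cBB _; first exact: annulus_closed.
have M0 : 0 <= M by rewrite addr_ge0.
have sq x : x ^+ 2 <= c2 -> `[- M, M]%classic x.
  move=> xc; rewrite /= in_itv /= -ler_norml.
  have : `|x| ^+ 2 <= M ^+ 2.
    rewrite real_normK ?num_real //; apply: le_trans xc _; apply: le_trans (ler_norm _) _.
    by rewrite /M; have := normr_ge0 c2; nra.
  by rewrite ler_pXn2r // nnegrE.
by move=> p /andP[_ pc]; split=> i /=; apply: sq; apply: le_trans pc;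
  have [] := coord_le_sqnorm p i.
Qed.

Lemma annulus_punctured c1 c2 : 0 < c1 -> annulus c1 c2 `<=` punctured.
Proof.
move=> c0 p /andP[h _]; rewrite /punctured /=; apply/eqP => p0; move: h.
rewrite leNgt p0 /sqnorm big1 ?c0 // => i _; by rewrite !mxE mulr0 addr0.
Qed.

End Annulus.

Section BoundedGeometry.
Context {R : realType} {n : nat}.

(** The domain of a solution, on which it is smooth up to t = 0. *)
Definition flow_domain (T : \bar R) : set (R * Cn R n) :=
  [set q | [/\ 0 <= q.1, (q.1%:E < T)%E & punctured q.2]].

Definition slab (t1 : R) (K : set (Cn R n)) : set (R * Cn R n) :=
  [set q | 0 <= q.1 <= t1 /\ K q.2].

Lemma slab_compact t1 K : compact K -> compact (slab t1 K).
Proof.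
move=> cK; have := compact_setX (@segment_compact R 0 t1) cK.
suff -> : slab t1 K = `[0, t1]%classic `*` K by [].
by apply/seteqP; split=> q /=; rewrite in_itv.
Qed.

Lemma slab_domain t1 K T : K `<=` punctured -> (t1%:E < T)%E ->
  slab t1 K `<=` flow_domain T.
Proof.
move=> Kp tT q [/andP[q0 qt] Kq]; split=> //; last exact: Kp.
by apply: le_lt_trans tT; rewrite lee_fin.
Qed.

Lemma flow_domain_interior T t p : 0 < t -> (t%:E < T)%E -> punctured p ->
  (flow_domain T)° (t, p).
Proof.
move=> t0 tT pp.
have nt : \forall s \near t, 0 <= s /\ (s%:E < T)%E.
  have nT : \forall s \near t, (s%:E < T)%E.
    case: T tT => [T| |] //= tT; last by near=> s; rewrite ltry.
    by rewrite lte_fin in tT; apply: filterS (lt_nbhsl tT) => s; rewrite lte_fin.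
  by near=> s; split; [apply: ltW; near: s; exact: lt_nbhsr|near: s].
have := near_punctured pp => np.
exists ([set s | 0 <= s /\ (s%:E < T)%E], punctured); first by [].
by move=> [s z] [[s0 sT] pz].
Unshelve. all: by end_near. Qed.

Lemma regular_unit (g : Cn R n -> 'M[R[i]]_n) a p :
  hopf_metric a g -> punctured p -> g p \in unitmx.
Proof. by move=> [_ h _] pp; exact: posdef_unit (h _ pp). Qed.

(** On a compact part of the domain all these quantities are restrictions of
    continuous functions; times t > 0 only, since derivatives are identified
    in the interior. *)
Lemma solution_bounded_geometry a b g0 T (g : R -> Cn R n -> 'M[R[i]]_n) t1 K :
  hcf_solution a b g0 T g -> (t1%:E < T)%E -> K `<=` punctured -> compact K ->
  bounded_geometry [set q | 0 < q.1 <= t1 /\ K q.2] g.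
Proof.
move=> [T0 [_ hm sm _]] tT Kp cK.
have cS := @slab_compact t1 _ cK; have SD := slab_domain Kp tT.
have ES : [set q : R * Cn R n | 0 < q.1 <= t1 /\ K q.2] `<=` slab t1 K.
  by move=> q [/andP[/ltW q0 qt] Kq]; split=> //; rewrite q0.
have ED q : [set q : R * Cn R n | 0 < q.1 <= t1 /\ K q.2] q -> (flow_domain T)° (q.1, q.2).
  move=> [/andP[q0 qt] Kq]; apply: flow_domain_interior => //; last exact: Kp.
  by apply: le_lt_trans tT; rewrite lee_fin.
have S1 i j A := slice_pd A (smooth_cCk 1 (sm i j)).
have S2 i j A B : exists2 Y, cCk 0 (flow_domain T) Y & forall t p, 0 < t -> (t%:E < T)%E ->
    punctured p -> pd B (pd A (fun z => g t z i j)) p = Y (t, p).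
  have [X cX hX] := slice_pd A (smooth_cCk 2 (sm i j)).
  have [Y cY hY] := slice_pd B cX; exists Y => // t p t0 tT' pp.
  rewrite -hY; last exact: flow_domain_interior.
  apply: pd_near; have := near_punctured pp; apply: filterS => z pz.
  by rewrite -hX //; exact: flow_domain_interior.
have det_low : exists2 m : R, 0 < m &
   forall q, slab t1 K q -> m <= cmod (\det (g q.1 q.2)).
  have cd : ccont (slab t1 K) (fun q => \det (g q.1 q.2)).
    by apply: ccont_det => i j; exact: cCk_ccont SD (smooth_cCk 0 (sm i j)).
  have pos q : slab t1 K q -> 0 < nsq (\det (g q.1 q.2)).
    move=> [/andP[q0 qt] Kq]; rewrite lt_neqAle nsq_ge0 andbT eq_sym -cmod_nsq expf_eq0 /=.
    have : g q.1 q.2 \in unitmx.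
      apply: (regular_unit (a := a)); last exact: Kp.
      by apply: hm => //; apply: le_lt_trans tT; rewrite lee_fin.
    rewrite unitmxE unitfE; apply: contra => /eqP h; apply/eqP.
    exact: ComplexField.Normc.eq0_normc h.
  have [m m0 hmin] := compact_bounded_below cS (ccont_nsq cd) pos.
  exists (Num.sqrt m); first by rewrite sqrtr_gt0.
  move=> q /hmin h; rewrite -[cmod _]ger0_norm ?cmod_ge0 // -sqrtr_sqr.
  by rewrite ler_sqrt ?cmod_nsq // nsq_ge0.
have bg i j : bdd [set q : R * Cn R n | 0 < q.1 <= t1 /\ K q.2] (fun q => g q.1 q.2 i j).
  exact: (bdd_compact cS SD ES (smooth_cCk 0 (sm i j))).
split=> //.
- move=> q [/andP[/ltW q0 qt] Kq]; apply: (regular_unit (a := a)); last exact: Kp.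
  by apply: hm => //; apply: le_lt_trans tT; rewrite lee_fin.
- move=> i j; apply: bdd_invmx => //; have [m m0 h] := det_low.
  by exists m => // q /ES; exact: h.
- move=> A i j; have [Y cY hY] := S1 i j A.
  apply: bdd_ext (bdd_compact cS SD ES cY) => q Eq.
  by rewrite /metric_pd (hY q.1 q.2) -?surjective_pairing //; exact: ED.
- move=> l k i j; have [Y cY hY] := S2 i j (inl k) (inr l).
  apply: bdd_ext (bdd_compact cS SD ES cY) => q [/andP[q0 qt] Kq].
  rewrite /metric_pd2 (hY q.1 q.2) -?surjective_pairing //; last exact: Kp.
  by apply: le_lt_trans tT; rewrite lee_fin.
Qed.

End BoundedGeometry.

(** * Growth of the difference of two solutions *)

Section RealSums.
Context {R : realType}.

Lemma le_term_sum (I : finType) (f : I -> R) i : (forall i, 0 <= f i) -> f i <= \sum_j f j.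
Proof. by move=> h; rewrite (bigD1 i) //= lerDl sumr_ge0. Qed.

Lemma sqr_sum_le (I : finType) (a : I -> R) :
  (\sum_i a i) ^+ 2 <= #|I|%:R * \sum_i a i ^+ 2.
Proof.
have e : \sum_i \sum_(j : I) (a i ^+ 2 + a j ^+ 2) = 2 * (#|I|%:R * \sum_i a i ^+ 2).
  under eq_bigr do rewrite big_split /= sumr_const.
  rewrite big_split /= sumr_const sumrMnl -mulr_natl; ring.
suff : 2 * (\sum_i a i) ^+ 2 <= 2 * (#|I|%:R * \sum_i a i ^+ 2) by rewrite ler_pM2l.
rewrite -e expr2 mulr_suml mulr_sumr; apply: ler_sum => i _.
rewrite !mulr_sumr; apply: ler_sum => j _.
by rewrite -subr_ge0; have := sqr_ge0 (a i - a j); congr (_ <= _); ring.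
Qed.

(** The first order term M c S Y is absorbed by the negative term - Q, which
    controls Y^2, at the price of a multiple of S^2. *)
Lemma peter_paul (M c N S Y A Q : R) : 0 <= M -> 0 < N -> Y ^+ 2 <= N * Q ->
  S ^+ 2 <= A -> - Q + S * (M * (S + c * Y)) <= (M + N * (M * c) ^+ 2) * A.
Proof.
move=> M0 N0 hY hS; have hQ : Y ^+ 2 / N <= Q by rewrite ler_pdivrMr // mulrC.
have h : (M * c) * (S * Y) <= Y ^+ 2 / N + N * (M * c) ^+ 2 * S ^+ 2.
  have h := sqr_ge0 (Y - N * (M * c) * S / 2).
  have e : Y ^+ 2 / N + N * (M * c) ^+ 2 * S ^+ 2 - M * c * (S * Y) =
    ((Y - N * (M * c) * S / 2) ^+ 2 + 3 / 4 * (N * (M * c) * S) ^+ 2) / N.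
    by field; rewrite gt_eqF.
  rewrite -subr_ge0 e; apply: divr_ge0; last exact: ltW.
  by apply: addr_ge0 => //; apply: mulr_ge0; [lra|exact: sqr_ge0].
have h1 : (M + N * (M * c) ^+ 2) * S ^+ 2 <= (M + N * (M * c) ^+ 2) * A.
  apply: ler_wpM2l => //; apply: addr_ge0 => //; apply: mulr_ge0; first exact: ltW.
  exact: sqr_ge0.
apply: le_trans h1; rewrite mulrDl; move: h hQ; lra.
Qed.

End RealSums.

Section DifferenceOfSolutions.
Context {R : realType} {n : nat}.
Variables (E : set (R * Cn R n)) (g1 g2 : R -> Cn R n -> 'M[R[i]]_n).
Hypothesis (b1 : bounded_geometry E g1) (b2 : bounded_geometry E g2).
Hypothesis (E1 : forall q, E q -> regular_metric (g1 q.1) /\ regular_metric (g2 q.1)).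
Hypothesis (Ep : forall q, E q -> hermitian_posdef (g1 q.1 q.2)).
Variables (c1 c2 : R).
Hypothesis (c0 : 0 < c1) (EK : forall q, E q -> annulus c1 c2 q.2).
Implicit Types (q : R * Cn R n) (x : 'I_n * 'I_n).

Definition gap (q : R * Cn R n) x : R[i] := g1 q.1 q.2 x.1 x.2 - g2 q.1 q.2 x.1 x.2.
(** The factor |z|^2 makes the sum of squares of the entries invariant under
    the deck transformation. *)
Definition scaled_gap t x p : R[i] := znorm2 p * gap (t, p) x.
Let F := scaled_gap.

(** The size of the difference and of its derivatives along d_k; the
    derivatives along dbar_k are conjugates of these, by Hermitian symmetry. *)
Definition jet q : R := \sum_x (cmod (F q.1 x q.2) + \sum_k cmod (pd (inl k) (F q.1 x) q.2)).

Let Epp q : E q -> punctured q.2.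
Proof. by move=> /EK; exact: annulus_punctured. Qed.

Lemma jet_term_ge0 q x :
  0 <= cmod (F q.1 x q.2) + \sum_k cmod (pd (inl k) (F q.1 x) q.2).
Proof.
by apply: addr_ge0; [exact: cmod_ge0|apply: sumr_ge0 => k _; exact: cmod_ge0].
Qed.

Lemma jet_ge0 q : 0 <= jet q.
Proof. by apply: sumr_ge0 => x _; exact: jet_term_ge0. Qed.

Let le_jet q x : cmod (F q.1 x q.2) + \sum_k cmod (pd (inl k) (F q.1 x) q.2) <= jet q.
Proof. exact: (le_term_sum x (jet_term_ge0 q)). Qed.

Let smallF x : small E jet (fun q => F q.1 x q.2).
Proof.
exists 1 => // q _; rewrite mul1r; apply: le_trans (le_jet q x).
by rewrite lerDl; apply: sumr_ge0 => k _; exact: cmod_ge0.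
Qed.

Let smalldF x k : small E jet (fun q => pd (inl k) (F q.1 x) q.2).
Proof.
exists 1 => // q _; rewrite mul1r; apply: le_trans (le_jet q x).
apply: le_trans (le_term_sum k (fun k => cmod_ge0 (pd (inl k) (F q.1 x) q.2))) _.
by rewrite lerDr cmod_ge0.
Qed.

Let r_real q : E q -> cmod (znorm2 q.2) = sqnorm q.2 /\ c1 <= sqnorm q.2 <= c2.
Proof.
move=> Eq; have /andP[h1 h2] := EK Eq; split; last by rewrite h1.
rewrite znorm2_sqnorm /= expr0n addr0 sqrtr_sqr ger0_norm //.
by apply: ltW; apply: lt_le_trans h1.
Qed.

Let bdd_r : bdd E (fun q => znorm2 q.2).
Proof.
exists `|c2| => // q /r_real[-> /andP[_ h]]; exact: le_trans h (ler_norm _).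
Qed.

Let bdd_rV : bdd E (fun q => (znorm2 q.2)^-1).
Proof.
exists c1^-1; first by rewrite invr_ge0 ltW.
move=> q /r_real[e /andP[h _]]; rewrite cmodV e lef_pV2 ?posrE //.
exact: lt_le_trans h.
Qed.

Let bdd_zc i : bdd E (fun q => zc q.2 i).
Proof.
exists (1 + `|c2|) => [|q /r_real[_ /andP[_ h]]]; first exact: addr_ge0.
have hz : nsq (zc q.2 i) <= c2.
  apply: le_trans h; rewrite /nsq /zc /= /sqnorm (bigD1 i) //= lerDl.
  by apply: sumr_ge0 => k _; rewrite -!expr2 addr_ge0 ?sqr_ge0.
have : cmod (zc q.2 i) ^+ 2 <= (1 + `|c2|) ^+ 2.
  rewrite cmod_nsq; apply: le_trans hz _; apply: le_trans (ler_norm _) _.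
  by have := normr_ge0 c2; nra.
by rewrite ler_pXn2r // nnegrE ?cmod_ge0 // addr_ge0.
Qed.

Let bdd_zb i : bdd E (fun q => (zc q.2 i)^*%C).
Proof. exact: bdd_conj. Qed.

Let dr (A : 'I_n + 'I_n) (p : Cn R n) : R[i] := match A with inl k => (zc p k)^*%C | inr k => zc p k end.

Let bdd_dr A : bdd E (fun q => dr A q.2).
Proof. by case: A => k; [exact: bdd_zb|exact: bdd_zc]. Qed.

Let regular_gap q x : E q -> forall p, punctured p ->
  cdiff (fun z => gap (q.1, z) x) p /\
  forall A, cdiff (fun z => pd A (fun z' => g1 q.1 z' x.1 x.2) z
                          - pd A (fun z' => g2 q.1 z' x.1 x.2) z) p.
Proof.
move=> Eq p pp; have [r1 r2] := E1 Eq; have [_ _ metric_pd e1] := r1 p pp; have [_ _ metric_pd2 e2] := r2 p pp.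
by split=> [|A]; apply: cdiffD => //; apply: cdiffN.
Qed.

Let pd_gap q x A p : E q -> punctured p -> pd A (F q.1 x) p =
  dr A p * gap (q.1, p) x + znorm2 p * (pd A (fun z => g1 q.1 z x.1 x.2) p
                                        - pd A (fun z => g2 q.1 z x.1 x.2) p).
Proof.
move=> Eq pp; have [r1 r2] := E1 Eq; have [_ _ e1 _] := r1 p pp; have [_ _ e2 _] := r2 p pp.
rewrite pdM; last by case: (regular_gap x Eq pp).
  by rewrite pd_r pdD // ?pdN //; exact: cdiffN.
exact: cdiff_r.
Qed.

Let smallgap x : small E jet (gap^~ x).
Proof.
apply: small_ext (smallM bdd_rV (smallF x)) => q Eq.
by rewrite /F /scaled_gap mulKf ?punctured_r -?surjective_pairing //; exact: Epp.
Qed.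

Lemma scaled_gap_conj q x p : E q -> punctured p -> F q.1 (x.2, x.1) p = (F q.1 x p)^*%C.
Proof.
move=> Eq pp; have [r1 r2] := E1 Eq; have [_ h1 _ _] := r1 p pp; have [_ h2 _ _] := r2 p pp.
rewrite /F /scaled_gap /gap /= conjcMx conjcBx -h1 -h2; congr (_ * _).
by rewrite conj_r.
Qed.

(** Hermitian symmetry exchanges the derivatives along d_k and dbar_k. *)
Lemma pd_inr_gap q x k : E q ->
  pd (inr k) (F q.1 x) q.2 = (pd (inl k) (F q.1 (x.2, x.1)) q.2)^*%C.
Proof.
move=> Eq; have pp := Epp Eq.
rewrite (_ : inl k = barI (inr k)) // -pd_conj; last first.
  by apply: cdiffM; [exact: cdiff_r|case: (regular_gap (x.2, x.1) Eq pp)].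
apply: pd_near; have := near_punctured pp; apply: filterS => z pz.
by rewrite -scaled_gap_conj //; case: (x).
Qed.

Let small_dgap x A : small E jet (fun q => metric_pd g1 A x.1 x.2 q - metric_pd g2 A x.1 x.2 q).
Proof.
have s : small E jet (fun q => pd A (F q.1 x) q.2).
  case: A => k; first exact: smalldF.
  apply: small_ext (small_conj (smalldF (x.2, x.1) k)) => q Eq.
  by rewrite pd_inr_gap.
apply: small_ext (smallM bdd_rV (smallD s (smallN (smallM (bdd_dr A) (smallgap x))))).
move=> q Eq; rewrite pd_gap -?surjective_pairing //; last exact: Epp.
by rewrite addrAC subrr add0r mulKf // punctured_r //; exact: Epp.
Qed.

Let defect_jet : exists2 M : R, 0 <= M & forall q, E q -> defect g1 g2 q <= M * jet q.
Proof.
have sumM (I : finType) (f : I -> R * Cn R n -> R) :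
    (forall i, exists2 M : R, 0 <= M & forall q, E q -> f i q <= M * jet q) ->
    exists2 M : R, 0 <= M & forall q, E q -> \sum_i f i q <= M * jet q.
  move=> h; have: forall s : seq I, exists2 M : R, 0 <= M &
     forall q, E q -> \sum_(i <- s) f i q <= M * jet q; last exact.
  elim=> [|i s [M M0 hM]].
    by exists 0 => // q _; rewrite big_nil mul0r.
  have [N N0 hN] := h i; exists (N + M); first exact: addr_ge0.
  by move=> q Eq; rewrite big_cons mulrDl; apply: lerD; [exact: hN|exact: hM].
apply: (sumM) => i; apply: (sumM) => j.
have [M M0 hM] := smallgap (i, j).
have [N N0 hN] := sumM _ (fun A q => cmod (metric_pd g1 A i j q - metric_pd g2 A i j q))
   (fun A => small_dgap (i, j) A).
exists (M + N); first exact: addr_ge0.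
by move=> q Eq; rewrite mulrDl; apply: lerD; [exact: hM|exact: hN].
Qed.

Let pd2_gap q x k l : E q -> pd (inr l) (pd (inl k) (F q.1 x)) q.2 =
  (l == k)%:R * gap q x
  + (zc q.2 k)^*%C * (metric_pd g1 (inr l) x.1 x.2 q - metric_pd g2 (inr l) x.1 x.2 q)
  + zc q.2 l * (metric_pd g1 (inl k) x.1 x.2 q - metric_pd g2 (inl k) x.1 x.2 q)
  + znorm2 q.2 * (metric_pd2 g1 l k x.1 x.2 q - metric_pd2 g2 l k x.1 x.2 q).
Proof.
move=> Eq; have pp := Epp Eq.
have [h1 h2] := regular_gap x Eq pp.
have [r1 r2] := E1 Eq; have [_ _ e1 f1] := r1 _ pp; have [_ _ e2 f2] := r2 _ pp.
have -> : pd (inr l) (pd (inl k) (F q.1 x)) q.2 = pd (inr l) (fun p =>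
   (zc p k)^*%C * gap (q.1, p) x + znorm2 p * (pd (inl k) (fun z => g1 q.1 z x.1 x.2) p
                                        - pd (inl k) (fun z => g2 q.1 z x.1 x.2) p)) q.2.
  by apply: pd_near; have := near_punctured pp; apply: filterS => z pz; exact: pd_gap.
have cz : cdiff (fun p : Cn R n => (zc p k)^*%C) q.2 by apply: cdiff_conj; exact: cdiff_zc.
rewrite pdD; first last.
- by apply: cdiffM; [exact: cdiff_r|exact: h2].
- by apply: cdiffM.
rewrite (pdM _ cz h1) (pdM _ (cdiff_r _) (h2 (inl k))) pd_zbar pd_r.
rewrite (pdD _ (f1 _ _ _) (cdiffN (f2 _ _ _))) (pdN _ (f2 _ _ _)).
rewrite (pdD _ (e1 _ _) (cdiffN (e2 _ _))) (pdN _ (e2 _ _)).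
by rewrite -surjective_pairing addrA.
Qed.

(** The factor |z|^2 contributes terms of order at most one, bounded on the
    annulus. *)
Lemma velocity_gap b : exists2 M : R, 0 <= M & forall q x, E q ->
  cmod (znorm2 q.2 *
    (hcf_algebraic b (chern_S (g1 q.1) q.2) (ginv (g1 q.1) q.2)
       (chern_torsion (g1 q.1) q.2) x.1 x.2
     - hcf_algebraic b (chern_S (g2 q.1) q.2) (ginv (g2 q.1) q.2)
       (chern_torsion (g2 q.1) q.2) x.1 x.2)
   - \sum_k \sum_l ginv (g1 q.1) q.2 k l * pd (inr l) (pd (inl k) (F q.1 x)) q.2)
  <= M * jet q.
Proof.
pose vel g q x := hcf_algebraic b (chern_S (g q.1) q.2) (ginv (g q.1) q.2)
       (chern_torsion (g q.1) q.2) x.1 x.2.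
have H x : small E jet (fun q => znorm2 q.2 * (vel g1 q x - vel g2 q x)
   - \sum_k \sum_l ginv (g1 q.1) q.2 k l * pd (inr l) (pd (inl k) (F q.1 x)) q.2).
  have [M M0 hM] := velocity_comparison b1 b2 b x.1 x.2.
  have [N N0 hN] := defect_jet.
  have s1 : small E jet (fun q => vel g1 q x - vel g2 q x -
     \sum_k \sum_l ginv (g1 q.1) q.2 k l * (metric_pd2 g1 l k x.1 x.2 q - metric_pd2 g2 l k x.1 x.2 q)).
    exists (M * N); first exact: mulr_ge0.
    move=> q Eq; apply: le_trans (hM q Eq) _; rewrite -mulrA.
    by apply: ler_wpM2l => //; exact: hN.
  have s2 : small E jet (fun q => \sum_k \sum_l ginv (g1 q.1) q.2 k l *
     ((l == k)%:R * gap q x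
      + (zc q.2 k)^*%C * (metric_pd g1 (inr l) x.1 x.2 q - metric_pd g2 (inr l) x.1 x.2 q)
      + zc q.2 l * (metric_pd g1 (inl k) x.1 x.2 q - metric_pd g2 (inl k) x.1 x.2 q))).
    apply: small_sum => k; apply: small_sum => l.
    have [_ _ bi _ _] := b1; apply: smallM; first exact: bi.
    apply: smallD; last exact: smallM.
    by apply: smallD; apply: smallM => //; exact: bdd_cst.
  apply: small_ext (smallD (smallM bdd_r s1) (smallN s2)) => q Eq.
  have -> : \sum_k \sum_l ginv (g1 q.1) q.2 k l * pd (inr l) (pd (inl k) (F q.1 x)) q.2 =
     znorm2 q.2 * \sum_k \sum_l ginv (g1 q.1) q.2 k l
        * (metric_pd2 g1 l k x.1 x.2 q - metric_pd2 g2 l k x.1 x.2 q)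
     + \sum_k \sum_l ginv (g1 q.1) q.2 k l *
     ((l == k)%:R * gap q x
      + (zc q.2 k)^*%C * (metric_pd g1 (inr l) x.1 x.2 q - metric_pd g2 (inr l) x.1 x.2 q)
      + zc q.2 l * (metric_pd g1 (inl k) x.1 x.2 q - metric_pd g2 (inl k) x.1 x.2 q)).
    rewrite mulr_sumr -big_split; apply: eq_bigr => k _.
    rewrite mulr_sumr -big_split; apply: eq_bigr => l _.
    rewrite (pd2_gap x k l Eq) [RHS]addrC mulrCA -mulrDr //.
  have alg (r v s t : R[i]) : r * (v - s) - t = r * v - (r * s + t) by ring.
  exact: alg.
have /fin_all_exists[M hM] : forall x, exists Mx : R, 0 <= Mx /\ forall q, E q ->
  cmod (znorm2 q.2 * (vel g1 q x - vel g2 q x)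
   - \sum_k \sum_l ginv (g1 q.1) q.2 k l * pd (inr l) (pd (inl k) (F q.1 x)) q.2)
   <= Mx * jet q.
  by move=> x; have [Mx] := H x; exists Mx.
exists (\sum_x M x); first by apply: sumr_ge0 => x _; case: (hM x).
move=> q x Eq; have [_ h] := hM x; apply: le_trans (h q Eq) _.
apply: ler_wpM2r; first exact: jet_ge0.
by apply: le_term_sum => y; case: (hM y).
Qed.

(** Ellipticity in terms of the directions of the Gram decomposition: the
    entries of V are bounded by the inverse metric, and g V^* inverts V. *)
Lemma gram_ellipticity : exists2 M : R, 0 <= M & forall q, E q ->
  forall V : 'I_n -> 'I_n -> R[i],
  (forall k l, ginv (g1 q.1) q.2 k l = \sum_m V k m * (V l m)^*%C) ->
  forall x : 'I_n -> R[i],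
    \sum_j cmod (x j) <= M * \sum_m cmod (\sum_k V k m * x k).
Proof.
have [_ bg bi _ _] := b1.
have /fin_all_exists[A hA] : forall x : 'I_n * 'I_n, exists Ax : R, 0 <= Ax /\
    forall q, E q -> cmod (g1 q.1 q.2 x.1 x.2) <= Ax.
  by move=> x; have [Ax] := bg x.1 x.2; exists Ax.
have /fin_all_exists[B hB] : forall l : 'I_n, exists Bl : R, 0 <= Bl /\
    forall q, E q -> cmod (invmx (g1 q.1 q.2) l l) <= Bl.
  by move=> l; have [Bl] := bi l l; exists Bl.
pose M := \sum_j \sum_l A (j, l) * (1 + B l).
have M0 j : 0 <= \sum_l A (j, l) * (1 + B l).
  apply: sumr_ge0 => l _; have [a _] := hA (j, l); have [b _] := hB l.
  by apply: mulr_ge0 => //; exact: addr_ge0.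
exists M => [|q Eq V hV x]; first by apply: sumr_ge0 => j _.
have Vb l m : cmod (V l m) <= 1 + B l.
  have [b0 hb] := hB l; have h := hb q Eq.
  have : cmod (V l m) ^+ 2 <= B l.
    apply: le_trans h; rewrite -[invmx _ _ _]/(ginv (g1 q.1) q.2 l l) hV.
    rewrite (_ : \sum_m _ = (\sum_m nsq (V l m))%:C); last first.
      rewrite (big_morph _ (@realcD R) (erefl : (0 : R)%:C = 0)).
      by apply: eq_bigr => k _; rewrite nsqE.
    have -> (c : R) : cmod c%:C = `|c| by rewrite /= expr0n addr0 sqrtr_sqr.
    rewrite cmod_nsq; apply: le_trans (ler_norm _).
    by apply: (le_term_sum (f := fun m => nsq (V l m))) => k; exact: nsq_ge0.
  by have := cmod_ge0 (V l m); nra.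
rewrite /M mulr_suml; apply: ler_sum => j _.
pose y m := \sum_k V k m * x k.
have -> : x j = \sum_l \sum_m g1 q.1 q.2 j l * (V l m)^*%C * y m.
  have u := posdef_unit (Ep Eq).
  rewrite -(sum_delta' x j).
  under eq_bigr do rewrite -(ginv_low _ _ u) mulr_sumr.
  rewrite exchange_big; apply: eq_bigr => l _.
  rewrite /y; under [RHS]eq_bigr do rewrite mulr_sumr.
  rewrite [RHS]exchange_big; apply: eq_bigr => k _.
  rewrite hV !mulr_sumr; apply: eq_bigr => m _.
  by move: (x k) (g1 _ _ _ _) (V k m) (V l m)^*%C => *; ring.
apply: le_trans (cmod_sum _) _; rewrite mulr_suml; apply: ler_sum => l _.
apply: le_trans (cmod_sum _) _; rewrite mulr_sumr; apply: ler_sum => m _.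
rewrite !cmodM; apply: ler_wpM2r; first exact: cmod_ge0.
have [a0 ha] := hA (j, l).
by apply: ler_pM; rewrite ?cmod_ge0 // ?cmod_conj //; exact: ha.
Qed.

(** At a spatial maximum of the size of the difference. The maximum principle
    in each direction of the Gram decomposition bounds the second order part
    by - |V dF|^2, which absorbs all first derivatives by ellipticity. *)
Lemma gap_growth b : exists2 kappa : R, 0 <= kappa & forall q, E q ->
  (\forall p \near q.2, \sum_x nsq (F q.1 x p) <= \sum_x nsq (F q.1 x q.2)) ->
  (forall x, bidiff (F q.1 x) q.2) ->
  \sum_x Rep ((F q.1 x q.2)^*%C * (znorm2 q.2 *
    (hcf_algebraic b (chern_S (g1 q.1) q.2) (ginv (g1 q.1) q.2)
       (chern_torsion (g1 q.1) q.2) x.1 x.2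
     - hcf_algebraic b (chern_S (g2 q.1) q.2) (ginv (g2 q.1) q.2)
       (chern_torsion (g2 q.1) q.2) x.1 x.2)))
  <= kappa * \sum_x nsq (F q.1 x q.2).
Proof.
have [M M0 hM] := velocity_gap b; have [c c0' hc] := gram_ellipticity.
pose N1 : R := #|{: 'I_n * 'I_n}|%:R.
pose N2 : R := #|{: ('I_n * 'I_n) * 'I_n}|%:R + 1.
have N20 : 0 < N2 by rewrite ltr_wpDl // ler0n.
exists ((M + N2 * (M * c) ^+ 2) * N1).
  apply: mulr_ge0; last exact: ler0n.
  by apply: addr_ge0 => //; apply: mulr_ge0; [exact: ltW|exact: sqr_ge0].
move=> q Eq hmax bd; have pp := Epp Eq.
have [V hV] : exists V : 'I_n -> 'I_n -> R[i],
   forall k l, ginv (g1 q.1) q.2 k l = \sum_m V k m * (V l m)^*%C.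
  exact: posdef_gram (Ep Eq).
pose y x m := \sum_k V k m * pd (inl k) (F q.1 x) q.2.
pose H x := \sum_k \sum_l ginv (g1 q.1) q.2 k l * pd (inr l) (pd (inl k) (F q.1 x)) q.2.
have her : \forall p \near q.2, forall x, F q.1 (x.2, x.1) p = (F q.1 x p)^*%C.
  by have := near_punctured pp; apply: filterS => p ppp x; exact: scaled_gap_conj.
have ellip : \sum_x Rep ((F q.1 x q.2)^*%C * H x) <= - \sum_x \sum_m nsq (y x m).
  rewrite exchange_big -sumrN.
  have -> : \sum_x Rep ((F q.1 x q.2)^*%C * H x) = \sum_m \sum_x Rep ((F q.1 x q.2)^*%C *
     \sum_k \sum_l V k m * (V l m)^*%C * pd (inr l) (pd (inl k) (F q.1 x)) q.2).
    rewrite exchange_big; apply: eq_bigr => x _; rewrite -Re_sum -mulr_sumr; congr (Rep (_ * _)).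
    rewrite exchange_big; apply: eq_bigr => k _; rewrite exchange_big; apply: eq_bigr => l _.
    by rewrite hV mulr_suml.
  apply: ler_sum => m _.
  pose w : Cn R n := (\row_k Rep (V k m), \row_k Imp (V k m)).
  have zw : zc w = (fun k => V k m).
    by apply/funext => k; rewrite /zc !mxE; case: (V k m).
  by have := maximum_point w bd her hmax; rewrite zw.
pose vel g x := hcf_algebraic b (chern_S (g q.1) q.2) (ginv (g q.1) q.2)
       (chern_torsion (g q.1) q.2) x.1 x.2.
pose f x := cmod (F q.1 x q.2).
pose S := \sum_x f x; pose Y := \sum_x \sum_m cmod (y x m).
have jetE : jet q <= S + c * Y.
  rewrite /jet /S /Y mulr_sumr -big_split; apply: ler_sum => x _.
  by rewrite lerD2l; exact: (hc q Eq V hV (fun k => pd (inl k) (F q.1 x) q.2)).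
have split_velocity x : Rep ((F q.1 x q.2)^*%C * (znorm2 q.2 * (vel g1 x - vel g2 x)))
    <= Rep ((F q.1 x q.2)^*%C * H x) + f x * (M * jet q).
  have -> : (F q.1 x q.2)^*%C * (znorm2 q.2 * (vel g1 x - vel g2 x)) =
     (F q.1 x q.2)^*%C * H x
     + (F q.1 x q.2)^*%C * (znorm2 q.2 * (vel g1 x - vel g2 x) - H x).
    by rewrite -mulrDr [X in _ = _ * X]addrC subrK.
  rewrite raddfD lerD2l; apply: le_trans (cmod_Re _) _; rewrite cmodM cmod_conj.
  by apply: ler_wpM2l; [exact: cmod_ge0|exact: hM].
apply: le_trans (ler_sum _ (fun x _ => split_velocity x)) _.
rewrite big_split -mulr_suml -/S.
have S0 : 0 <= S by apply: sumr_ge0 => x _; exact: cmod_ge0.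
have hS : S ^+ 2 <= N1 * \sum_x nsq (F q.1 x q.2).
  apply: le_trans (sqr_sum_le _) _; rewrite /N1.
  by apply: ler_wpM2l; [exact: ler0n|apply: ler_sum => x _; rewrite cmod_nsq].
have hY : Y ^+ 2 <= N2 * \sum_x \sum_m nsq (y x m).
  rewrite /Y (pair_big xpredT xpredT (fun x m => cmod (y x m))).
  rewrite (pair_big xpredT xpredT (fun x m => nsq (y x m))).
  apply: le_trans (sqr_sum_le _) _; rewrite /N2 mulrDl mul1r.
  rewrite (eq_bigr _ (fun z _ => cmod_nsq (y z.1 z.2))).
  by rewrite lerDl; apply: sumr_ge0 => z _; exact: nsq_ge0.
apply: le_trans (lerD ellip (ler_wpM2l S0 (ler_wpM2l M0 jetE))) _.
by rewrite -mulrA; exact: peter_paul.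
Qed.

End DifferenceOfSolutions.

(** * A compact fundamental domain *)

Section FundamentalDomain.
Context {R : realType} {n : nat}.

Lemma expr_unbounded (q x : R) : 1 < q -> exists k : nat, x <= q ^+ k.
Proof.
move=> q1; have bern k : 1 + k%:R * (q - 1) <= q ^+ k.
  elim: k => [|k ih]; first by rewrite mul0r addr0 expr0.
  rewrite exprS -natr1; have k0 : 0 <= k%:R :> R by rewrite ler0n.
  have h1 : q * (1 + k%:R * (q - 1)) <= q * q ^+ k by rewrite ler_wpM2l // ltW // (lt_trans ltr01).
  have h2 := mulr_ge0 k0 (sqr_ge0 (q - 1)).
  by apply: le_trans h1; move: h2; rewrite expr2; lra.
have d0 : 0 < q - 1 by rewrite subr_gt0.
exists (Num.bound (x / (q - 1))); apply: le_trans (bern _).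
have [x0|x0] := leP x 0.
  by apply: le_trans x0 _; rewrite addr_ge0 // mulr_ge0 ?ler0n // ltW.
have h : 0 <= x / (q - 1) by rewrite divr_ge0 // ltW.
have := archi_boundP h; rewrite ltr_pdivrMr // => /ltW; lra.
Qed.

(** D multiplies |z|^2 by q and D' divides by it, so an orbit meets every
    annulus of ratio q. *)
Lemma annulus_orbit (q : R) (D D' : Cn R n -> Cn R n) (A : Type) (u : Cn R n -> A) p :
  1 < q ->
  (forall p, sqnorm (D p) = q * sqnorm p) -> (forall p, sqnorm (D' p) = q^-1 * sqnorm p) ->
  (forall p, punctured p -> punctured (D p) /\ u (D p) = u p) ->
  (forall p, punctured p -> punctured (D' p) /\ u (D' p) = u p) ->
  punctured p -> exists2 p', annulus 1 q p' & u p' = u p.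
Proof.
move=> q1 hD hD' dGmet dGmet' pp; have q0 : 0 < q by apply: lt_trans q1.
have s0 : 0 < sqnorm p.
  rewrite lt_neqAle eq_sym sqnorm_neq0 //=; apply: sumr_ge0 => i _.
  by rewrite -!expr2 addr_ge0 ?sqr_ge0.
have iD k : punctured (iter k D p) /\ u (iter k D p) = u p.
  by elim: k => //= k [h1 h2]; have [? e] := dGmet _ h1; rewrite e.
have iD' k : punctured (iter k D' p) /\ u (iter k D' p) = u p.
  by elim: k => //= k [h1 h2]; have [? e] := dGmet' _ h1; rewrite e.
have sD k : sqnorm (iter k D p) = q ^+ k * sqnorm p.
  by elim: k => [|k ih]; rewrite ?mul1r // iterS hD ih exprS mulrA.
have sD' k : sqnorm (iter k D' p) = q ^- k * sqnorm p.
  elim: k => [|k ih]; first by rewrite expr0 invr1 mul1r.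
  by rewrite iterS hD' ih exprS invfM mulrA.
(* the least number of steps that enters the annulus from inside,
   respectively from outside, does not leave it on the other side *)
have [sq|sq] := leP (sqnorm p) q.
  have ex : exists k, 1 <= q ^+ k * sqnorm p.
    have [k hk] := expr_unbounded (sqnorm p)^-1 q1; exists k.
    by rewrite -ler_pdivrMr // mul1r.
  exists (iter (ex_minn ex) D p); last by case: (iD (ex_minn ex)).
  case: ex_minnP => k hk mk; rewrite /annulus /= sD hk /=.
  case: k hk mk => [|k] hk mk; first by rewrite mul1r.
  have : q ^+ k * sqnorm p < 1 by rewrite ltNge; apply/negP => /mk; rewrite ltnn.
  by rewrite exprS -mulrA => /ltW h; rewrite -[leRHS]mulr1 ler_pM2l.
have ex : exists k, sqnorm p <= q * q ^+ k.
  have [k hk] := expr_unbounded (sqnorm p) q1; exists k.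
  by apply: le_trans hk _; rewrite ler_peMl ?exprn_ge0 // ltW.
exists (iter (ex_minn ex) D' p); last by case: (iD' (ex_minn ex)).
case: ex_minnP => k hk mk; rewrite /annulus /= sD'.
have qk j : 0 < q ^+ j by rewrite exprn_gt0.
rewrite mulrC ler_pdivrMr // hk andbT ler_pdivlMr // mul1r.
case: k hk mk => [|k] hk mk; first by rewrite expr0 (le_trans (ltW q1)) // ltW.
rewrite exprS leNgt; apply/negP => /ltW /mk; by rewrite ltnn.
Qed.

Lemma sqnorm_deck c (t : R) (p : Cn R n) : (forall i, c i * (c i)^*%C = (t ^+ 2)%:C) ->
  sqnorm (deck c p) = t ^+ 2 * sqnorm p.
Proof.
by move=> h; have := znorm2_deck p h; rewrite !znorm2_sqnorm -realcM => -[].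
Qed.

(** Invariant functions on C^n minus the origin take all their values on one
    compact annulus. If |a_i| < 1 the inverse of the deck transformation
    plays the role of the expansion. *)
Lemma fundamental_annulus (c : 'I_n -> R[i]) : hopf_parameter c -> exists c2 : R,
  forall (A : Type) (u : Cn R n -> A), (forall p, punctured p -> u (deck c p) = u p) ->
  forall p, punctured p -> exists2 p', annulus 1 c2 p' & u p' = u p.
Proof.
move=> hc; have [t [t0 t1] ct] := hopf_parameter_norm hc.
have c0 i : c i != 0.
  apply/eqP => ci; have := ct i; rewrite ci mul0r => /esym/eqP.
  by rewrite eq_complex /= eqxx andbT expf_eq0 /= gt_eqF.
pose d i := (c i)^-1.
have dt i : d i * (d i)^*%C = (t^-1 ^+ 2)%:C.
  by rewrite /d conjc_inv -invfM ct exprVn realcV.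
have cd p : deck c (deck d p) = p.
  rewrite [RHS]surjective_pairing; congr pair; apply/rowP => i; rewrite !mxE;
    by rewrite zc_deck mulVKf // /zc; case: (p).
have tn : t != 0 by rewrite gt_eqF.
have pc p : punctured p -> punctured (deck c p) by rewrite (deck_punctured p tn ct).
have pd' p : punctured p -> punctured (deck d p).
  by rewrite (deck_punctured p _ dt) ?invr_neq0.
have [lt1|gt1|e] := ltgtP t 1; last by rewrite e eqxx in t1.
  exists (t^-1 ^+ 2) => A u hu p pp; apply: (annulus_orbit (D := deck d) (D' := deck c)) => //.
  - by rewrite expr2 -invfM -expr2 invf_gt1 ?exprn_gt0 // expr_lt1 // ltW.
  - by move=> q; exact: sqnorm_deck.
  - by move=> q; rewrite exprVn invrK; exact: sqnorm_deck.
  - by move=> q pq; split; [exact: pd'|rewrite -[in RHS](cd q) hu //; exact: pd'].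
  - by move=> q pq; split; [exact: pc|exact: hu].
exists (t ^+ 2) => A u hu p pp; apply: (annulus_orbit (D := deck c) (D' := deck d)) => //.
- by rewrite expr_gt1 // ltW.
- by move=> q; exact: sqnorm_deck.
- by move=> q; rewrite -exprVn; exact: sqnorm_deck.
- by move=> q pq; split; [exact: pc|exact: hu].
- by move=> q pq; split; [exact: pd'|rewrite -[in RHS](cd q) hu //; exact: pd'].
Qed.

End FundamentalDomain.

Section LeftMaximum.
Context {R : realType}.

(** Only a one-sided comparison is available at the last instant of a time
    interval. *)
Lemma derive_ge0_left_max (f : R -> R) (t0 d : R) : 0 < t0 ->
  is_derive t0 (1 : R) f d -> (forall s, 0 < s <= t0 -> f s <= f t0) -> 0 <= d.
Proof.
move=> t00 [df dE] hmax; rewrite leNgt; apply/negP => d0.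
have c : (fun h : R => h^-1 *: ((f \o shift t0) (h *: 1) - f t0)) @ 0^' --> d.
  by rewrite -dE; exact: df.
have neg : \forall h \near (0 : R)^', h^-1 *: ((f \o shift t0) (h *: 1) - f t0) < 0.
  exact: (cvgr_lt _ c).
move: neg; rewrite near_withinE => /nbhs_normP[e /= e0 He].
(* the step to the left stays positive and within the radius e *)
pose s := Num.min e t0 / 2.
have m0 : 0 < Num.min e t0 by rewrite lt_min e0 t00.
have s0 : 0 < s by rewrite divr_gt0.
have sm : s < Num.min e t0 by rewrite /s; lra.
have se : s < e by apply: lt_le_trans sm _; rewrite ge_min lexx.
have st : s < t0 by apply: lt_le_trans sm _; rewrite ge_min lexx orbT.
have := He (- s); rewrite /= sub0r opprK gtr0_norm // oppr_eq0 gt_eqF // => /(_ se isT).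
apply/negP; rewrite -leNgt [_ *: 1]mulr1 invrN scaleNr -scalerN opprB.
apply: mulr_ge0; first by rewrite invr_ge0 ltW.
by rewrite subr_ge0 hmax //; apply/andP; split; lra.
Qed.

End LeftMaximum.

(** * Uniqueness of the flow *)

Section Uniqueness.
Context {R : realType} {n : nat}.
Implicit Types (t : R) (p : Cn R n).

(** The flow equation gives the value of the derivative; that it exists comes
    from smoothness in the interior. *)
Lemma solution_time_derivative a b g0 T (g : R -> Cn R n -> 'M[R[i]]_n) t p i j : hcf_solution a b g0 T g ->
  0 < t -> (t%:E < T)%E -> punctured p ->
  is_cderive (fun s => g s p i j) t 1
    (hcf_algebraic b (chern_S (g t) p) (ginv (g t) p) (chern_torsion (g t) p) i j).
Proof.
move=> [_ [_ hm sm eq]] t0 tT pp.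
have [G cG hG] := eq t t0 tT.
have rg := hopf_metric_regular (hm t (ltW t0) tT).
rewrite -(hcf_velocityE rg cG) // -hG //.
have [f' hf' _] := cCkS ((1, 0) : R * Cn R n) (smooth_cCk 1 (sm i j)).
suff h : is_cderive (fun s => g s p i j) t 1 (f' (t, p)) by rewrite (cderiveE h).
have [h1 h2] := hf' _ (flow_domain_interior t0 tT pp).
have slice (f : R * Cn R n -> R) d : is_derive (t, p) (1, 0) f d ->
    is_derive t (1 : R) (fun s => f (s, p)) d.
  move=> /is_derive_line h; apply/(is_derive_line (V := R)).
  suff -> : (fun h : R => f (h *: 1 + t, p)) =
    (fun h : R => f (h *: ((1, 0) : R * Cn R n) + (t, p))) by [].
  apply/funext => s; congr f; apply/eqP; rewrite xpair_eqE /= eqxx /=.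
  by rewrite scaler0 add0r.
by split; [exact: slice h1|exact: slice h2].
Qed.

(** The deck transformation multiplies the entries of a metric by numbers of
    modulus t^-2 and |z|^2 by t^2. *)
Lemma gap_deck (a : 'I_n -> R[i]) (g1 g2 : R -> Cn R n -> 'M[R[i]]_n) t p :
  hopf_parameter a -> hopf_metric a (g1 t) -> hopf_metric a (g2 t) -> punctured p ->
  \sum_x nsq (scaled_gap g1 g2 t x (deck a p)) = \sum_x nsq (scaled_gap g1 g2 t x p).
Proof.
move=> ha [_ _ h1] [_ _ h2] pp; have [s [s0 _] as2] := hopf_parameter_norm ha.
apply: eq_bigr => x _; rewrite /scaled_gap (znorm2_deck p as2).
have nM (y z : R[i]) : nsq (y * z) = nsq y * nsq z.
  by rewrite /nsq Re_mul Im_mul; ring.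
have -> : gap g1 g2 (t, p) x = gap g1 g2 (t, deck a p) x * a x.1 * (a x.2)^*%C.
  by rewrite /gap /= -h1 // -h2 // -mulrBl -mulrBl.
have na i : nsq (a i) = s ^+ 2 by have := nsqE (a i); rewrite as2 => -[].
have nr : nsq (s ^+ 2)%:C = s ^+ 2 * s ^+ 2 by rewrite /nsq /=; ring.
by rewrite !nM nsq_conj !na nr; ring.
Qed.

Lemma solution_bidiff a (g1 g2 : R -> Cn R n -> 'M[R[i]]_n) t p x :
  hopf_metric a (g1 t) -> hopf_metric a (g2 t) -> punctured p ->
  bidiff (scaled_gap g1 g2 t x) p.
Proof.
move=> [s1 _ _] [s2 _ _] pp; apply: bidiffM; first exact: bidiff_r.
apply: bidiffD; first exact: (C2_bidiff open_punctured pp (smooth_cCk 2 (s1 _ _))).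
apply: (@bidiff_near _ _ (fun q => -1 * g2 t q x.1 x.2)).
  by near=> q; rewrite mulN1r.
apply: bidiffM; first exact: bidiff_cst.
exact: (C2_bidiff open_punctured pp (smooth_cCk 2 (s2 _ _))).
Unshelve. all: by end_near. Qed.

Lemma is_derive_nsq_sum (F : 'I_n * 'I_n -> R -> R[i]) (D : 'I_n * 'I_n -> R[i]) t :
  (forall x, is_cderive (F x) t 1 (D x)) ->
  is_derive t (1 : R) (fun s => \sum_x nsq (F x s)) (2 * \sum_x Rep ((F x t)^*%C * D x)).
Proof.
move=> h; rewrite mulr_sumr.
have: forall s : seq ('I_n * 'I_n), is_derive t (1 : R) (fun z => \sum_(x <- s) nsq (F x z))
   (\sum_(x <- s) (2 * Rep ((F x t)^*%C * D x))); last exact.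
elim=> [|x s ih].
  by rewrite big_nil; under eq_fun do rewrite big_nil; exact: is_derive_cst.
rewrite big_cons; under eq_fun do rewrite big_cons; apply: is_deriveD.
have [h1 h2] := h x; rewrite /nsq; apply: is_derive_eq.
by rewrite Re_mul /GRing.scale; case: (F x t) => y z /=; ring.
Qed.

(** Otherwise exp(- lam t) u has a positive maximum over the times up to t1
    and the annulus, at a positive time since the initial metrics agree. It
    is a maximum over all of space by invariance, so there u' <= 2 kap u, and
    lam = 2 kap + 1 makes the time derivative negative. *)
Theorem hcf_unique a b g0 T1 T2 (g1 g2 : R -> Cn R n -> 'M[R[i]]_n) : hopf_parameter a ->
  hcf_solution a b g0 T1 g1 -> hcf_solution a b g0 T2 g2 ->
  forall t p, 0 <= t -> (t%:E < T1)%E -> (t%:E < T2)%E -> punctured p -> g1 t p = g2 t p.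
Proof.
move=> ha sol1 sol2 t1 p1 t10 tT1 tT2 pp1.
pose u t p := \sum_x nsq (scaled_gap g1 g2 t x p).
have [_ [i1 hm1 sm1 _]] := sol1; have [_ [i2 hm2 sm2 _]] := sol2.
have u0 t p : 0 <= u t p by apply: sumr_ge0 => x _; exact: nsq_ge0.
suff : u t1 p1 = 0.
  move=> /eqP; rewrite psumr_eq0; last by move=> x _; exact: nsq_ge0.
  move=> /allP h; apply/matrixP => i j.
  have := h (i, j) (mem_index_enum _); rewrite /= -cmod_nsq expf_eq0 /=.
  move=> /eqP/ComplexField.Normc.eq0_normc/eqP.
  by rewrite mulf_eq0 (negbTE (punctured_r pp1)) /= subr_eq0 => /eqP.
have tTle t : t <= t1 -> (t%:E < T1)%E /\ (t%:E < T2)%E.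
  by move=> le; split; [apply: le_lt_trans tT1|apply: le_lt_trans tT2]; rewrite lee_fin.
have udeck t p : 0 <= t -> t <= t1 -> punctured p -> u t (deck a p) = u t p.
  by move=> t0 /tTle[l1 l2] pp; apply: (gap_deck ha) => //; [exact: hm1|exact: hm2].
have [c2 fund] := fundamental_annulus ha.
pose K : set (Cn R n) := annulus 1 c2.
have cK : compact K by exact: annulus_compact.
have Kp : K `<=` punctured by exact: annulus_punctured.
pose E : set (R * Cn R n) := [set q | 0 < q.1 <= t1 /\ K q.2].
have bg1 := solution_bounded_geometry sol1 tT1 Kp cK.
have bg2 := solution_bounded_geometry sol2 tT2 Kp cK.
have Ereg q : E q -> regular_metric (g1 q.1) /\ regular_metric (g2 q.1).
  move=> [/andP[/ltW q0 /tTle[l1 l2]] _].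
  by split; [exact: hopf_metric_regular (hm1 _ q0 l1)|exact: hopf_metric_regular (hm2 _ q0 l2)].
have Epos q : E q -> hermitian_posdef (g1 q.1 q.2).
  by move=> [/andP[/ltW q0 /tTle[l1 _]] /Kp pq]; have [_ h _] := hm1 _ q0 l1; exact: h.
have [kap kap0 growth] := gap_growth bg1 bg2 Ereg Epos ltr01 (fun q Eq => Eq.2) b.
(* any rate above 2 kap; the factor 2 comes from differentiating a sum of
   squares *)
pose lam := 2 * kap + 1.
pose v (q : R * Cn R n) := expR (- lam * q.1) * u q.1 q.2.
have cF x : ccont (slab t1 K) (fun q => scaled_gap g1 g2 q.1 x q.2).
  have cr : ccont (slab t1 K) (fun q : R * Cn R n => znorm2 q.2).
    under eq_fun do rewrite znorm2_sqnorm; split; last by move=> q; exact: cst_continuous.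
    apply: continuous_subspaceT => q.
    by apply: (continuous_comp (f := snd)); [exact: cvg_snd|exact: sqnorm_continuous].
  apply: ccontM => //.
  have c1 := cCk_ccont (slab_domain Kp tT1) (smooth_cCk 0 (sm1 x.1 x.2)).
  have c2' := cCk_ccont (slab_domain Kp tT2) (smooth_cCk 0 (sm2 x.1 x.2)).
  have := ccontD c1 (ccontM (ccont_cst _ (-1)) c2').
  by under eq_fun do rewrite mulN1r.
have cv : {within slab t1 K, continuous v}.
  apply: withinM.
    apply: continuous_subspaceT => q.
    apply: (continuous_comp (f := fun q : R * Cn R n => - lam * q.1) (g := expR)).
      by apply: continuousM; [exact: cst_continuous|exact: cvg_fst].
    exact: continuous_expR.
  have: forall s : seq ('I_n * 'I_n), {within slab t1 K, continuous
     (fun q => \sum_(x <- s) nsq (scaled_gap g1 g2 q.1 x q.2))}; last exact.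
  elim=> [|x s ih].
    by under eq_fun do rewrite big_nil; move=> q; exact: cst_continuous.
  under eq_fun do rewrite big_cons; apply: withinD ih.
  exact: ccont_nsq.
have [p2 Kp2 up2] := fund _ (u t1) (fun p pp => udeck t1 p t10 (lexx t1) pp) p1 pp1.
rewrite -up2; have [//|un0] := eqVneq (u t1 p2) 0.
have S2 : slab t1 K (t1, p2) by split=> //=; rewrite t10 lexx.
have [q0 /[1!inE] Sq0 qmax] := compact_EVT_max (ex_intro _ _ S2) (slab_compact cK) cv.
have vq0 : 0 < v q0.
  have : v (t1, p2) <= v q0 by apply: qmax; rewrite inE.
  by apply: lt_le_trans; rewrite mulr_gt0 ?expR_gt0 // lt_neqAle eq_sym un0 /=.
move: Sq0 qmax vq0; case: q0 => t0 p0 [/= /andP[t00 t01] Kp0] qmax vq0.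
have pp0 := Kp _ Kp0.
have uq0 : 0 < u t0 p0 by move: vq0; rewrite /v pmulr_rgt0 ?expR_gt0.
have {}t00 : 0 < t0.
  rewrite lt_neqAle t00 andbT eq_sym; apply/eqP => e; move: uq0; rewrite /u e big1 ?ltxx //.
  move=> x _; rewrite /scaled_gap /gap /= i1 // i2 // subrr mulr0.
  by rewrite /nsq /= mulr0 addr0.
have Eq0 : E (t0, p0) by split=> //=; rewrite t00.
have [l1 l2] := tTle t0 t01.
have space_max p : punctured p -> u t0 p <= u t0 p0.
  move=> pp; have [p' Kp' <-] := fund _ (u t0) (fun p => udeck t0 p (ltW t00) t01) p pp.
  have : v (t0, p') <= v (t0, p0).
    by apply: qmax; rewrite inE; split=> //=; rewrite t01 ltW.
  by rewrite /v /= ler_pM2l ?expR_gt0.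
pose vel (g : R -> Cn R n -> 'M[R[i]]_n) x := hcf_algebraic b (chern_S (g t0) p0)
  (ginv (g t0) p0) (chern_torsion (g t0) p0) x.1 x.2.
pose D (x : 'I_n * 'I_n) := znorm2 p0 * (vel g1 x - vel g2 x).
have nmax : \forall p \near p0, u t0 p <= u t0 p0.
  by have := near_punctured pp0; apply: filterS => p; exact: space_max.
have bd x : bidiff (scaled_gap g1 g2 t0 x) p0.
  by apply: (solution_bidiff _ (hm1 _ _ l1) (hm2 _ _ l2) pp0); exact: ltW.
have hD : \sum_x Rep ((scaled_gap g1 g2 t0 x p0)^*%C * D x) <= kap * u t0 p0.
  exact: growth (t0, p0) Eq0 nmax bd.
have dF x : is_cderive (fun s => scaled_gap g1 g2 s x p0) t0 1 (D x).
  have h1 := solution_time_derivative x.1 x.2 sol1 t00 l1 pp0.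
  have h2 := solution_time_derivative x.1 x.2 sol2 t00 l2 pp0.
  have := is_cderiveM (is_cderive_cst (znorm2 p0) t0 1) (is_cderiveD h1 (is_cderiveN h2)).
  by rewrite mul0r add0r.
have du := is_derive_nsq_sum dF.
have de : is_derive t0 (1 : R) (fun s => expR (- lam * s)) (- lam * expR (- lam * t0)).
  have := is_derive1_comp (is_derive_expR (- lam * t0))
    (is_derive1_scale (- lam) (is_derive_id t0 (1 : R))).
  by rewrite mulr1 mulrC.
have dv := is_deriveM de du.
have left_max s : 0 < s <= t0 -> v (s, p0) <= v (t0, p0).
  move=> /andP[s0 st]; apply: qmax; rewrite inE; split=> //=.
  by rewrite ltW //= (le_trans st).
have := derive_ge0_left_max t00 dv left_max; rewrite /GRing.scale /= leNgt.
case/negP; rewrite -/(u t0 p0); move: hD; set Y := \sum_x _ => hD.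
have e0 := expR_gt0 (- lam * t0); move: e0; set e := expR _ => e0.
have -> : e * (2 * Y) + u t0 p0 * (- lam * e) = e * (2 * (Y - kap * u t0 p0) - u t0 p0).
  by rewrite /lam; ring.
by rewrite pmulr_rlt0 //; lra.
Qed.

End Uniqueness.

(** * Solutions within the family g(alpha, beta) *)

Section InvariantSolutions.
Context {R : realType} {n : nat}.
Implicit Types (t x : R) (p : Cn R n).

(** The velocity of the flow on this family, normalized to al' = - n + B y
    and (al + be)' = - A y^2. *)
Definition gab_flow_coefficients (b : R * R * R * R) (A B : R) :=
  let: (b1, b2, b3, b4) := b in forall y : R,
  - (n%:R - y) + b1 * y + 2 * b2 * y + b4 * (n%:R - 1) * y = - n%:R + B * y /\
  - (n%:R - 1) * y ^+ 2 + b1 * (n%:R - 1) * y ^+ 2 + b3 * (n%:R - 1) ^+ 2 * y ^+ 2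
    = - A * y ^+ 2.

Lemma is_derive_gab_entry (al be : R -> R) (da db t : R) p i j :
  is_derive t (1 : R) al da -> is_derive t (1 : R) be db -> punctured p ->
  is_cderive (fun s => gab (al s) (be s) p i j) t 1
   (da%:C / znorm2 p * (i == j)%:R + db%:C / znorm2 p ^+ 2 * ((zc p i)^*%C * zc p j)).
Proof.
move=> ha hb pp; under eq_fun do rewrite gab_entryE.
have real (f : R -> R) d : is_derive t (1 : R) f d -> is_cderive (fun s => (f s)%:C) t 1 d%:C.
  by move=> h; split=> //=; exact: is_derive_cst.
have hX (c : R[i]) := is_cderive_cst c t 1.
have := is_cderiveD (is_cderiveM (real _ _ ha) (hX ((i == j)%:R * (rho p)%:C)))
  (is_cderiveM (real _ _ hb) (hX (((zc p i)^*%C * zc p j) * ((rho p)%:C * (rho p)%:C)))).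
rewrite !mulr0 !addr0; congr (is_cderive _ _ _ _).
rewrite /rho !realcV -znorm2_sqnorm expr2 invfM.
by move: (_^-1) (zc p i)^*%C (zc p j) ((i == j)%:R) => u v w d; ring.
Qed.

(** One family of matrices g solves the flow for 0 <= t < th x1, whatever x1
    is, so its lifetime need not be known. *)
Lemma gab_solutions (a : 'I_n -> R[i]) b A B (al0 be0 : R) :
  hopf_parameter a -> (0 < n)%N -> gab_flow_coefficients b A B -> 0 < A + B ->
  0 < al0 -> 0 < al0 + be0 ->
  let y x := flow_y n%:R A B ((al0 + be0) / al0) x in
  let al x := flow_al n%:R A B al0 ((al0 + be0) / al0) x in
  exists th : R -> R,
  [/\ th 0 = 0, forall x x', 0 <= x -> x < x' -> th x < th x',
      forall x, 0 <= x -> {for x, continuous th} &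
  exists g : R -> Cn R n -> 'M[R[i]]_n,
    (forall x1, 0 < x1 -> hcf_solution a b (gab al0 be0) (th x1)%:E g) /\
    forall x, 0 <= x -> g (th x) = gab (al x) (y x * al x - al x)].
Proof.
move=> ha n0 hb K0 al00 sl00 y al.
have N0 : 0 < n%:R :> R by rewrite ltr0n.
have y00 : 0 < (al0 + be0) / al0 by rewrite divr_gt0.
have [th [th0 inc cth [fa [fs H]]]] := homogeneous_system_solution N0 K0 al00 y00.
exists th; split=> //; exists (fun t => gab (fa t) (fs t - fa t)).
split; last first.
  move=> x x0; have [J _ [_ _ _ e]] := H 1 ltr01.
  by have [-> ->] := e x x0.
move=> x1 x10; have [J hJ [pos da ds e]] := H x1 x10.
have thx1 : 0 < th x1 by rewrite -th0 inc.
have posJ t : J t -> 0 < fa t /\ 0 < fa t + (fs t - fa t).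
  by move=> /pos[p1 p2]; rewrite addrC subrK.
have Je t : 0 <= t -> (t%:E < (th x1)%:E)%E -> J t.
  by rewrite lte_fin; exact: hJ.
split; first by rewrite lte_fin.
have hg t p : punctured p -> gab (fa t) (fs t - fa t) p = gab (fa t) (fs t - fa t) p by [].
split.
- move=> p _; have [] := e 0 (lexx 0).
  rewrite th0 flow_al0 // flow_y0 // => -> ->; congr (gab _ _ p).
  by rewrite divfK ?gt_eqF // addrC addKr.
- move=> t t0 tx; have [p1 p2] := posJ t (Je t t0 tx); split.
  + by move=> i j; exact: gab_smooth.
  + by move=> p pp; exact: (gab_posdef p1 p2 (hg t) pp).
  + by move=> p i j pp; exact: (gab_deck (hg t)).
- move=> i j; pose ia t := (fa t)^-1.
  pose TA : set (R -> R) := [set f | [\/ f = fa, f = fs | f = ia]].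
  have sa : sm TA fa by apply: sm_atom; constructor 1.
  have ss : sm TA fs by apply: sm_atom; constructor 2.
  have si : sm TA ia by apply: sm_atom; constructor 3.
  have dirR (f : R -> R) t v d : is_derive t (1 : R) f d -> is_derive t v f (v * d).
    by move=> h; rewrite -{1}[v]mulr1; exact: is_derive_dirZ.
  have sda : sm TA (fun t => - n%:R + B * (fs t * ia t)).
    by apply: sm_add; [exact: sm_cst|apply: sm_mul; [exact: sm_cst|exact: sm_mul]].
  have tder f v : TA f -> exists2 f', sm TA f' & forall t, J t -> is_derive t v f (f' t).
    case=> ->.
    + exists (fun t => v * (- n%:R + B * (fs t * ia t))).
        by apply: sm_mul => //; exact: sm_cst.
      by move=> t Jt; apply: dirR; exact: da.
    + exists (fun t => v * (- A * ((fs t * ia t) * (fs t * ia t)))).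
        apply: sm_mul; first exact: sm_cst; apply: sm_mul; first exact: sm_cst.
        by apply: sm_mul; exact: sm_mul.
      by move=> t Jt; apply: dirR; rewrite -expr2; exact: ds.
    + exists (fun t => v * (- (ia t * ia t * (- n%:R + B * (fs t * ia t))))).
        apply: sm_mul; first exact: sm_cst; apply: sm_opp; apply: sm_mul => //.
        exact: sm_mul.
      move=> t Jt; apply: dirR; have [p1 _] := pos t Jt.
      have h : is_derive t (1 : R) ia (- fa t ^- 2 *: (- n%:R + B * (fs t / fa t))).
        by apply: (is_deriveV _ (da t Jt)); rewrite gt_eqF.
      by apply: (is_derive_eq h); rewrite /ia /GRing.scale /= -exprVn expr2 mulNr.
  have tcont f t : TA f -> J t -> {for t, continuous f}.
    by move=> Tf Jt; have [d] : exists d, is_derive t (1 : R) f d;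
      [have [f' _ h] := tder f 1 Tf; exists (f' t); exact: h|exact: is_derive1_continuous].
  have sb : sm TA (fun t => fs t - fa t) by apply: sm_add => //; exact: sm_opp.
  apply: (gab_time_smooth tcont tder i j sa sb).
  by move=> q [q0 q1 pq]; split=> //; exact: Je.
- move=> t t0 tx; have Jt := Je t (ltW t0) tx; have [p1 p2] := posJ t Jt.
  have rg := gab_regular p1 p2 (hg t).
  exists (real_connection (chern_gamma (gab (fa t) (fs t - fa t))) (fun _ _ _ _ => 0)).
    exact: chern_exists.
  move=> p i j pp; rewrite (hcf_velocityE rg (chern_exists rg)) //.
  rewrite (gab_hcf_velocity p1 p2 (hg t)) //.
  rewrite (cderiveE (is_derive_gab_entry i j (da t Jt) (is_deriveB (ds t Jt) (da t Jt)) pp)).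
  move: hb; case: b => [[[b1 b2] b3] b4] /= /(_ (fs t / fa t))[hu hv].
  by rewrite (addrC (fa t)) subrK hu hv.
Qed.

(** The largest y = (al + be) / al that is compatible with non-negativity. *)
Definition critical_ratio : R := if n == 2%N then 1 else 2^-1.

Lemma BG_condition_ratio (al y : R) : 0 < al ->
  @BG_condition R n al (y * al - al) = (y <= critical_ratio).
Proof.
move=> al0; rewrite /BG_condition /critical_ratio; case: eqP => _.
  by rewrite subr_le0 -[X in _ <= X]mul1r ler_pM2r.
have -> : al + 2 * (y * al - al) = 2 * al * (y - 2^-1) by field.
by rewrite pmulr_rle0 ?subr_le0 // mulr_gt0.
Qed.

(** The logistic curve stays between its initial value and its limit N / (A +
    B). *)
Lemma flow_y_bounded (N A B y0 yc x : R) : 0 < N -> 0 < A + B -> 0 < y0 -> y0 <= yc ->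
  N <= yc * (A + B) -> 0 <= x -> flow_y N A B y0 x <= yc.
Proof.
move=> N0 K0 y00 y0c Nc x0.
have E1 : 1 <= expR (N * x) by rewrite -expR0 ler_expR mulr_ge0 // ltW.
have D0 : 0 < flow_den N A B y0 x.
  rewrite /flow_den; apply: ltr_wpDr => //; apply: mulr_ge0; last by rewrite subr_ge0.
  by rewrite mulr_ge0 // ltW.
rewrite /flow_y ler_pdivrMr // /flow_den; move: E1; set E := expR _ => E1.
rewrite -subr_ge0.
have -> : yc * (N + (A + B) * y0 * (E - 1)) - N * y0 * E =
  N * (yc - y0) + y0 * (E - 1) * (yc * (A + B) - N) by ring.
by apply: addr_ge0; repeat (apply: mulr_ge0 || rewrite subr_ge0 || exact: ltW || done).
Qed.

(** The logistic curve comes arbitrarily close to its limit N / (A + B). *)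
Lemma flow_y_exceeds (N A B y0 yc : R) : 0 < N -> 0 < A + B -> 0 < y0 -> 0 < yc ->
  yc * (A + B) < N -> exists2 x, 0 < x & yc < flow_y N A B y0 x.
Proof.
move=> N0 K0 y00 yc0 Nc.
pose d := N - yc * (A + B); have d0 : 0 < d by rewrite subr_gt0.
(* with exp (N x) >= N x this x makes d y0 exp (N x) >= N yc *)
pose x := yc / (d * y0); have x0 : 0 < x by rewrite divr_gt0 // mulr_gt0.
exists x => //.
have E1 : 1 + N * x <= expR (N * x) by exact: expR_ge1Dx.
have Nx : 0 < N * x by exact: mulr_gt0.
have D0 : 0 < flow_den N A B y0 x.
  rewrite /flow_den; apply: ltr_wpDr => //; apply: mulr_ge0; first by rewrite mulr_ge0 // ltW.
  by rewrite subr_ge0; lra.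
rewrite /flow_y ltr_pdivlMr // /flow_den; move: E1; set E := expR _ => E1.
have h : d * y0 * (1 + N * x) <= d * y0 * E by rewrite ler_pM2l // mulr_gt0.
have e : d * y0 * (1 + N * x) = d * y0 + N * yc.
  by rewrite /x; field; rewrite !gt_eqF.
have dy : 0 < d * y0 by exact: mulr_gt0.
have ky : 0 < yc * ((A + B) * y0) by rewrite !mulr_gt0.
rewrite -subr_gt0.
have -> : N * y0 * E - yc * (N + (A + B) * y0 * (E - 1)) =
   d * y0 * E - yc * N + yc * ((A + B) * y0) by rewrite /d; ring.
by move: h dy ky; rewrite e; lra.
Qed.

(** The exponent of al is at most - (1 - B / (A + B)) N x up to a constant,
    and A > 0 makes it tend to - oo. *)
Lemma flow_al_vanishes (N A B al0 y0 m : R) : 0 < N -> 0 < A -> 0 <= B -> 0 < al0 -> 0 < y0 ->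
  0 < m -> exists2 x, 0 < x & flow_al N A B al0 y0 x < m.
Proof.
move=> N0 A0 B0 al00 y00 m0; have K0 : 0 < A + B by exact: ltr_wpDr.
pose th := B / (A + B); have th0 : 0 <= th by rewrite divr_ge0 // ltW.
have th1 : 0 < 1 - th.
  by rewrite /th (_ : 1 - _ = A / (A + B)) ?divr_gt0 //; field; rewrite gt_eqF.
pose c := (A + B) * y0 / N; have c0 : 0 < c by rewrite divr_gt0 // mulr_gt0.
pose M := al0 * expR (th * ln (1 + c)).
have M0 : 0 < M by rewrite mulr_gt0 // expR_gt0.
(* chosen so that the exponent is - M / m, and exp (M / m) > M / m *)
pose x := M / m / ((1 - th) * N); have x0 : 0 < x by rewrite !divr_gt0 // mulr_gt0.
exists x => //.
have E1 : 1 + N * x <= expR (N * x) by exact: expR_ge1Dx.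
have Nx : 0 < N * x by exact: mulr_gt0.
have DN : flow_den N A B y0 x / N = 1 + c * (expR (N * x) - 1).
  by rewrite /flow_den /c; field; rewrite gt_eqF.
have c1 : 0 < 1 + c by rewrite addr_gt0.
have D1 : 0 < 1 + c * (expR (N * x) - 1).
  by apply: ltr_wpDr => //; apply: mulr_ge0; [exact: ltW|rewrite subr_ge0; lra].
have lnD : ln (flow_den N A B y0 x / N) <= ln (1 + c) + N * x.
  rewrite DN -{2}[N * x]expRK -lnM ?posrE ?expR_gt0 // ler_ln ?posrE ?mulr_gt0 ?expR_gt0 //.
  by move: E1; set E := expR _ => E1; nra.
have h1 : flow_al N A B al0 y0 x <= M * expR (- ((1 - th) * N * x)).
  rewrite /flow_al /M -[X in _ <= X]mulrA; apply: ler_wpM2l; first exact: ltW.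
  rewrite -expRD ler_expR -/th.
  have : th * ln (flow_den N A B y0 x / N) <= th * (ln (1 + c) + N * x) by exact: ler_wpM2l.
  by move: (ln (1 + c)) => L; lra.
apply: le_lt_trans h1 _.
have ez : (1 - th) * N * x = M / m by rewrite /x; field; rewrite !gt_eqF.
rewrite ez expRN -/(M / expR (M / m)) ltr_pdivrMr ?expR_gt0 //.
have h2 : 1 + M / m <= expR (M / m) by exact: expR_ge1Dx.
apply: lt_le_trans (_ : m * (1 + M / m) <= _); last by rewrite ler_pM2l.
by rewrite mulrDr mulr1 mulrCA mulfV ?gt_eqF // mulr1 ltrDr.
Qed.

End InvariantSolutions.

(** * Preservation of non-negativity *)

(** The form evaluated on a basis vector. *)
Lemma posdef_diagonal {R : realType} {n : nat} (h : 'M[R[i]]_n) k :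
  hermitian_posdef h -> 0 < h k k.
Proof.
move=> [_ pos]; have : exists i, ((i == k)%:R : R[i]) != 0 by exists k; rewrite eqxx oner_eq0.
move=> /pos; congr (0 < _).
rewrite (eq_bigr (fun i => h i k * (i == k)%:R)); first by rewrite (sum_delta (fun i => h i k)).
move=> i _; rewrite (eq_bigr (fun j => h i j * (i == k)%:R * (j == k)%:R)).
  by rewrite (sum_delta (fun j => h i j * (i == k)%:R)).
by move=> j _; rewrite conjc_nat.
Qed.

Section InvariantFlows.
Context {R : realType} {n : nat}.
Variables (a : 'I_n -> R[i]) (al0 be0 : R).
Hypothesis (n2 : (2 <= n)%N) (ha : hopf_parameter a) (al00 : 0 < al0) (sl00 : 0 < al0 + be0).
Hypothesis hg0 : BG_nonneg (gab (n := n) al0 be0).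

Let n0 : (0 < n)%N. Proof. exact: ltn_trans n2. Qed.
Let N0 : 0 < n%:R :> R. Proof. by rewrite ltr0n. Qed.
Let y0 := (al0 + be0) / al0.
Let y00 : 0 < y0. Proof. exact: divr_gt0. Qed.

Let y0_le : y0 <= critical_ratio (R := R) (n := n).
Proof.
have := BG_condition_necessary al00 sl00 (fun p _ => erefl) n2 hg0.
have -> : be0 = y0 * al0 - al0 by rewrite /y0 divfK ?gt_eqF // addrC addKr.
by rewrite BG_condition_ratio.
Qed.

Let critical_gt0 : 0 < critical_ratio (R := R) (n := n).
Proof. by rewrite /critical_ratio; case: eqP => _; rewrite ?invr_gt0. Qed.

(** The explicit solution passes the critical ratio while it exists. *)
Lemma gab_flow_not_preserves b A B : gab_flow_coefficients (n := n) b A B -> 0 < A + B ->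
  critical_ratio (R := R) (n := n) * (A + B) < n%:R ->
  ~ preserves_BG_nonneg a b (gab al0 be0).
Proof.
move=> hb K0 hc pres.
have [th [th0 inc _ [g [sol gE]]]] := gab_solutions ha n0 hb K0 al00 sl00.
have [x x0 yx] := flow_y_exceeds N0 K0 y00 critical_gt0 hc.
have lx : (0 : R) <= th x by rewrite -th0 ltW // inc.
have x1 : 0 < x + 1 by rewrite addr_gt0.
have lt1 : ((th x)%:E < (th (x + 1))%:E)%E by rewrite lte_fin inc ?ltrDl // ltW.
have := pres _ _ (sol _ x1) _ lx lt1; rewrite gE; last exact: ltW.
set al := flow_al _ _ _ _ _ _; set y := flow_y _ _ _ _ _.
have alp : 0 < al by exact: flow_al_gt0.
have yp : 0 < y by apply: lt_trans critical_gt0 yx.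
have slp : 0 < al + (y * al - al) by rewrite addrC subrK mulr_gt0.
move=> /(BG_condition_necessary alp slp (fun p _ => erefl) n2).
by rewrite BG_condition_ratio // leNgt yx.
Qed.

(** At times reached by the explicit solution uniqueness identifies the two.
    A later time t is impossible: at the point e_0 the entry of index (1, 1)
    of the given solution, bounded below by positivity up to time t, would
    equal the vanishing al. *)
Lemma gab_flow_preserves b A B : gab_flow_coefficients (n := n) b A B -> 0 < A -> 0 <= B ->
  n%:R <= critical_ratio (R := R) (n := n) * (A + B) ->
  (exists T g, hcf_solution a b (gab al0 be0) T g) /\
  preserves_BG_nonneg a b (gab al0 be0).
Proof.
move=> hb A0 B0 hc; have K0 : 0 < A + B by exact: ltr_wpDr.
have [th [th0 inc cth [g [sol gE]]]] := gab_solutions ha n0 hb K0 al00 sl00.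
split; first by exists (th 1)%:E, g; exact: sol.
move=> T g' sol' t t0 tT.
have agree s x1 p : 0 < x1 -> 0 <= s -> s < th x1 -> (s%:E < T)%E -> punctured p ->
    g' s p = g s p.
  move=> x10 s0 sx sT pp; apply: (hcf_unique ha sol' (sol _ x10)) => //.
have [[x1 x10 tx1]|never] := pselect (exists2 x1, 0 < x1 & t < th x1).
  have [x /andP[x0 _] xt] : exists2 x, 0 <= x <= x1 & th x = t.
    have [||x] := @IVT R th 0 x1 t (ltW x10).
    - apply: continuous_in_subspaceT => z; rewrite inE /= in_itv /= => /andP[z0 _].
      exact: cth.
    - rewrite th0; apply/andP; split; first by rewrite ge_min t0.
      by rewrite le_max (ltW tx1) orbT.
    - by rewrite in_itv /= => xi e; exists x.
  have hg p : punctured p -> g' t p = gab (flow_al n%:R A B al0 y0 x)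
     (flow_y n%:R A B y0 x * flow_al n%:R A B al0 y0 x - flow_al n%:R A B al0 y0 x) p.
    by move=> pp; rewrite (agree t x1) // -xt gE.
  have alp : 0 < flow_al n%:R A B al0 y0 x by exact: flow_al_gt0.
  have yp : 0 < flow_y n%:R A B y0 x.
    by apply: flow_y_gt0 => //; apply: lt_le_trans x0; exact: lo_lt0.
  apply: (BG_condition_sufficient alp _ hg n2).
    by rewrite addrC subrK mulr_gt0.
  by rewrite BG_condition_ratio //; exact: flow_y_bounded.
have thle x : 0 < x -> th x <= t.
  by move=> x0; rewrite leNgt; apply/negP => tx; apply: never; exists x.
exfalso; have [_ [_ hm sm _]] := sol'.
pose i0 := Ordinal n0; pose i1 := Ordinal n2.
pose e : Cn R n := (delta_mx 0 i0, 0).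
have ze i : zc e i = (i == i0)%:R.
  by rewrite /zc !mxE /= eq_sym; case: eqP.
have pe : punctured e.
  rewrite /punctured /= -znorm2_eq0; apply/eqP => /eqP; rewrite psumr_eq0.
    by move=> /allP/(_ i0 (mem_index_enum _)); rewrite /= ze eqxx normr1 expr1n oner_eq0.
  by move=> i _; rewrite exprn_ge0.
have Ke : [set e] `<=` punctured by move=> _ ->.
have cS : compact (slab t [set e]) by apply: slab_compact; exact: compact_set1.
have [cRe _] := cCk_ccont (slab_domain Ke tT) (smooth_cCk 0 (sm i1 i1)).
have pos q : slab t [set e] q -> 0 < Rep (g' q.1 q.2 i1 i1).
  move=> [/andP[q0 qt] qe]; rewrite qe.
  have qT : (q.1%:E < T)%E by apply: le_lt_trans tT; rewrite lee_fin.
  have [_ /(_ e pe) pd _] := hm q.1 q0 qT.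
  by have := posdef_diagonal i1 pd; rewrite ltcE => /andP[].
have [m m0 hmin] := compact_bounded_below cS cRe pos.
have [x x0 xm] := flow_al_vanishes N0 A0 B0 al00 y00 m0.
have thx0 : 0 <= th x by rewrite -th0 ltW // inc.
have x1 : 0 < x + 1 by rewrite addr_gt0.
have := hmin (th x, e); rewrite /= (agree (th x) (x + 1)) //; first last.
- by apply: le_lt_trans tT; rewrite lee_fin thle.
- by rewrite inc ?ltrDl // ltW.
rewrite gE; last exact: ltW.
have -> : gab (flow_al n%:R A B al0 ((al0 + be0) / al0) x)
   (flow_y n%:R A B ((al0 + be0) / al0) x * flow_al n%:R A B al0 ((al0 + be0) / al0) x
    - flow_al n%:R A B al0 ((al0 + be0) / al0) x) e i1 i1 =
   (flow_al n%:R A B al0 y0 x)%:C.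
  rewrite mxE !ze eqxx conjc0 mul0r mulr0 mul0r addr0.
  have -> : znorm2 e = 1.
    rewrite /znorm2 (bigD1 i0) //= big1 => [|i /negbTE ii]; rewrite ze ?ii ?eqxx.
      by rewrite normr1 expr1n addr0.
    by rewrite normr0 expr0n.
  by rewrite divr1 mulr1.
have S : slab t [set e] (th x, e) by split=> //=; rewrite thx0 thle.
by move=> /(_ S) /=; rewrite leNgt xm.
Qed.

End InvariantFlows.

Section Coefficients.
Context {R : realType} {n : nat}.

Lemma gradient_flow_coefficients :
  gab_flow_coefficients (n := n) (gradient_flow R) (n%:R * (n%:R - 1) / 2) n%:R.
Proof. by move=> y; split; field. Qed.

Lemma ustinovskiy_flow_coefficients :
  gab_flow_coefficients (n := n) (ustinovskiy_flow R) (n%:R - 1) 0.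
Proof. by move=> y; split; field. Qed.

Lemma pluriclosed_flow_coefficients :
  gab_flow_coefficients (n := n) (pluriclosed_flow R) 0 2.
Proof. by move=> y; split; ring. Qed.

End Coefficients.

Theorem mainTheorem6 (R : realType) (n : nat) (hn : (2 <= n)%N)
    (a : 'I_n -> R[i]) (ha : hopf_parameter a)
    (alpha0 beta0 : R) (halpha0 : 0 < alpha0) (hbeta0 : - alpha0 < beta0)
    (hg0 : BG_nonneg (gab (n := n) alpha0 beta0)) :
  [/\ (exists T g,
         hcf_solution a (gradient_flow R) (gab alpha0 beta0) T g) /\
      preserves_BG_nonneg a (gradient_flow R) (gab alpha0 beta0),
      ~ preserves_BG_nonneg a (ustinovskiy_flow R) (gab alpha0 beta0)
    & n <> 2%N ->
      ~ preserves_BG_nonneg a (pluriclosed_flow R) (gab alpha0 beta0)].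
Proof.
have s0 : 0 < alpha0 + beta0 by rewrite addrC -(opprK alpha0) subr_gt0.
have hn' : 2 <= n%:R :> R by rewrite ler_nat.
have n3 : n <> 2%N -> 3 <= n%:R :> R.
  by move=> h; rewrite ler_nat ltn_neqAle hn andbT eq_sym; apply/eqP.
split.
- apply: (gab_flow_preserves hn ha halpha0 s0 hg0 gradient_flow_coefficients) => //.
  + by rewrite divr_gt0 // mulr_gt0 //; lra.
  + by rewrite /critical_ratio; case: eqP => [e|/n3 h]; [rewrite e|]; nra.
- apply: (gab_flow_not_preserves hn ha halpha0 s0 ustinovskiy_flow_coefficients).
  + lra.
  + by rewrite /critical_ratio; case: eqP => _; lra.
- move=> h; have h3 := n3 h.
  apply: (gab_flow_not_preserves hn ha halpha0 s0 pluriclosed_flow_coefficients).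
  + lra.
  + by rewrite /critical_ratio; case: eqP => // _; lra.
Qed.
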